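(* Let $(\bar u,\bar\mu)\in\mathcal D$ and let $(u,\mu)$ be the (unique) global-in-time conservative solution of the generalized Hunter-Saxton system with initial datum $(\bar u,\bar\mu)$. Let $s\in\mathbb R$ be a time such that $\mu(s)$ is absolutely continuous with respect to the Lebesgue measure. Set $\tilde u(x)=u(x,s)$ and $$X(\xi,t)=\xi+\tilde u(\xi)t+\frac{t^2}{4}\int_{(-\infty,\xi)}\tilde u_x^2(z)\,dz,\qquad \xi,t\in\mathbb R.$$ Let $y(\alpha,t)$ be the characteristics associated with $(\bar u,\bar\mu)$ (see context). Then $$\tilde u\in C_b(\mathbb R),\qquad \tilde u_x\in L^2(\mathbb R),\qquad \|\tilde u_x\|_{L^2}^2=\bar\mu(\mathbb R),$$ and for any $t\in\mathbb R$, $$y(\cdot,t)=X(\cdot,t-s)\circ y(\cdot,s),\qquad \mu(t)=X(\cdot,t-s)\#(\tilde u_x^2\,dx),$$ and $$u(x,t)=\frac{\partial}{\partial t}X(\xi,t-s)=\tilde u(\xi)+\frac{t-s}{2}\int_{(-\infty,\xi)}\tilde u_x^2(z)\,dz\quad\text{for } x=X(\xi,t-s).$$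
   Context: $\mathcal M_+(\mathbb R)$ is the set of finite positive Radon measures on $\mathbb R$ with the weak topology (testing against bounded continuous functions). $C_b(\mathbb R)$ is the space of bounded continuous functions with the sup norm. $\mathcal D$ is the set of pairs $(u,\mu)$ with $u\in C_b(\mathbb R)$, (weak derivative) $u_x\in L^2(\mathbb R)$, $\mu\in\mathcal M_+(\mathbb R)$, and $d\mu_{ac}=u_x^2\,dx$, where $\mu_{ac}$ is the absolutely continuous part of $\mu$ with respect to Lebesgue measure. For a measurable map $T$ and a measure $\nu$, $(T\#\nu)(E)=\nu(T^{-1}(E))$. The generalized Hunter-Saxton system is: $u_t+uu_x=\frac12\int_{-\infty}^x d\mu(t)$, $\ \mu_t+(u\mu)_x=0$, $\ d\mu_{ac}(t)=u_x^2(\cdot,t)\,dx$. Conservative solution: given $(\bar u,\bar\mu)\in\mathcal D$, a pair $(u(t),\mu(t))_{t\in\mathbb R}$ is a global-in-time conservative solution with initial datum $(\bar u,\bar\mu)$ if (1) $u\in C(\mathbb R;C_b(\mathbb R))\cap C^{1/2}_{loc}(\mathbb R\times\mathbb R)$, $u_t\in L^2_{loc}(\mathbb R\times\mathbb R)$, $u_x(\cdot,t)\in L^2(\mathbb R)$ for all $t$, and $\mu\in C(\mathbb R;\mathcal M_+(\mathbb R))$; (2) $(u(\cdot,0),\mu(0))=(\bar u,\bar\mu)$, and $d\mu(t)=u_x^2(x,t)\,dx$ for a.e. $t\in\mathbb R$; (3) $\int_{\mathbb R}\int_{\mathbb R}\big[u\phi_t-\phi(uu_x-\tfrac12F)\big]\,dx\,dt=0$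 for all $\phi\in C_c^\infty(\mathbb R\times\mathbb R)$, where $F(x,t)=\int_{-\infty}^x d\mu(t)$ (well defined for a.e. $t$ by (2)); (4) $\int_{\mathbb R}\int_{\mathbb R}(\phi_t+u\phi_x)\,d\mu(t)\,dt=0$ for all $\phi\in C_c^\infty(\mathbb R\times\mathbb R)$; (5) $d\mu_{ac}(t)=u_x^2(\cdot,t)\,dx$ for all $t\in\mathbb R$. Such a solution exists and is unique for every $(\bar u,\bar\mu)\in\mathcal D$; it is given by $u(y(\alpha,t),t)=\partial_t y(\alpha,t)$, $\mu(t)=y(\cdot,t)\#(f\,d\alpha)$ with the following notation. Characteristics: for $\alpha\in\mathbb R$, $\bar x(\alpha)$ is the unique real number with $\bar x(\alpha)+\bar\mu((-\infty,\bar x(\alpha)))\le\alpha\le\bar x(\alpha)+\bar\mu((-\infty,\bar x(\alpha)])$; $f(\alpha)=1-\bar x'(\alpha)$; and $y(\alpha,t)=\bar x(\alpha)+\bar u(\bar x(\alpha))t+\frac{t^2}{4}(\alpha-\bar x(\alpha))$. *)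

(* Defs.v *)
From HB Require Import structures.
From mathcomp Require Import all_boot all_order all_algebra.
From mathcomp Require Import all_classical all_reals all_analysis.

Set Implicit Arguments.
Unset Strict Implicit.
Unset Printing Implicit Defensive.

Import Order.TTheory GRing.Theory Num.Theory.
Import numFieldNormedType.Exports.

Local Open Scope classical_set_scope.
Local Open Scope ring_scope.

Section FunctionSpaces.
Context {R : realType}.

Definition Cb (f : R -> R) : Prop := continuous f /\ bounded_fun f.

(* In finite dimension, having continuous iterated directional derivatives up
   to order [k] in all directions is the usual notion of class C^k. *)
Fixpoint class_C (V : normedModType R) (k : nat) (f : V -> R) : Prop :=
  if k is k'.+1 then
    continuous f /\
    forall v : V, (forall x, derivable f x v) /\ class_C k' ('D_v f)
  else continuous f.

Definition test_function (V : normedModType R) (phi : V -> R) : Prop :=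
  (forall k, class_C k phi) /\ compact (closure [set x | phi x != 0]).

Definition weak_derivative (f g : R -> R) : Prop :=
  locally_integrable setT g /\
  forall phi : R -> R, test_function phi ->
    \int[lebesgue_measure]_x (f x * derive1 phi x) =
    - \int[lebesgue_measure]_x (g x * phi x).

Definition L2 (g : R -> R) : Prop :=
  g \in Lfun (@lebesgue_measure R) 2%:E.

(* For functions and test functions on the plane, a point is [(x, t)]. *)
Definition d_x (phi : R * R -> R) : R * R -> R := 'D_((1, 0) : R * R) phi.
Definition d_t (phi : R * R -> R) : R * R -> R := 'D_((0, 1) : R * R) phi.

Definition lebesgue2 := ((@lebesgue_measure R) \x (@lebesgue_measure R))%E.

Definition weak_t_derivative_L2loc (f g : R * R -> R) : Prop :=
  [/\ measurable_fun setT g,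
      forall K : set (R * R), compact K ->
        (\int[lebesgue2]_(p in K) ((g p) ^+ 2)%:E < +oo)%E &
      forall phi : R * R -> R, test_function phi ->
        \int[lebesgue2]_p (f p * d_t phi p) =
        - \int[lebesgue2]_p (g p * phi p)].

Definition half_holder_loc (f : R * R -> R) : Prop :=
  forall K : set (R * R), compact K ->
    exists C : R, forall p q, K p -> K q ->
      `|f p - f q| <= C * Num.sqrt `|p - q|.

End FunctionSpaces.

Section Measures.
Context {R : realType}.

(* On the real line, the finite positive Radon measures are exactly the
   finite positive Borel measures. *)
Definition Mplus := {finite_measure set (measurableTypeR R) -> \bar R}.

Definition weakly_continuous (mu : R -> Mplus) : Prop :=
  forall phi : R -> R, Cb phi -> continuous (fun t => \int[mu t]_x phi x).

Definition mutually_singular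
    (m1 m2 : {measure set (measurableTypeR R) -> \bar R}) : Prop :=
  exists N : set (measurableTypeR R),
    [/\ measurable N, m1 N = 0%E & m2 (~` N) = 0%E].

(* By uniqueness of the Lebesgue decomposition, [mac] is determined by [mu]
   on Borel sets. *)
Definition ac_part
    (mu mac : {measure set (measurableTypeR R) -> \bar R}) : Prop :=
  mac `<< lebesgue_measure /\
  exists ms : {measure set (measurableTypeR R) -> \bar R},
    mutually_singular ms lebesgue_measure /\
    forall A, measurable A -> mu A = (mac A + ms A)%E.

Definition sq_dx (g : R -> R) : set (measurableTypeR R) -> \bar R :=
  fun A => (\int[lebesgue_measure]_(x in A) ((g x) ^+ 2)%:E)%E.

Definition ac_part_is_sq_dx (mu : Mplus) (g : R -> R) : Prop :=
  exists mac : {measure set (measurableTypeR R) -> \bar R},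
    ac_part mu mac /\ forall A, measurable A -> mac A = sq_dx g A.

End Measures.
Arguments Mplus : clear implicits.

Section HunterSaxton.
Context {R : realType}.

Definition datum (u : R -> R) (mu : Mplus R) : Prop :=
  Cb u /\
  exists ux : R -> R,
    [/\ weak_derivative u ux, L2 ux & ac_part_is_sq_dx mu ux].

Definition cumulative (mu : R -> Mplus R) (x t : R) : R :=
  fine (mu t [set` `]-oo, x]]).

(* In what follows [u x t] stands for u(x,t). *)

(* the transport equation of the generalized Hunter-Saxton system,
   u_t + u u_x = F / 2, in the sense of distributions *)
Definition weak_velocity_equation (u ux : R -> R -> R) (mu : R -> Mplus R) :=
  forall phi : R * R -> R, test_function phi ->
    \int[lebesgue_measure]_t \int[lebesgue_measure]_x
      (u x t * d_t phi (x, t) -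
       phi (x, t) * (u x t * ux x t - 2^-1 * cumulative mu x t)) = 0.

(* mu_t + (u mu)_x = 0 in the sense of distributions *)
Definition weak_continuity_equation (u : R -> R -> R) (mu : R -> Mplus R) :=
  forall phi : R * R -> R, test_function phi ->
    \int[lebesgue_measure]_t \int[mu t]_x
      (d_t phi (x, t) + u x t * d_x phi (x, t)) = 0.

Definition solution_regularity
    (u ux : R -> R -> R) (mu : R -> Mplus R) : Prop :=
  [/\ (forall t, Cb (u ^~ t)) /\
      (forall t0, {uniform, (fun t => u ^~ t) @ t0 --> u ^~ t0}),
      half_holder_loc (fun p => u p.1 p.2),
      (exists ut, weak_t_derivative_L2loc (fun p => u p.1 p.2) ut),
      (forall t, weak_derivative (u ^~ t) (ux ^~ t) /\ L2 (ux ^~ t)) &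
      weakly_continuous mu].

(* [ux] is an arbitrary choice of representatives of the weak derivatives of
   the slices u(.,t); none of the conditions depends on this choice. *)
Definition conservative_solution (u0 : R -> R) (mu0 : Mplus R)
    (u : R -> R -> R) (mu : R -> Mplus R) : Prop :=
  exists ux : R -> R -> R,
    solution_regularity u ux mu /\
    [/\ (forall x, u x 0 = u0 x) /\
        (forall A, measurable A -> mu 0 A = mu0 A),
        {ae lebesgue_measure, forall t : R,
          forall A, measurable A -> mu t A = sq_dx (ux ^~ t) A},
        weak_velocity_equation u ux mu,
        weak_continuity_equation u mu &
        forall t, ac_part_is_sq_dx (mu t) (ux ^~ t)].

Definition xbar (mu0 : Mplus R) (alpha : R) : R :=
  get [set x : R | (x%:E + mu0 [set` `]-oo, x[] <= alpha%:E)%E /\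
                   (alpha%:E <= x%:E + mu0 [set` `]-oo, x]])%E].

Definition char_y (u0 : R -> R) (mu0 : Mplus R) (alpha t : R) : R :=
  xbar mu0 alpha + u0 (xbar mu0 alpha) * t
  + t ^+ 2 / 4 * (alpha - xbar mu0 alpha).

Definition sq_cumulative (g : R -> R) (xi : R) : R :=
  \int[lebesgue_measure]_(z in `]-oo, xi[) ((g z) ^+ 2).

Definition map_X (v vx : R -> R) (xi t : R) : R :=
  xi + v xi * t + t ^+ 2 / 4 * sq_cumulative vx xi.

End HunterSaxton.

(* Main.v *)
(* The characteristics are recovered from the weak formulation in the Lagrangian
   variable b = x + F(x, t), where F(., t) is the distribution function of mu(t).
   Since the absolutely continuous part of mu(t) is u_x^2 dx, AM-GM gives
   |u(x') - u(x)| <= (|x' - x| + |F(x') - F(x)|) / 2, so the velocity is a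
   1/2-Lipschitz function of b and the flow of b exists by Picard iteration.
   Testing the continuity equation with cut-offs that move along lines shows that
   F is constant along this flow, so that x' = b' = u. Averaging the velocity
   equation over [x(t), x(t) + e] with a smooth kernel, the flux error is bounded by
   mu(t)(]x(t), x(t) + e]), which vanishes with e; hence u grows at the constant
   rate F / 2 along a characteristic. This yields the quadratic formula for
   characteristics starting from any time, and the theorem compares the formula
   started at time 0 with the one started at time s, when F(., s) is continuous. *)

Require Import Defs.
From HB Require Import structures.
From mathcomp Require Import all_boot all_order all_algebra.
From mathcomp Require Import all_classical all_reals all_analysis.
From mathcomp Require Import measurable_realfun.
From mathcomp Require Import ring lra.

Set Implicit Arguments.
Unset Strict Implicit.
Unset Printing Implicit Defensive.

Import Order.TTheory GRing.Theory Num.Theory.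
Import numFieldNormedType.Exports.

Local Open Scope classical_set_scope.
Local Open Scope ring_scope.

(** * Smooth cut-offs *)

Section Smooth.
Context {R : realType}.

(** The velocity is only 1/2-Holder in [x], so [x' = u(x, t)] by itself need not determine its
    solutions, and at exceptional times [mu(t)] may have atoms, where [F(., t)] jumps and a whole
    interval of labels sits at one point. The coordinate [b] meets both obstacles: a pair (position,
    level) is a point of the graph of [F(., t)] completed by vertical segments, and the sum of its
    two coordinates parametrizes this monotone curve. This is why the open and the closed
    distribution function are carried along side by side. Test functions have to be smooth, whereas
    a characteristic is a priori only a differentiable curve; the weak equations are therefore
    exploited in frames that move with constant speed, and a curve is replaced by its tangent line
    up to o(h). At a time with an atom on the characteristic the value [F / 2] is ambiguous, but the
    rate is integrated in time, and for almost every [t] the measure is [u_x^2 dx], so that the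
    level is the value of [F]. *)

Lemma class_C_continuous (V : normedModType R) k (f : V -> R) :
  class_C k f -> continuous f.
Proof. by case: k => [|k] //= []. Qed.

Lemma class_CS (V : normedModType R) k (f : V -> R) :
  class_C k.+1 f -> class_C k f.
Proof.
elim: k f => [|k IH] f; first by case.
by move=> [cf df]; split=> // v; have [dv /IH] := df v.
Qed.

Lemma class_CD (V : normedModType R) k (f g : V -> R) :
  class_C k f -> class_C k g -> class_C k (f + g).
Proof.
elim: k f g => [|k IH] f g /= => [cf cg x|[cf df] [cg dg]].
  by apply: continuousD; [exact: cf|exact: cg].
split=> [x|v]; first by apply: continuousD; [exact: cf|exact: cg].
have [dfv fk] := df v; have [dgv gk] := dg v.
split=> [x|]; first exact: derivableD.
rewrite [X in class_C _ X](_ : _ = 'D_v f + 'D_v g); first exact: IH.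
by apply/funext => x; rewrite deriveD.
Qed.

Lemma class_CM (V : normedModType R) k (f g : V -> R) :
  class_C k f -> class_C k g -> class_C k (f * g).
Proof.
elim: k f g => [|k IH] f g /=.
  by move=> cf cg x; apply: continuousM; [exact: cf|exact: cg].
move=> Cf Cg; have [[cf df] [cg dg]] := (Cf, Cg).
split=> [x|v]; first by apply: continuousM; [exact: cf|exact: cg].
have [dfv fk] := df v; have [dgv gk] := dg v.
split=> [x|]; first exact: derivableM.
rewrite [X in class_C _ X](_ : _ = f * 'D_v g + g * 'D_v f).
  by apply: class_CD; apply: IH => //; exact: class_CS.
by apply/funext => x; rewrite deriveM.
Qed.

Lemma class_C_cst (V : normedModType R) k (c : R) : class_C k (cst c : V -> R).
Proof.
elim: k c => [|k IH] c /=; first by move=> x; exact: cst_continuous.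
split=> [x|v]; first exact: cst_continuous.
split=> [x|]; first exact: derivable_cst.
rewrite [X in class_C _ X](_ : _ = cst 0); first exact: IH.
by apply/funext => x; rewrite derive_cst.
Qed.

Lemma class_CV (V : normedModType R) k (f : V -> R) :
  (forall x, f x != 0) -> class_C k f -> class_C k (fun x => (f x)^-1).
Proof.
move=> f0; elim: k => [|k IH] /=.
  by move=> cf x; apply: continuousV => //; exact: cf.
move=> Cf; have [cf df] := Cf.
split=> [x|v]; first by apply: continuousV => //; exact: cf.
have [dfv fk] := df v; split=> [x|]; first exact: derivableV.
have fV := IH (class_CS Cf).
rewrite [X in class_C _ X](_ : _ =
    cst (-1) * ((fun x => (f x)^-1) * ((fun x => (f x)^-1) * 'D_v f))).
  apply: class_CM; first exact: class_C_cst.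
  by apply: class_CM => //; exact: class_CM.
apply/funext => x; rewrite deriveV// /GRing.mul/=.
by rewrite /GRing.scale/= expr2 invfM mulN1r mulNr !mulrA.
Qed.

(** As [l] is affine with linear part [l0], the difference quotients of [a \o l] along [v] are
    literally those of [a] along [l0 v]; the induction needs no chain rule. *)
Lemma class_C_comp_affine (V : normedModType R) k (a : R -> R) (l l0 : V -> R) :
  continuous l -> (forall x v h, l (h *: v + x) = h * l0 v + l x) ->
  class_C k a -> class_C k (a \o l).
Proof.
move=> cl hl; elim: k a => [|k IH] a /=.
  by move=> ca x; apply: continuous_comp; [exact: cl|exact: ca].
move=> [ca da]; split=> [x|v].
  by apply: continuous_comp; [exact: cl|exact: ca].
have [dav ak] := da (l0 v).
have E x : (fun h : R => h^-1 *: (((a \o l) \o shift x) (h *: v) - (a \o l) x)) =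
    (fun h : R => h^-1 *: ((a \o shift (l x)) (h *: l0 v) - a (l x))).
  by apply/funext => h /=; rewrite hl.
split=> [x|].
  by rewrite /derivable E; exact: dav.
rewrite [X in class_C _ X](_ : _ = 'D_(l0 v) a \o l); first exact: IH.
by apply/funext => x; rewrite /derive E.
Qed.

Lemma is_derive_dir (f : R -> R) (x v df : R) :
  is_derive x 1 f df -> is_derive x v f (v * df).
Proof.
move=> Hf; have dfx : differentiable f x by apply/derivable1_diffP; apply: ex_derive.
have [_ D1] := Hf.
apply: DeriveDef; first exact: diff_derivable.
rewrite deriveE// -[v in 'd f x v]mulr1 linearZ/= -deriveE// D1.
by [].
Qed.

Lemma derive1_eq (f : R -> R) (x df : R) : is_derive x 1 f df -> derive1 f x = df.
Proof. by move=> [_ H]; rewrite derive1E. Qed.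

(** The powers of [x^-1] are built in so that the family is closed under differentiation up to
    linear combinations; smoothness is then a plain induction. *)
Definition flat (n : nat) (x : R) : R :=
  if 0 < x then x^-1 ^+ n * expR (- x^-1) else 0.

Lemma flat_gt0 n x : 0 < x -> 0 < flat n x.
Proof. by move=> x0; rewrite /flat x0 mulr_gt0 ?expR_gt0 ?exprn_gt0 ?invr_gt0. Qed.

Lemma flat_ge0 n x : 0 <= flat n x.
Proof. by case: (ltP 0 x) => x0; [exact/ltW/flat_gt0|rewrite /flat ltNge x0]. Qed.

Lemma flat_eq0 n x : x <= 0 -> flat n x = 0.
Proof. by move=> x0; rewrite /flat ltNge x0. Qed.

(** The exponential series gives [expR y >= y ^+ n.+2 / n.+2!] at [y = x^-1]. The quadratic bound is
    what makes the derivative at the origin vanish. *)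
Lemma flat_bound n x : flat n x <= (n.+2)`!%:R * x ^+ 2.
Proof.
case: (ltP 0 x) => x0; last first.
  by rewrite flat_eq0// mulr_ge0// sqr_ge0.
rewrite /flat x0 expRN.
have y0 : 0 < x^-1 by rewrite invr_gt0.
have F0 : (0 : R) < (n.+2)`!%:R by rewrite ltr0n fact_gt0.
have := expR_ge1Dxn n.+1 (ltW y0).
set E := expR _ => HE.
have E0 : 0 < E by exact: expR_gt0.
rewrite ler_pdivrMr// -ler_pdivrMl ?mulr_gt0 ?exprn_gt0//.
apply: le_trans HE.
rewrite ler_wpDl//.
have xn0 : x != 0 by rewrite gt_eqF.
have Fn0 : ((n.+2)`!%:R : R) != 0 by rewrite gt_eqF.
rewrite le_eqVlt; apply/orP; left; apply/eqP; rewrite !exprS !exprVn.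
by field; rewrite expf_neq0 ?xn0//= Fn0.
Qed.

Lemma is_derive_quadratic_bound (f : R -> R) (C x : R) :
  (forall h, `|f (x + h) - f x| <= C * h ^+ 2) -> is_derive x 1 f 0.
Proof.
move=> H.
have C0 : 0 <= C by have := le_trans (normr_ge0 _) (H 1); rewrite expr1n mulr1.
have L : h^-1 *: ((f \o shift x) (h *: 1) - f x) @[h --> 0^'] --> (0 : R).
  apply/cvgr0Pnorm_le => e e0; near=> h.
  have h0 : h != 0 by near: h; exact: nbhs_dnbhs_neq.
  rewrite /= /GRing.scale/= mulr1 normrM normfV [h + x]addrC.
  rewrite ler_pdivrMl ?normr_gt0//; apply: le_trans (H h) _.
  rewrite -real_normK ?num_real// expr2 mulrCA ler_wpM2l//.
  have : `|h| <= e / (C + 1).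
    near: h; apply: dnbhs0_le; rewrite divr_gt0// ltr_wpDl//.
  move=> hh; apply: le_trans (_ : C * (e / (C + 1)) <= _); first by rewrite ler_wpM2l.
  by rewrite mulrCA ger_pMr// ler_pdivrMr ?ltr_wpDl// mul1r lerDl.
apply: DeriveDef; first by apply/cvg_ex; exists 0.
exact: cvg_lim L.
Unshelve. all: by end_near. Qed.

Lemma is_derive_flat n x :
  is_derive (x : R) (1 : R) (flat n) (flat n.+2 x - n%:R * flat n.+1 x).
Proof.
have [x0|x0|->] := ltgtP x 0.
- rewrite !flat_eq0 ?ltW// mulr0 subr0.
  apply: near_eq_is_derive (is_derive_cst (0 : R) x 1) => //.
  near=> y; rewrite /= flat_eq0//; apply: ltW; near: y; exact: lt_nbhsl.
- have H : is_derive x 1 ((fun y : R => y^-1 ^+ n) * (expR \o (fun y => - y^-1)))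
      (flat n.+2 x - n%:R * flat n.+1 x).
    have xn0 : x != 0 by rewrite gt_eqF.
    have dV : is_derive x 1 (fun y : R => y^-1) (- x ^- 2).
      have := is_deriveV (f := id : R -> R) xn0 (is_derive_id x 1).
      by rewrite /GRing.scale/= mulr1.
    have dN : is_derive x 1 (fun y : R => - y^-1) (x ^- 2).
      by have := is_deriveN dV; rewrite opprK.
    have dE := @is_derive1_comp R expR (fun y : R => - y^-1) x _ _ (is_derive_expR (- x^-1)) dN.
    have dX : is_derive x 1 (fun y : R => y^-1 ^+ n)
        ((n%:R * x^-1 ^+ n.-1) *: (- x ^- 2)).
      by have := is_deriveX n dV; rewrite exprfctE.
    suff -> : flat n.+2 x - n%:R * flat n.+1 x =
        x^-1 ^+ n *: (expR (- x^-1) / x ^+ 2) +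
        expR (- x^-1) *: ((n%:R * x^-1 ^+ n.-1) *: (- x ^- 2)).
      exact: is_deriveM.
    rewrite /GRing.scale/= /flat x0; clear dE dX dV dN.
    case: n => [|n] /=; rewrite ?exprVn !exprS ?expr0.
      by field.
    by field; rewrite xn0 expf_neq0.
  apply: near_eq_is_derive H => //.
  near=> y; rewrite /flat ifT//; near: y; exact: lt_nbhsr.
- rewrite !flat_eq0// mulr0 subr0.
  apply: (@is_derive_quadratic_bound _ (n.+2)`!%:R) => h.
  by rewrite add0r (flat_eq0 n (lexx 0)) subr0 ger0_norm ?flat_ge0// flat_bound.
Unshelve. all: by end_near. Qed.

Lemma flat_class_C k n : class_C k (flat n).
Proof.
have cf m : continuous (flat m).
  move=> x; apply: differentiable_continuous; apply/derivable1_diffP.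
  by have [] := is_derive_flat m x.
elim: k n => [|k IH] n /=; first exact: cf.
split=> [|v]; first exact: cf.
split=> [x|]; first by have [] := is_derive_dir v (is_derive_flat n x).
rewrite [X in class_C _ X](_ : _ =
    cst v * (flat n.+2 + cst (- n%:R) * flat n.+1)).
  apply: class_CM; first exact: class_C_cst.
  apply: class_CD => //; apply: class_CM => //; exact: class_C_cst.
apply/funext => x; have [_ ->] := is_derive_dir v (is_derive_flat n x).
by rewrite /GRing.add/= /GRing.mul/= /cst mulNr.
Qed.

Definition step_den (x : R) : R := flat 0 x + flat 0 (1 - x).

Lemma step_den_gt0 x : 0 < step_den x.
Proof.
rewrite /step_den; case: (ltP 0 x) => x0.
  by rewrite ltr_pwDl ?flat_gt0 ?flat_ge0.
by rewrite ltr_wpDl ?flat_ge0// flat_gt0// subr_gt0 (le_lt_trans x0).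
Qed.

Definition step (x : R) : R := flat 0 x / step_den x.

(** The derivative of [step] after cancellation in the quotient rule; in this form its sign and its
    support in [[0, 1]] can be read off. *)
Definition bump (x : R) : R :=
  (flat 2 x * flat 0 (1 - x) + flat 0 x * flat 2 (1 - x)) / step_den x ^+ 2.

Lemma step_class_C k : class_C k step.
Proof.
apply: (@class_CM _ k (flat 0) (fun x => (step_den x)^-1)).
  exact: flat_class_C.
apply: class_CV => [x|]; first by rewrite gt_eqF// step_den_gt0.
apply: class_CD; first exact: flat_class_C.
apply: (@class_C_comp_affine R k (flat 0) (fun x => 1 - x) (fun x => - x)).
- move=> x; apply: continuousB; [exact: cst_continuous|exact: cvg_id].
- by move=> x v h; rewrite /GRing.scale/=; ring.
- exact: flat_class_C.
Qed.

Lemma is_derive_step x : is_derive (x : R) (1 : R) step (bump x).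
Proof.
have d0 := is_derive_flat 0 x.
have d1 : is_derive x 1 (fun x => flat 0 (1 - x)) (- flat 2 (1 - x)).
  have dl : is_derive x 1 (fun x : R => 1 - x) (-1).
    by have := is_deriveB (is_derive_cst (1 : R) x 1) (is_derive_id x 1);
       rewrite sub0r.
  have := @is_derive1_comp R (flat 0) (fun x : R => 1 - x) x _ _ (is_derive_flat 0 (1 - x)) dl.
  by rewrite mul0r subr0 mulrN1.
have dd : is_derive x 1 step_den (flat 2 x - flat 2 (1 - x)).
  by have := is_deriveD d0 d1; rewrite mul0r subr0.
have dn : step_den x != 0 by rewrite gt_eqF// step_den_gt0.
have dv := is_deriveV dn dd.
suff -> : bump x = flat 0 x *: (- step_den x ^- 2 *: (flat 2 x - flat 2 (1 - x))) +
     (step_den x)^-1 *: (flat 2 x - 0 * flat 1 x) by exact: is_deriveM.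
rewrite /GRing.scale/= mul0r subr0 /bump.
have E : flat 0 x = step_den x - flat 0 (1 - x) by rewrite /step_den addrK.
rewrite E; set a := flat 0 (1 - x); set d := step_den x.
by field.
Qed.

Lemma bump_class_C k : class_C k bump.
Proof.
have [_ /(_ 1)[_]] : class_C k.+1 step by exact: step_class_C.
suff -> : 'D_1 step = bump by [].
by apply/funext => x; have [_ ->] := is_derive_step x.
Qed.

Lemma bump_ge0 x : 0 <= bump x.
Proof.
by rewrite divr_ge0 ?sqr_ge0// addr_ge0// mulr_ge0// flat_ge0.
Qed.

Lemma bump_le0 x : x <= 0 -> bump x = 0.
Proof. by move=> x0; rewrite /bump !(flat_eq0 _ x0) !mul0r addr0 mul0r. Qed.

Lemma bump_ge1 x : 1 <= x -> bump x = 0.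
Proof.
move=> x1; rewrite /bump.
by rewrite !(@flat_eq0 _ (1 - x)) ?subr_le0// !mulr0 addr0 mul0r.
Qed.

Lemma step_le0 x : x <= 0 -> step x = 0.
Proof. by move=> x0; rewrite /step (flat_eq0 _ x0) mul0r. Qed.

Lemma step_ge1 x : 1 <= x -> step x = 1.
Proof.
move=> x1; rewrite /step /step_den (@flat_eq0 _ (1 - x)) ?subr_le0// addr0.
by rewrite divff// gt_eqF// flat_gt0// (lt_le_trans _ x1).
Qed.

Lemma step_ge0 x : 0 <= step x.
Proof. by rewrite divr_ge0 ?flat_ge0// ltW// step_den_gt0. Qed.

Lemma step_le1 x : step x <= 1.
Proof. by rewrite ler_pdivrMr ?step_den_gt0// mul1r lerDl flat_ge0. Qed.

End Smooth.

(** * Integration against cut-offs *)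

Section Integration.
Context {R : realType}.

Lemma bounded_funP (T : Type) (f : T -> R) :
  bounded_fun f <-> exists M, forall x, `|f x| <= M.
Proof.
split=> [[M [_ HM]]|[M HM]].
  by exists (M + 1) => x; apply: HM => //; rewrite ltrDl.
exists M; split; first exact: num_real.
by move=> y My x _; rewrite /= (le_trans (HM x))// ltW.
Qed.

Lemma Rdominated_convergence d (T : measurableType d)
    (mu : {measure set T -> \bar R}) (D : set T) (f_ : nat -> T -> R) (f h : T -> R) :
  measurable D ->
  (forall n, measurable_fun D (f_ n)) -> measurable_fun D f ->
  {ae mu, forall x, D x -> f_ n x @[n --> \oo] --> f x} ->
  mu.-integrable D (EFin \o h) -> (forall n x, D x -> `|f_ n x| <= h x) ->
  (\int[mu]_(x in D) f_ n x) @[n --> \oo] --> \int[mu]_(x in D) f x.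
Proof.
move=> mD mf_ mf cf ih fh.
have [|||||fi _ cvi] := @dominated_convergence _ T R mu D mD
    (fun n => EFin \o f_ n) (EFin \o f) (EFin \o h).
- by move=> n; apply/measurable_EFinP.
- exact/measurable_EFinP.
- apply: filterS cf => x cx Dx; exact/cvg_EFin/cx/Dx/nearW.
- exact: ih.
- by apply/aeW => x n Dx /=; rewrite lee_fin; exact: fh.
apply: fine_cvg; rewrite fineK//; exact: integrable_fin_num.
Qed.

Notation mu := (@lebesgue_measure R).

Lemma integrable_restrict d (T : measurableType d)
    (nu : {measure set T -> \bar R}) (D : set T) (f : T -> R) :
  measurable D -> (forall x, ~ D x -> f x = 0) ->
  nu.-integrable D (EFin \o f) -> nu.-integrable setT (EFin \o f).
Proof.
move=> mD f0 /(integrable_mkcond _ mD).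
rewrite (_ : (EFin \o f) \_ D = EFin \o f)//; apply/funext => x.
by rewrite patchE; case: ifPn => // /negP; rewrite inE => /f0 /= ->.
Qed.

Lemma Rintegral_restrict d (T : measurableType d)
    (nu : {measure set T -> \bar R}) (D : set T) (f : T -> R) :
  (forall x, ~ D x -> f x = 0) -> \int[nu]_x f x = \int[nu]_(x in D) f x.
Proof.
move=> f0; rewrite [RHS]Rintegral_mkcond; apply: eq_Rintegral => x _.
by rewrite patchE; case: ifPn => // /negP; rewrite inE => /f0 ->.
Qed.

Lemma integrable_csupp (f : R -> R) (a b : R) :
  continuous f -> (forall x, x \notin `[a, b] -> f x = 0) ->
  mu.-integrable setT (EFin \o f).
Proof.
move=> cf f0; apply: (@integrable_restrict _ _ mu `[a, b]%classic) => //.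
- by move=> x /negP xab; exact: f0.
apply: continuous_compact_integrable; first exact: segment_compact.
exact: continuous_subspaceT.
Qed.

Lemma locally_integrable_itv (g : R -> R) (a b : R) :
  locally_integrable setT g -> mu.-integrable `[a, b] (EFin \o g).
Proof.
move=> [mg _ Hg]; apply/integrableP; split.
  by apply/measurable_EFinP; exact: measurable_funS mg.
by apply: Hg => //; exact: segment_compact.
Qed.

Lemma continuous_bounded_itv (f : R -> R) (a b : R) : continuous f ->
  exists2 M, 0 <= M & forall x, x \in `[a, b] -> `|f x| <= M.
Proof.
move=> cf; have [|M [_ HM]] := @compact_bounded R R^o (f @` `[a, b]).
  by apply: continuous_compact; [exact: continuous_subspaceT|exact: segment_compact].
exists (`|M| + 1); first by rewrite addr_ge0.
move=> x xab; apply: (HM (`|M| + 1)); last by exists x.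
by rewrite ltr_pwDr// ler_norm.
Qed.

Lemma integrable_mul_csupp (f g : R -> R) (a b : R) :
  continuous f -> (forall x, x \notin `[a, b] -> f x = 0) ->
  locally_integrable setT g -> mu.-integrable setT (EFin \o (fun x => g x * f x)).
Proof.
move=> cf f0 ig; apply: (@integrable_restrict _ _ mu `[a, b]%classic) => //.
  by move=> x /negP xab; rewrite f0// mulr0.
have mab : measurable (`[a, b]%classic : set (measurableTypeR R)) by [].
apply: (integrableMl mab (locally_integrable_itv a b ig)).
  by apply: measurable_funTS; exact: continuous_measurable_fun.
have [M _ HM] := continuous_bounded_itv a b cf.
exists M; split; first by rewrite num_real.
by move=> y My x xab; rewrite /= (le_trans (HM x xab))// ltW.
Qed.

Lemma continuous_locally_integrable (g : R -> R) :
  continuous g -> locally_integrable setT g.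
Proof.
move=> cg; split; [exact: continuous_measurable_fun|exact: openT|].
move=> K _ cK.
have /integrableP[] := @continuous_compact_integrable R g K cK
  (continuous_subspaceT cg).
by [].
Qed.

Lemma integrable_continuous_itv (g : R -> R) (a b : R) : continuous g ->
  mu.-integrable `[a, b] (EFin \o g).
Proof. by move=> cg; exact/locally_integrable_itv/continuous_locally_integrable. Qed.

Lemma derive1_out (f : R -> R) (a b x : R) :
  (forall y, y \notin `[a, b] -> f y = 0) -> x \notin `[a, b] -> derive1 f x = 0.
Proof.
move=> f0 xab; apply: derive1_eq.
apply: (@near_eq_is_derive _ _ _ (cst 0)) (is_derive_cst (0 : R) x 1).
have oab : open (~` `[a, b]%classic : set R).
  by apply: closed_openC; exact: itv_closed.
have : nbhs x (~` `[a, b]%classic) by apply: open_nbhs_nbhs; split => //; exact/negP.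
by apply: filterS => y /= /negP yab; rewrite f0.
Qed.

Lemma is_derive_affine (a e x : R) : is_derive x 1 (fun x : R => (x - a) / e) e^-1.
Proof.
have d1 : is_derive x 1 (fun x : R => x - a) 1.
  by have := is_deriveB (is_derive_id x 1) (is_derive_cst (a : R) x 1); rewrite subr0.
have := is_deriveM d1 (is_derive_cst (e^-1 : R) x 1).
by rewrite scaler0 add0r /GRing.scale/= mulr1.
Qed.

Lemma compact_support_itv (f : R -> R) (a b : R) :
  (forall x, x \notin `[a, b] -> f x = 0) -> compact (closure [set x | f x != 0]).
Proof.
move=> f0; apply: (@subclosed_compact _ _ `[a, b]%classic).
- exact: closed_closure.
- exact: segment_compact.
rewrite closureEbigcap; apply: bigcap_inf; split; first exact: itv_closed.
move=> x /= fx; apply/negPn/negP => /f0/eqP; exact/negP.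
Qed.

Lemma test_function_supp (f : R -> R) : test_function f ->
  exists a b, forall x, x \notin `[a, b] -> f x = 0.
Proof.
move=> [_ /compact_bounded[M [_ HM]]]; exists (- (M + 1)), (M + 1) => x.
apply: contraNeq => fx; rewrite in_itv/= -ler_norml.
apply: (HM (M + 1)); first by rewrite ltrDl.
exact: subset_closure.
Qed.

Lemma test_function_continuous (V : normedModType R) (f : V -> R) :
  test_function f -> continuous f.
Proof. by move=> [/(_ 0%N)]. Qed.

Lemma test_function_is_derive (f : R -> R) (x : R) :
  test_function f -> is_derive x 1 f (derive1 f x).
Proof.
move=> [/(_ 1%N)[_ /(_ 1)[df _]] _]; rewrite derive1E; exact: derivableP.
Qed.

Lemma test_function_derive1 (f : R -> R) : test_function f ->
  test_function (derive1 f).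
Proof.
move=> tf; have [a [b f0]] := test_function_supp tf.
split=> [k|].
  have [/(_ k.+1)[_ /(_ 1)[_]]] := tf.
  by rewrite (_ : 'D_1 f = derive1 f)//; apply/funext => x; rewrite derive1E.
by apply: (@compact_support_itv _ a b) => x; exact: derive1_out.
Qed.

Lemma test_function_bounded (f : R -> R) : test_function f ->
  exists M, forall x, `|f x| <= M.
Proof.
move=> tf; have [a [b f0]] := test_function_supp tf.
have [M M0 HM] := continuous_bounded_itv a b (test_function_continuous tf).
exists M => x; case: (boolP (x \in `[a, b])) => [|/f0 ->]; first exact: HM.
by rewrite normr0.
Qed.

Lemma test_function_lipschitz (f : R -> R) : test_function f ->
  exists L, 0 <= L /\ forall x y, `|f x - f y| <= L * `|x - y|.
Proof.
move=> tf; have [L HL] := test_function_bounded (test_function_derive1 tf).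
exists L; split; first exact: le_trans (HL 0).
have H x y : x <= y -> `|f y - f x| <= L * `|y - x|.
  move=> xy; have [] := @MVT_segment R f (derive1 f) x y xy.
  - by move=> z _; exact: test_function_is_derive.
  - exact/continuous_subspaceT/test_function_continuous.
  by move=> z _ ->; rewrite normrM ler_wpM2r.
move=> x y; case: (leP x y) => [xy|/ltW xy]; last exact: H.
by rewrite distrC [X in _ * X]distrC; exact: H.
Qed.

(** The transition takes place to the right of [a], so that [1 - ramp a e] decreases to the
    indicator of the closed half-line []-oo, a]] as [e] tends to 0. Its derivative [kern a e] is a
    one-sided mollifier of mass one. *)
Definition ramp (a e x : R) : R := step ((x - a) / e).

Definition kern (a e x : R) : R := e^-1 * bump ((x - a) / e).

Lemma class_C_affine (f : R -> R) k (a e : R) :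
  class_C k f -> class_C k (fun x => f ((x - a) / e)).
Proof.
apply: (@class_C_comp_affine R R k f (fun x => (x - a) / e) (fun x => x / e)).
  move=> x; apply: cvgM; last exact: cvg_cst.
  by apply: cvgB; [exact: cvg_id|exact: cvg_cst].
by move=> x v h; rewrite /GRing.scale/=; ring.
Qed.

Lemma ramp_class_C k a e : class_C k (ramp a e).
Proof. exact/class_C_affine/step_class_C. Qed.

Lemma kern_class_C k a e : class_C k (kern a e).
Proof.
apply: (@class_CM _ _ k (cst e^-1)); first exact: class_C_cst.
exact/class_C_affine/bump_class_C.
Qed.

Lemma is_derive_ramp (a e x : R) : is_derive x 1 (ramp a e) (kern a e x).
Proof.
have := @is_derive1_comp R step (fun x : R => (x - a) / e) x _ _
  (is_derive_step ((x - a) / e)) (is_derive_affine a e x).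
by rewrite mulrC.
Qed.

Lemma ramp_ge0 a e x : 0 <= ramp a e x. Proof. exact: step_ge0. Qed.
Lemma ramp_le1 a e x : ramp a e x <= 1. Proof. exact: step_le1. Qed.

Lemma ramp_le a e x : 0 < e -> x <= a -> ramp a e x = 0.
Proof.
by move=> e0 xa; rewrite /ramp step_le0// ler_pdivrMr// mul0r subr_le0.
Qed.

Lemma ramp_ge a e x : 0 < e -> a + e <= x -> ramp a e x = 1.
Proof.
by move=> e0 xa; rewrite /ramp step_ge1// ler_pdivlMr// mul1r lerBrDl.
Qed.

Lemma kern_ge0 a e x : 0 < e -> 0 <= kern a e x.
Proof. by move=> e0; rewrite mulr_ge0 ?bump_ge0// invr_ge0 ltW. Qed.

Lemma kern_out a e x : 0 < e -> x \notin `[a, a + e] -> kern a e x = 0.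
Proof.
move=> e0; rewrite in_itv/= negb_and -!ltNge => /orP[xa|xa]; rewrite /kern.
  by rewrite bump_le0 ?mulr0// ler_pdivrMr// mul0r subr_le0 ltW.
by rewrite bump_ge1 ?mulr0// ler_pdivlMr// mul1r lerBrDl ltW.
Qed.

Lemma kern_continuous a e : continuous (kern a e).
Proof. exact: (class_C_continuous (kern_class_C 0 a e)). Qed.

Lemma ramp_continuous a e : continuous (ramp a e).
Proof. exact: (class_C_continuous (ramp_class_C 0 a e)). Qed.

Lemma kern_test a e : 0 < e -> test_function (kern a e).
Proof.
move=> e0; split; first by move=> k; exact: kern_class_C.
by apply: (@compact_support_itv _ a (a + e)) => x; exact: kern_out.
Qed.

Lemma bump_bounded : exists2 K : R, 0 < K & forall x, `|bump x| <= K.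
Proof.
have := @test_function_bounded (kern 0 1) (kern_test 0 ltr01) => -[M HM].
exists (`|M| + 1); first by rewrite ltr_wpDl.
move=> x; apply: le_trans (_ : M <= _); last first.
  by apply: le_trans (ler_norm M) _; rewrite lerDl.
by have := HM x; rewrite /kern subr0 divr1 invr1 mul1r.
Qed.

(** The two flanks have independent widths: for the transport of mass the left one becomes ever
    flatter while the right one becomes ever steeper. *)
Lemma trapezoid_class_C k a e b d : class_C k (fun x => ramp a e x - ramp b d x).
Proof.
rewrite (_ : (fun _ => _) = ramp a e + cst (-1) * ramp b d).
  apply: class_CD; first exact: ramp_class_C.
  apply: class_CM; first exact: class_C_cst.
  exact: ramp_class_C.
by apply/funext => x; rewrite /GRing.add/= /GRing.mul/= /cst mulN1r.
Qed.

Lemma trapezoid_out a e b d x : 0 < e -> 0 < d -> a <= b -> a + e <= b + d ->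
  x \notin `[a, b + d] -> ramp a e x - ramp b d x = 0.
Proof.
move=> e0 d0 ab aebd; rewrite in_itv/= negb_and -!ltNge => /orP[xa|xb].
  by rewrite !ramp_le ?subr0// ltW// (lt_le_trans xa).
by rewrite !ramp_ge ?subrr// ltW// (le_lt_trans aebd).
Qed.

Lemma trapezoid_test a e b d : 0 < e -> 0 < d -> a <= b -> a + e <= b + d ->
  test_function (fun x => ramp a e x - ramp b d x).
Proof.
move=> e0 d0 ab aebd; split; first by move=> k; exact: trapezoid_class_C.
by apply: (@compact_support_itv _ a (b + d)) => x; exact: trapezoid_out.
Qed.

Lemma is_derive_trapezoid (a e b d x : R) :
  is_derive x 1 (fun x => ramp a e x - ramp b d x) (kern a e x - kern b d x).
Proof. exact: (is_deriveB (is_derive_ramp a e x) (is_derive_ramp b d x)). Qed.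

Lemma Rintegral_kern a e : 0 < e -> \int[mu]_x kern a e x = 1.
Proof.
move=> e0; rewrite (@Rintegral_restrict _ _ mu `[a, a + e]%classic); last first.
  by move=> x /negP; exact: kern_out.
rewrite /Rintegral (@continuous_FTC2 R (kern a e) (ramp a e)) ?ltrDl//.
- by rewrite (@ramp_le a e a)// (@ramp_ge a e (a + e))//= subr0.
- exact/continuous_subspaceT/kern_continuous.
- split.
  + by move=> x _; have [] := is_derive_ramp a e x.
  + exact/cvg_at_right_filter/ramp_continuous.
  + exact/cvg_at_left_filter/ramp_continuous.
- by move=> x _; rewrite derive1E; have [_ ->] := is_derive_ramp a e x.
Qed.

Lemma kern_average (f : R -> R) (a e c h : R) : 0 < e -> continuous f ->
  (forall x, x \in `[a, a + e] -> `|f x - c| <= h) ->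
  `|\int[mu]_x (f x * kern a e x) - c| <= h.
Proof.
move=> e0 cf fc.
have ik : mu.-integrable setT (EFin \o kern a e).
  apply: (@integrable_csupp _ a (a + e)); first exact: kern_continuous.
  by move=> x; exact: kern_out.
have cfk (g : R -> R) : continuous g ->
    mu.-integrable setT (EFin \o (fun x => g x * kern a e x)).
  move=> cg; apply: (@integrable_mul_csupp (kern a e) g a (a + e)).
  - exact: kern_continuous.
  - by move=> x; exact: kern_out.
  - exact: continuous_locally_integrable.
have -> : \int[mu]_x (f x * kern a e x) - c =
    \int[mu]_x ((f x - c) * kern a e x).
  rewrite -[c in LHS]mulr1 -{1}(Rintegral_kern a e0) -RintegralZl//.
  rewrite -RintegralB//; [|exact: cfk|].
    by apply: eq_Rintegral => x _; ring.
  by apply: (cfk (cst c)); exact: cst_continuous.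
have cfc : continuous (fun x => f x - c).
  by move=> x; apply: continuousB; [exact: cf|exact: cst_continuous].
apply: le_trans (le_normr_Rintegral _ _) _ => //; first exact: cfk.
rewrite -[h]mulr1 -(Rintegral_kern a e0) -RintegralZl//.
apply: le_Rintegral => //.
- by apply: integrable_norm; exact: cfk.
- by apply: (cfk (cst h)); exact: cst_continuous.
move=> x _; rewrite normrM (ger0_norm (kern_ge0 a x e0)).
case: (boolP (x \in `[a, a + e])) => xa.
  by rewrite ler_wpM2r ?kern_ge0// fc.
by rewrite kern_out// !mulr0.
Qed.

Lemma kern_average_cvg (f : R -> R) (a : R) : continuous f ->
  \int[mu]_x (f x * kern a n.+1%:R^-1 x) @[n --> \oo] --> f a.
Proof.
move=> cf; apply/cvgrPdist_le => e e0.
have /cvgrPdist_le/(_ e e0)[r /= r0 Hr] := cf a.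
near=> n; rewrite distrC; apply: kern_average => //.
move=> x; rewrite in_itv/= => /andP[ax xa]; rewrite distrC; apply: Hr => /=.
rewrite ler0_norm ?subr_le0// opprB (le_lt_trans (y := n.+1%:R^-1))//.
  by rewrite lerBlDl.
by near: n; exact: (near_infty_natSinv_lt (PosNum r0)).
Unshelve. all: by end_near. Qed.

Lemma ramp_cvg (a x : R) :
  ramp a n.+1%:R^-1 x @[n --> \oo] --> (if a < x then 1 else 0 : R).
Proof.
case: ltP => ax; last first.
  by apply: cvg_near_cst; near=> n; rewrite ramp_le.
have ax0 : 0 < x - a by rewrite subr_gt0.
apply: cvg_near_cst; near=> n; rewrite ramp_ge//.
rewrite -lerBrDl ltW//; near: n; exact: (near_infty_natSinv_lt (PosNum ax0)).
Unshelve. all: by end_near. Qed.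

(* Test against [ramp a e - ramp b e] and let [e] tend to [0]. *)
Lemma weak_derivative_increment (f g : R -> R) (a b : R) :
  continuous f -> weak_derivative f g -> a <= b ->
  f b - f a = \int[mu]_(x in `[a, b]) g x.
Proof.
move=> cf [ig Hw]; rewrite le_eqVlt => /predU1P[->|ab].
  by rewrite subrr set_itv1 Rintegral_set1.
pose th n x : R := ramp a n.+1%:R^-1 x - ramp b n.+1%:R^-1 x.
have e0 n : (0 : R) < n.+1%:R^-1 by rewrite invr_gt0.
have thT n : test_function (th n).
  by apply: trapezoid_test => //; [exact: ltW|rewrite lerD2r ltW].
have thout n x : x \notin `[a, b + 1] -> th n x = 0.
  move=> xab; apply: trapezoid_out => //; [exact: ltW|by rewrite lerD2r ltW|].
  apply: contra xab; rewrite !in_itv/= => /andP[-> xb]; apply: le_trans xb _.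
  by rewrite lerD2l invf_le1 ?ler1n.
have L1 : \int[mu]_x (f x * derive1 (th n) x) @[n --> \oo] --> f a - f b.
  rewrite (_ : (fun n => _) = (fun n => \int[mu]_x (f x * kern a n.+1%:R^-1 x)
      - \int[mu]_x (f x * kern b n.+1%:R^-1 x))).
    by apply: cvgB; exact: kern_average_cvg.
  apply/funext => n; rewrite -RintegralB//.
  - apply: eq_Rintegral => x _; rewrite derive1E.
    by have [_ ->] := is_derive_trapezoid a n.+1%:R^-1 b n.+1%:R^-1 x; rewrite mulrBr.
  - apply: (@integrable_mul_csupp _ f a (a + n.+1%:R^-1)).
    + exact: kern_continuous.
    + by move=> x; exact: kern_out.
    + exact: continuous_locally_integrable.
  - apply: (@integrable_mul_csupp _ f b (b + n.+1%:R^-1)).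
    + exact: kern_continuous.
    + by move=> x; exact: kern_out.
    + exact: continuous_locally_integrable.
pose G x : R := if x \in `]a, b] then g x else 0.
have mg : measurable_fun setT g by have [] := ig.
have GE : G = g \_ `]a, b]%classic.
  by apply/funext => x; rewrite patchE /G mem_setE.
have L2 : \int[mu]_x (g x * th n x) @[n --> \oo] --> \int[mu]_x G x.
  apply: (@Rdominated_convergence _ _ mu setT _ _
      (fun x => if x \in `[a, b + 1] then `|g x| else 0)) => //.
  - move=> n; apply: measurable_funM => //.
    by apply: continuous_measurable_fun; exact: test_function_continuous.
  - rewrite GE; apply/(measurable_restrictT g) => //.
    exact: measurable_funTS.
  - apply/aeW => x _; have -> : G x = g x *
        ((if a < x then 1 else 0) - (if b < x then 1 else 0)).
      rewrite /G in_itv/=; case: ltP => ax; case: ltP => bx /=;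
        rewrite ?subrr ?subr0 ?mulr0 ?mulr1//.
      by have := lt_trans (lt_le_trans bx ax) ab; rewrite ltxx.
    by apply: cvgM; [exact: cvg_cst|apply: cvgB; exact: ramp_cvg].
  - apply: (@integrable_restrict _ _ mu `[a, b + 1]%classic) => //.
      by move=> x /negP; rewrite -/(is_true _) => xab; rewrite (negbTE xab).
    have := integrable_norm (locally_integrable_itv a (b + 1) ig).
    apply: eq_integrable => // x; rewrite inE/= => -> //.
  - move=> n x _; case: ifPn => xab; last by rewrite thout// mulr0 normr0.
    rewrite normrM -[leRHS]mulr1 ler_wpM2l//.
    rewrite ler_norml; apply/andP; split.
      by rewrite lerBrDr (le_trans _ (ramp_ge0 _ _ _))// addrC subr_le0 ramp_le1.
    by rewrite lerBlDr (le_trans (ramp_le1 _ _ _))// lerDl ramp_ge0.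
have : \int[mu]_x (f x * derive1 (th n) x) @[n --> \oo] --> - \int[mu]_x G x.
  rewrite (_ : (fun n => _) = (fun n => - \int[mu]_x (g x * th n x))).
    exact: cvgN.
  by apply/funext => n; exact: Hw.
move=> /(cvg_unique _ L1) E.
have -> : f b - f a = \int[mu]_x G x by rewrite -[RHS]opprK -E ?opprB//; exact: Rhausdorff.
rewrite GE -Rintegral_mkcond Rintegral_itv_obnd_cbnd//.
apply: integrableS (locally_integrable_itv a b ig) => //.
exact: subset_itv_oc_cc.
Qed.

End Integration.

(** * Absolutely continuous functions *)

Section RealIntegrable.
Context d (T : measurableType d) (R : realType) (nu : {measure set T -> \bar R}).
Implicit Types (D : set T) (f g : T -> R).

Lemma integrableRD D f g : measurable D -> nu.-integrable D (EFin \o f) ->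
  nu.-integrable D (EFin \o g) -> nu.-integrable D (EFin \o (fun x => f x + g x)).
Proof. by move=> mD fi gi; exact: (integrableD mD fi gi). Qed.

Lemma integrableRB D f g : measurable D -> nu.-integrable D (EFin \o f) ->
  nu.-integrable D (EFin \o g) -> nu.-integrable D (EFin \o (fun x => f x - g x)).
Proof. by move=> mD fi gi; exact: (integrableB mD fi gi). Qed.

Lemma integrableRZ D (c : R) f : measurable D -> nu.-integrable D (EFin \o f) ->
  nu.-integrable D (EFin \o (fun x => c * f x)).
Proof. by move=> mD fi; exact: (integrableZl mD c fi). Qed.

End RealIntegrable.

Section Increments.
Context {R : realType}.
Notation mu := (@lebesgue_measure R).

Lemma Rintegral_itv_split (g : R -> R) (a b c : R) :
  mu.-integrable `[a, c] (EFin \o g) -> a <= b -> b <= c ->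
  \int[mu]_(x in `[a, c]) g x =
  \int[mu]_(x in `[a, b]) g x + \int[mu]_(x in `[b, c]) g x.
Proof.
move=> ig ab bc; have := Rintegral_itvB ig; move=> /(_ b); rewrite !bnd_simp => /(_ ab bc).
rewrite Rintegral_itv_obnd_cbnd; first by move=> <-; rewrite addrC subrK.
apply: integrableS ig => //; apply: subset_itv; rewrite bnd_simp//.
Qed.

Lemma integrable_itvM (g f : R -> R) (a b : R) : continuous f ->
  mu.-integrable `[a, b] (EFin \o g) ->
  mu.-integrable `[a, b] (EFin \o (fun x => g x * f x)).
Proof.
move=> cf ig.
have mab : measurable (`[a, b]%classic : set (measurableTypeR R)) by [].
apply: (integrableMl mab ig).
  by apply: measurable_funTS; exact: continuous_measurable_fun.
have [M _ HM] := continuous_bounded_itv a b cf.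
exists M; split; first by rewrite num_real.
by move=> y My x xab; rewrite /= (le_trans (HM x xab))// ltW.
Qed.

(** Continuous induction: from a point [y] just before the supremum of the points reached, the local
    estimate leads to a point [z] beyond it, unless the supremum is [b]. Only pairs with
    [y <= x <= z] occur, and the choices [d / 2] and [d / 4] keep [z - y] below [d]. *)
Lemma local_increment_le (Phi V : R -> R) (a b : R) : a <= b ->
  (forall x, a <= x <= b -> exists2 d, 0 < d & forall y z,
     a <= y -> y <= x -> x <= z -> z <= b -> z - y < d ->
     `|Phi z - Phi y| <= V z - V y) ->
  `|Phi b - Phi a| <= V b - V a.
Proof.
move=> ab H.
pose S := [set x | a <= x <= b /\ `|Phi x - Phi a| <= V x - V a].
have Sa : S a by rewrite /S/= lexx ab !subrr normr0 lexx.
have supS : has_sup S.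
  by split; [exists a|exists b => x [/andP[]]].
have cb : sup S <= b by apply: ge_sup => [|x [/andP[]]//]; exists a.
have ac : a <= sup S by exact: ub_le_sup (proj2 supS) _ Sa.
have [|d d0 Hd] := H (sup S); first by rewrite ac cb.
have [y Sy yc] := sup_adherent (divr_gt0 d0 (ltr0n R 2)) supS.
have {}yc : sup S < y + d / 2 by rewrite -ltrBlDr.
have ysup : y <= sup S := ub_le_sup (proj2 supS) Sy.
pose z := Num.min b (sup S + d / 4).
have cz : sup S <= z by rewrite le_min cb lerDl divr_ge0 ?ltW.
have [/andP[ay yb] Hy] := Sy.
have zd : z <= sup S + d / 4 by rewrite ge_min lexx orbT.
have Hz : `|Phi z - Phi y| <= V z - V y.
  apply: Hd => //; first by rewrite ge_min lexx.
  lra.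
have Sz : S z.
  split; first by rewrite (le_trans ac cz) ge_min lexx.
  have -> : Phi z - Phi a = (Phi z - Phi y) + (Phi y - Phi a) by ring.
  by apply: le_trans (ler_normD _ _) _; lra.
have zc : z <= sup S := ub_le_sup (proj2 supS) Sz.
have : z = b.
  by move: zc; rewrite /z minEle; case: ifP => // _; move: d0; lra.
by move=> zb; rewrite zb in Sz; have [] := Sz.
Qed.

(* Absolute continuity of [p] with derivative [p'] is encoded by the increments of [p]. *)
Lemma increment_mul (p q p' q' : R -> R) (a b : R) :
  continuous p -> continuous q ->
  (forall x y, mu.-integrable `[x, y] (EFin \o p')) ->
  (forall x y, mu.-integrable `[x, y] (EFin \o q')) ->
  (forall x y, x <= y -> p y - p x = \int[mu]_(s in `[x, y]) p' s) ->
  (forall x y, x <= y -> q y - q x = \int[mu]_(s in `[x, y]) q' s) ->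
  a <= b ->
  p b * q b - p a * q a = \int[mu]_(s in `[a, b]) (p' s * q s + q' s * p s).
Proof.
move=> cp cq ip iq Hp Hq ab.
pose h s := p' s * q s + q' s * p s.
have ih x y : mu.-integrable `[x, y] (EFin \o h).
  by apply: integrableRD => //; exact: integrable_itvM.
pose w s := `|p' s| + `|q' s|.
have iw x y : mu.-integrable `[x, y] (EFin \o w).
  by apply: integrableRD => //; exact: integrable_norm.
pose Phi x := p x * q x - \int[mu]_(s in `[a, x]) h s.
pose W x := \int[mu]_(s in `[a, x]) w s.
have Wab : 0 <= W b by apply: Rintegral_ge0 => x _; rewrite addr_ge0.
(* [Phi] is the defect in the product rule. Over a short interval [[y, z]] it changes by the
   integral of [(q z - q s) * p' s + (p y - p s) * q' s], hence by at most the oscillation [e] times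
   the increment of [W]. *)
have key e : 0 < e -> `|Phi b - Phi a| <= e * W b - e * W a.
  move=> e0; apply: (@local_increment_le Phi (fun x => e * W x)) => // x0 x0ab.
  have e20 : 0 < e / 2 by rewrite divr_gt0.
  have /cvgrPdist_le/(_ _ e20)[dp /= dp0 Hdp] := cp x0.
  have /cvgrPdist_le/(_ _ e20)[dq /= dq0 Hdq] := cq x0.
  exists (Num.min dp dq); first by rewrite lt_min dp0.
  move=> y z ay yx xz zb zyd.
  have yz : y <= z by exact: le_trans xz.
  have az : a <= z by exact: le_trans yz.
  have osc (f : R -> R) (d : R) : Num.min dp dq <= d ->
      (forall s, `|x0 - s| < d -> `|f x0 - f s| <= e / 2) ->
      forall s s', s \in `[y, z] -> s' \in `[y, z] -> `|f s - f s'| <= e.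
    move=> dd Hf s s'; rewrite !in_itv/= => /andP[ys sz] /andP[ys' sz'].
    have Hs : `|x0 - s| < d.
      apply: lt_le_trans dd; apply: le_lt_trans zyd; rewrite ler_norml; lra.
    have Hs' : `|x0 - s'| < d.
      apply: lt_le_trans dd; apply: le_lt_trans zyd; rewrite ler_norml; lra.
    have -> : f s - f s' = (f x0 - f s') - (f x0 - f s) by ring.
    apply: le_trans (ler_normB _ _) _.
    by have := Hf _ Hs; have := Hf _ Hs'; lra.
  have op := osc p dp; have oq := osc q dq.
  have {}op := op ltac:(by rewrite ge_min lexx) Hdp.
  have {}oq := oq ltac:(by rewrite ge_min lexx orbT) Hdq.
  have -> : Phi z - Phi y = \int[mu]_(s in `[y, z])
      ((q z - q s) * p' s + (p y - p s) * q' s).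
    have -> : Phi z - Phi y = q z * (p z - p y) + p y * (q z - q y)
        - \int[mu]_(s in `[y, z]) h s.
      rewrite /Phi (Rintegral_itv_split (ih a z) ay yz); ring.
    rewrite Hp// Hq// -!RintegralZl// -RintegralD//; last 2 first.
    - exact: integrableRZ.
    - exact: integrableRZ.
    rewrite -RintegralB//; last by apply: integrableRD => //; exact: integrableRZ.
    by apply: eq_Rintegral => s _; rewrite /h; ring.
  have -> : e * W z - e * W y = \int[mu]_(s in `[y, z]) (e * w s).
    rewrite RintegralZl// /W (Rintegral_itv_split (iw a z) ay yz); ring.
  have ig : mu.-integrable `[y, z]
      (EFin \o (fun s => (q z - q s) * p' s + (p y - p s) * q' s)).
    have := integrableRD _ (@integrable_itvM p' (fun s => q z - q s) y z _ (ip y z))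
      (@integrable_itvM q' (fun s => p y - p s) y z _ (iq y z)).
    rewrite (_ : (fun x => p' x * _ + _) =
      (fun s => (q z - q s) * p' s + (p y - p s) * q' s)); last first.
      by apply/funext => s; ring.
    apply=> // s.
      by apply: cvgB; [exact: cvg_cst|exact: cq].
    by apply: cvgB; [exact: cvg_cst|exact: cp].
  apply: le_trans (le_normr_Rintegral _ ig) _ => //.
  apply: le_Rintegral => //; first exact: integrable_norm ig.
    exact: integrableRZ.
  move=> s ys; apply: le_trans (ler_normD _ _) _; rewrite !normrM /w mulrDr.
  apply: lerD; rewrite ler_wpM2r//.
    by apply: oq => //; rewrite in_itv/= lexx yz.
  by apply: op => //; rewrite in_itv/= lexx yz.
have Phi0 : Phi b - Phi a = 0.
  apply/eqP; rewrite -normr_le0; apply/ler_addgt0Pl => e e0; rewrite addr0.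
  have W0 : W a = 0 by rewrite /W set_itv1 Rintegral_set1.
  apply: le_trans (key (e / (W b + 1)) _) _; first by rewrite divr_gt0// ltr_wpDl.
  rewrite W0 mulr0 subr0 -mulrA ger_pMr// mulrC ler_pdivrMr ?ltr_wpDl//.
  by rewrite mul1r lerDl.
move: Phi0; rewrite /Phi set_itv1 Rintegral_set1 subr0 => /eqP.
by rewrite subr_eq0 subr_eq => /eqP ->; rewrite addrC addKr.
Qed.

(** This puts the term [u u_x] into the conservative form [(u^2 / 2)_x]. Since [g] is merely locally
    integrable, the product rule for increments is used twice, for [f * f] and then for
    [f * f * phi]. *)
Lemma weak_derivative_chain (f g phi : R -> R) :
  continuous f -> weak_derivative f g -> test_function phi ->
  \int[mu]_x (phi x * (f x * g x)) =
  - \int[mu]_x (f x ^+ 2 / 2 * derive1 phi x).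
Proof.
move=> cf fg tphi; have [ig _] := fg.
have [a0 [b0 phi0]] := test_function_supp tphi.
(* The bounds obtained for the support come without an order. *)
pose a := Num.min a0 b0; pose b := Num.max a0 b0.
have ab : a <= b by rewrite /a /b ge_min !le_max !lexx.
have phiab x : x \notin `[a, b] -> phi x = 0.
  move=> xab; apply: phi0; apply: contra xab; rewrite !in_itv/= => /andP[ax xb].
  by rewrite ge_min le_max ax xb orbT.
have tphi' := test_function_derive1 tphi.
have cphi := test_function_continuous tphi.
have cphi' := test_function_continuous tphi'.
have igI x y := @locally_integrable_itv R g x y ig.
have Hf x y : x <= y -> f y - f x = \int[mu]_(s in `[x, y]) g s.
  exact: weak_derivative_increment.
have cf2 : continuous (fun x => f x * f x).
  by move=> x; apply: cvgM; exact: cf.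
have Hff x y : x <= y -> f y * f y - f x * f x =
    \int[mu]_(s in `[x, y]) (g s * f s + g s * f s).
  exact: increment_mul.
have iff' x y : mu.-integrable `[x, y] (EFin \o (fun s => g s * f s + g s * f s)).
  by apply: integrableRD => //; exact: integrable_itvM.
have iphi' x y : mu.-integrable `[x, y] (EFin \o derive1 phi).
  exact: integrable_continuous_itv.
have Hphi x y : x <= y -> phi y - phi x = \int[mu]_(s in `[x, y]) derive1 phi s.
  rewrite le_eqVlt => /predU1P[->|xy]; first by rewrite subrr set_itv1 Rintegral_set1.
  rewrite /Rintegral (@continuous_FTC2 R (derive1 phi) phi)//.
  - exact/continuous_subspaceT.
  - split.
    + by move=> z _; have [] := test_function_is_derive z tphi.
    + exact/cvg_at_right_filter/cphi.
    + exact/cvg_at_left_filter/cphi.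
(* One unit of room on each side makes [phi] vanish at the end points, so that no boundary term
   survives. *)
have a1b1 : a - 1 <= b + 1 by lra.
have := increment_mul cf2 cphi iff' iphi' Hff Hphi a1b1.
rewrite !phiab; last 2 first.
- by rewrite in_itv/= negb_and -!ltNge; apply/orP; left; rewrite ltrBlDr ltrDl.
- by rewrite in_itv/= negb_and -!ltNge; apply/orP; right; rewrite ltrDl.
have out x : x \notin `[a - 1, b + 1] -> phi x = 0 /\ derive1 phi x = 0.
  move=> xab; split.
    apply: phiab; apply: contra xab; rewrite !in_itv/=; lra.
  apply: derive1_out phiab _; apply: contra xab; rewrite !in_itv/=; lra.
rewrite !mulr0 subr0 => E.
rewrite (@Rintegral_restrict R _ _ mu `[a - 1, b + 1]%classic); last first.
  by move=> x /negP/out[-> _]; rewrite mul0r.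
rewrite (@Rintegral_restrict R _ _ mu `[a - 1, b + 1]%classic
  (fun x => f x ^+ 2 / 2 * derive1 phi x)); last first.
  by move=> x /negP/out[_ ->]; rewrite mulr0.
have i1 : mu.-integrable `[a - 1, b + 1] (EFin \o (fun x => g x * f x * phi x)).
  by apply: integrable_itvM => //; exact: integrable_itvM.
have i2 : mu.-integrable `[a - 1, b + 1]
    (EFin \o (fun x => derive1 phi x * (f x * f x))).
  by apply: integrable_itvM.
have : \int[mu]_(x in `[a - 1, b + 1]) (2 * (g x * f x * phi x)) +
    \int[mu]_(x in `[a - 1, b + 1]) (derive1 phi x * (f x * f x)) = 0.
  rewrite E -RintegralD//.
    by apply: eq_Rintegral => x _; ring.
  exact: integrableRZ.
rewrite RintegralZl//.
have -> : \int[mu]_(x in `[a - 1, b + 1]) (phi x * (f x * g x)) =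
  \int[mu]_(x in `[a - 1, b + 1]) (g x * f x * phi x).
  by apply: eq_Rintegral => x _; ring.
have -> : \int[mu]_(x in `[a - 1, b + 1]) (f x ^+ 2 / 2 * derive1 phi x) =
  2^-1 * \int[mu]_(x in `[a - 1, b + 1]) (derive1 phi x * (f x * f x)).
  by rewrite -RintegralZl//; apply: eq_Rintegral => x _; field.
lra.
Qed.

End Increments.

(** * Test functions carried by a frame of constant speed *)

Section PlaneTests.
Context {R : realType}.

(** A spatial profile travelling with speed [k], times a cut-off in time. Integrating first in [x]
    leaves a pairing with [theta] and [theta'], which is a weak derivative in time along the
    line. *)
Definition sheared (theta psi : R -> R) (k : R) (p : R * R) : R :=
  theta p.2 * psi (p.1 - k * p.2).

Lemma sheared_test (theta psi : R -> R) (k : R) :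
  test_function theta -> test_function psi -> test_function (sheared theta psi k).
Proof.
move=> tt tp.
have c1 : continuous (fun p : R * R => p.1 - k * p.2).
  move=> p; apply: cvgB; first exact: cvg_fst.
  by apply: cvgM; [exact: cvg_cst|exact: cvg_snd].
have c2 : continuous (fun p : R * R => p.2) by move=> p; exact: cvg_snd.
split=> [n|].
  apply: (@class_CM _ _ n (theta \o (fun p : R * R => p.2))
                          (psi \o (fun p : R * R => p.1 - k * p.2))).
    apply: (@class_C_comp_affine R _ n theta (fun p : R * R => p.2) (fun p => p.2)) => //.
    by have [/(_ n)] := tt.
  apply: (@class_C_comp_affine R _ n psi (fun p : R * R => p.1 - k * p.2)
    (fun p => p.1 - k * p.2)) => //.
    by move=> x v h; rewrite /= /GRing.scale/=; ring.
  by have [/(_ n)] := tp.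
have [a [b Ht]] := test_function_supp tt.
have [c [d Hp]] := test_function_supp tp.
pose M := `|k| * Num.max `|a| `|b|.
pose Q : set (R * R) := `[c - M, d + M]%classic `*` `[a, b]%classic.
have cQ : compact Q by apply: compact_setX; exact: segment_compact.
apply: (@subclosed_compact _ _ Q) => //; first exact: closed_closure.
have clQ : closed Q by apply: compact_closed => //; exact: norm_hausdorff.
rewrite closureEbigcap; apply: bigcap_inf; split => //.
move=> [x t] /=; rewrite /sheared/= mulf_eq0 negb_or => /andP[tn pn].
have tab : t \in `[a, b] by apply/negPn/negP => /Ht/eqP; exact/negP.
have xcd : x - k * t \in `[c, d] by apply/negPn/negP => /Hp/eqP; exact/negP.
split => //=; move: xcd; rewrite !in_itv/=.
have kt : `|k * t| <= M.
  rewrite normrM ler_wpM2l// le_max; move: tab; rewrite in_itv/= => /andP[at_ tb].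
  case: (leP 0 t) => t0.
    by apply/orP; right; rewrite !ger0_norm//; exact: le_trans tb.
  by apply/orP; left; rewrite !ltr0_norm ?lerN2//; exact: le_lt_trans at_ t0.
by move: kt; rewrite ler_norml; lra.
Qed.

Lemma derive_sheared (theta psi : R -> R) (k x t : R) (v : R * R) :
  test_function theta -> test_function psi ->
  'D_v (sheared theta psi k) (x, t) =
  theta t * ((v.1 - k * v.2) * derive1 psi (x - k * t)) +
  psi (x - k * t) * (v.2 * derive1 theta t).
Proof.
move=> tt tp.
have comp_affine (a : R -> R) (l l0 : R * R -> R) (p : R * R) (da : R) :
    (forall x v h, l (h *: v + x) = h * l0 v + l x) ->
    is_derive (l p) 1 a da -> is_derive p v (a \o l) (l0 v * da).
  move=> Hl Ha.
  have E : (fun h : R => h^-1 *: (((a \o l) \o shift p) (h *: v) - (a \o l) p)) =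
      (fun h : R => h^-1 *: ((a \o shift (l p)) (h *: l0 v) - a (l p))).
    by apply/funext => h /=; rewrite Hl.
  have [Hd HD] := is_derive_dir (l0 v) Ha.
  by apply: DeriveDef; [rewrite /derivable E|rewrite /derive E].
have d1 := comp_affine theta (fun p => p.2) (fun p => p.2) (x, t) _ _
  (test_function_is_derive t tt).
have d2 := comp_affine psi (fun p => p.1 - k * p.2) (fun p => p.1 - k * p.2)
  (x, t) _ _ (test_function_is_derive (x - k * t) tp).
have {}d1 := d1 (fun _ _ _ => erefl).
have {}d2 : is_derive (x, t) v (psi \o (fun p => p.1 - k * p.2))
    ((v.1 - k * v.2) * derive1 psi (x - k * t)).
  by apply: d2 => y w h /=; rewrite /GRing.scale/=; ring.
have [_ ->] := is_deriveM d1 d2.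
by [].
Qed.

Lemma d_t_sheared (theta psi : R -> R) (k x t : R) :
  test_function theta -> test_function psi ->
  d_t (sheared theta psi k) (x, t) =
  derive1 theta t * psi (x - k * t) - k * theta t * derive1 psi (x - k * t).
Proof.
by move=> tt tp; rewrite /d_t derive_sheared//=; ring.
Qed.

Lemma d_x_sheared (theta psi : R -> R) (k x t : R) :
  test_function theta -> test_function psi ->
  d_x (sheared theta psi k) (x, t) = theta t * derive1 psi (x - k * t).
Proof.
by move=> tt tp; rewrite /d_x derive_sheared//=; ring.
Qed.

End PlaneTests.

(** * Paths of bounded continuous functions *)

Section BoundedPaths.
Context {R : realType}.
Notation lam := (@lebesgue_measure R).

(** The space [C(R; C_b(R))], with uniform convergence spelled out. This is the class of integrands
    that pairs well with weakly continuous measures. *)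
Definition Cb_path (g : R -> R -> R) : Prop :=
  (forall t, Cb (g ^~ t)) /\
  forall t0 e, 0 < e -> \forall t \near t0, forall x, `|g x t - g x t0| <= e.

Lemma CbP (f : R -> R) : Cb f <-> continuous f /\ exists M, forall x, `|f x| <= M.
Proof. by split=> -[cf bf]; split=> //; apply/bounded_funP. Qed.

Lemma Cb_cst (c : R) : Cb (cst c : R -> R).
Proof. by apply/CbP; split; [exact: cst_continuous|exists `|c|]. Qed.

Lemma Cb_pathD g h : Cb_path g -> Cb_path h -> Cb_path (fun x t => g x t + h x t).
Proof.
move=> [Cg ug] [Ch uh]; split=> [t|t0 e e0].
  have /CbP[cg [M HM]] := Cg t; have /CbP[ch [N HN]] := Ch t.
  apply/CbP; split; first by move=> x; apply: cvgD; [exact: cg|exact: ch].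
  by exists (M + N) => x; apply: le_trans (ler_normD _ _) _; rewrite lerD.
have e20 : 0 < e / 2 by rewrite divr_gt0.
near=> t => x; have -> : g x t + h x t - (g x t0 + h x t0) =
  (g x t - g x t0) + (h x t - h x t0) by ring.
apply: le_trans (ler_normD _ _) _; rewrite [e]splitr lerD//.
- by move: x; near: t; exact: ug.
- by move: x; near: t; exact: uh.
Unshelve. all: by end_near. Qed.

Lemma Cb_pathM g h : Cb_path g -> Cb_path h -> Cb_path (fun x t => g x t * h x t).
Proof.
move=> [Cg ug] [Ch uh]; split=> [t|t0 e e0].
  have /CbP[cg [M HM]] := Cg t; have /CbP[ch [N HN]] := Ch t.
  apply/CbP; split; first by move=> x; apply: cvgM; [exact: cg|exact: ch].
  by exists (M * N) => x; rewrite normrM ler_pM.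
have /CbP[_ [M HM]] := Cg t0; have /CbP[_ [N HN]] := Ch t0.
have M0 : 0 <= M by exact: le_trans (HM 0).
have N0 : 0 <= N by exact: le_trans (HN 0).
pose d := Num.min 1 (e / (M + N + 1)).
have K0 : 0 < M + N + 1 by rewrite ltr_wpDl// addr_ge0.
have d0 : 0 < d by rewrite lt_min ltr01 divr_gt0.
have d1 : d <= 1 by rewrite ge_min lexx.
have de : d * (M + N + 1) <= e.
  by rewrite -ler_pdivlMr// ge_min lexx orbT.
near=> t.
have gd : forall x, `|g x t - g x t0| <= d by near: t; exact: ug.
have hd : forall x, `|h x t - h x t0| <= d by near: t; exact: uh.
move=> x; move: {gd hd} (gd x) (hd x) => gd hd.
have -> : g x t * h x t - g x t0 * h x t0 =
  (g x t - g x t0) * (h x t - h x t0) + (g x t - g x t0) * h x t0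
  + g x t0 * (h x t - h x t0) by ring.
apply: le_trans de; apply: le_trans (ler_normD _ _) _.
have := ler_normD ((g x t - g x t0) * (h x t - h x t0)) ((g x t - g x t0) * h x t0).
rewrite !normrM.
have H1 : `|g x t - g x t0| * `|h x t - h x t0| <= d * 1 by rewrite ler_pM// (le_trans hd).
have H2 : `|g x t - g x t0| * `|h x t0| <= d * N by rewrite ler_pM.
have H3 : `|g x t0| * `|h x t - h x t0| <= M * d by rewrite ler_pM.
lra.
Unshelve. all: by end_near. Qed.

Lemma Cb_path_time (c : R -> R) : continuous c -> Cb_path (fun _ => c).
Proof.
move=> cc; split=> [t|t0 e e0].
  apply/CbP; split; first exact: cst_continuous.
  by exists `|c t|.
have /cvgrPdist_le/(_ e e0) := cc t0.
by apply: filterS => t; rewrite distrC.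
Qed.

Lemma Cb_path_shift (f z : R -> R) (L M : R) : continuous z ->
  (forall x y, `|f x - f y| <= L * `|x - y|) -> (forall x, `|f x| <= M) ->
  Cb_path (fun x t => f (x - z t)).
Proof.
move=> cz Lf Mf.
have L0 : 0 <= L by have := le_trans (normr_ge0 _) (Lf 1 0); rewrite subr0 normr1 mulr1.
have cf : continuous f.
  move=> x; apply/cvgrPdist_le => e e0; near=> y.
  apply: le_trans (Lf _ _) _.
  have : `|x - y| <= e / (L + 1).
    near: y; have /cvgrPdist_le := @cvg_id R (nbhs x).
    by apply; rewrite divr_gt0// ltr_wpDl.
  move=> xy; apply: le_trans (_ : L * (e / (L + 1)) <= _); first by rewrite ler_wpM2l.
  by rewrite mulrCA ger_pMr// ler_pdivrMr ?ltr_wpDl// mul1r lerDl.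
split=> [t|t0 e e0].
  apply/CbP; split; last by exists M.
  move=> x; apply: (@continuous_comp _ _ _ (fun x => x - z t) f); last exact: cf.
  by apply: cvgB; [exact: cvg_id|exact: cvg_cst].
near=> t => x; apply: le_trans (Lf _ _) _.
have -> : x - z t - (x - z t0) = z t0 - z t by ring.
have : `|z t0 - z t| <= e / (L + 1).
  near: t; have /cvgrPdist_le := cz t0.
  by apply; rewrite divr_gt0// ltr_wpDl.
move=> xy; apply: le_trans (_ : L * (e / (L + 1)) <= _); first by rewrite ler_wpM2l.
by rewrite mulrCA ger_pMr// ler_pdivrMr ?ltr_wpDl// mul1r lerDl.
Unshelve. all: by end_near. Qed.

Lemma Cb_path_test (f z : R -> R) : continuous z -> test_function f ->
  Cb_path (fun x t => f (x - z t)).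
Proof.
move=> cz tf; have [L [_ HL]] := test_function_lipschitz tf.
have [M HM] := test_function_bounded tf.
exact: Cb_path_shift HL HM.
Qed.

Lemma integrable_Cb (nu : Mplus R) (f : R -> R) : Cb f ->
  nu.-integrable setT (EFin \o f).
Proof.
move=> [cf bf]; apply: measurable_bounded_integrable => //.
  by rewrite ltey_eq fin_num_measure.
exact: continuous_measurable_fun.
Qed.

Lemma mass_continuous (nu : R -> Mplus R) :
  weakly_continuous nu -> continuous (fun t => fine (nu t setT)).
Proof.
move=> wc; have := wc _ (Cb_cst 1).
rewrite (_ : (fun t => _) = (fun t => fine (nu t setT)))//.
by apply/funext => t; rewrite Rintegral_cst// mul1r.
Qed.

(** Integrand and measure both vary. With the integrand frozen at [t0] this is weak continuity; the
    remaining error is the uniform distance of the integrands times the mass, which stays below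
    [m0 + 1] near [t0] because the constant 1 is an admissible test. *)
Lemma weak_moving_integral (nu : R -> Mplus R) (g : R -> R -> R) :
  weakly_continuous nu -> Cb_path g ->
  continuous (fun t => \int[nu t]_x g x t).
Proof.
move=> wc [Cg ug] t0.
have C1 := Cb_cst 1.
have mass t : \int[nu t]_x (cst 1 x) = fine (nu t setT).
  by rewrite Rintegral_cst// mul1r.
apply/cvgrPdist_le => e e0.
pose m0 := fine (nu t0 setT).
have m00 : 0 <= m0 by exact: fine_ge0.
have e20 : 0 < e / 2 by rewrite divr_gt0.
pose d := e / 2 / (m0 + 1).
have d0 : 0 < d by rewrite divr_gt0// ltr_wpDl.
have cm : continuous (fun t => fine (nu t setT)) by exact: mass_continuous.
have /cvgrPdist_le/(_ 1 ltr01) Hm := cm t0.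
have /cvgrPdist_le/(_ _ e20) Hg := wc _ (Cg t0) t0.
near=> t.
have gd : forall x, `|g x t - g x t0| <= d by near: t; exact: ug.
have mt : `|m0 - fine (nu t setT)| <= 1 by near: t; exact: Hm.
have gt' : `|\int[nu t0]_x g x t0 - \int[nu t]_x g x t0| <= e / 2 by near: t; exact: Hg.
have -> : \int[nu t0]_x g x t0 - \int[nu t]_x g x t =
  (\int[nu t0]_x g x t0 - \int[nu t]_x g x t0) -
  (\int[nu t]_x g x t - \int[nu t]_x g x t0) by ring.
apply: le_trans (ler_normB _ _) _; rewrite [leRHS]splitr lerD//.
rewrite -RintegralB//; [|exact: integrable_Cb|exact: integrable_Cb].
have ib : (nu t).-integrable setT (EFin \o (fun x => g x t - g x t0)).
  by apply: integrableRB => //; exact: integrable_Cb.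
apply: le_trans (le_normr_Rintegral _ ib) _ => //.
apply: le_trans (_ : \int[nu t]_x (d * cst 1 x) <= _).
  apply: le_Rintegral => //.
  - exact: integrable_norm ib.
  - by apply: integrableRZ => //; exact: integrable_Cb.
  - by move=> x _; rewrite mulr1.
rewrite RintegralZl//; last exact: integrable_Cb.
have dm : d * (m0 + 1) = e / 2 by rewrite /d divfK// gt_eqF// ltr_wpDl.
rewrite -dm ler_pM2l// mass.
by move: mt; rewrite ler_norml; lra.
Unshelve. all: by end_near. Qed.

(** Lebesgue measure being infinite, a support that is common to all times near [t0] takes over the
    role of the bounded mass. *)
Lemma lebesgue_moving_integral (g : R -> R -> R) : Cb_path g ->
  (forall t0 : R, exists a b : R,
     \forall t \near t0, forall x, x \notin `[a, b] -> g x t = 0) ->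
  continuous (fun t => \int[lam]_x g x t).
Proof.
move=> [Cg ug] supp t0; apply/cvgrPdist_le => e e0.
have [a0 [b0 Hs]] := supp t0.
pose a := Num.min a0 b0; pose b := Num.max a0 b0.
have ab : a <= b by rewrite /a /b ge_min !le_max !lexx.
pose d := e / (b - a + 1).
have d0 : 0 < d by rewrite divr_gt0// ltr_wpDl ?subr_ge0.
have Hs0 : forall x, x \notin `[a0, b0] -> g x t0 = 0 by exact: nbhs_singleton Hs.
near=> t.
have gd : forall x, `|g x t - g x t0| <= d by near: t; exact: ug.
have Hst : forall x, x \notin `[a0, b0] -> g x t = 0 by near: t.
have out x : x \notin `[a, b] -> x \notin `[a0, b0].
  apply: contra; rewrite !in_itv/= => /andP[ax xb].
  by rewrite ge_min le_max ax xb orbT.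
have ig s : (forall x, x \notin `[a0, b0] -> g x s = 0) ->
    lam.-integrable setT (EFin \o (g ^~ s)).
  by move=> H; apply: (@integrable_csupp _ _ a0 b0) => //; have [] := Cg s.
rewrite -RintegralB//; [|exact: ig|exact: ig].
rewrite (@Rintegral_restrict R _ _ lam `[a, b]%classic); last first.
  by move=> x /negP/out xab; rewrite Hs0// Hst// subrr.
have cgt s : continuous (g ^~ s) by have [] := Cg s.
have ib : lam.-integrable `[a, b] (EFin \o (fun x => g x t0 - g x t)).
  apply: integrableRB => //; apply: continuous_compact_integrable;
   by [exact: segment_compact|exact: continuous_subspaceT].
apply: le_trans (le_normr_Rintegral _ ib) _ => //.
apply: le_trans (_ : \int[lam]_(x in `[a, b]) (cst d x) <= _).
  apply: le_Rintegral => //.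
  - exact: integrable_norm ib.
  - apply: continuous_compact_integrable; first exact: segment_compact.
    exact/continuous_subspaceT/cst_continuous.
  - by move=> x _; rewrite distrC.
rewrite Rintegral_cst//= lebesgue_measure_itv/= lte_fin; case: ifPn => _.
  rewrite -EFinB/= /d -mulrA ger_pMr// mulrC ler_pdivrMr ?ltr_wpDl ?subr_ge0//.
  by rewrite mul1r lerDl.
by rewrite /= mulr0 ltW.
Unshelve. all: by end_near. Qed.

Lemma derive1_shift (f : R -> R) (c x : R) :
  derive1 (fun y => f (y - c)) x = derive1 f (x - c).
Proof.
rewrite /derive1.
suff -> : (fun h => h^-1 *: (f (h + x - c) - f (x - c))) =
  (fun h => h^-1 *: (f (h + (x - c)) - f (x - c))) by [].
by apply/funext => h; rewrite addrA.
Qed.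

(** Tonelli on the half-plane [y <= x]. The distribution function at a fixed point may jump in time,
    whereas its average is an integral of a bounded continuous function against the measure, hence
    continuous in time under weak continuity. *)
Lemma kern_cumulative (nu : Mplus R) (z e : R) : 0 < e ->
  \int[lam]_x (kern z e x * fine (nu [set` `]-oo, x]])) =
  \int[nu]_y (1 - ramp z e y).
Proof.
move=> e0.
pose D : set (measurableTypeR R * measurableTypeR R) := [set p | p.2 <= p.1].
have mD : measurable D.
  rewrite /D -[X in measurable X]setTI.
  have := @measurable_fun_ler _ _ R setT (fun p : measurableTypeR R * measurableTypeR R => p.2)
    (fun p => p.1) measurable_snd measurable_fst.
  by move=> /(_ measurableT [set true])/=; rewrite /preimage; apply.
pose f (p : measurableTypeR R * measurableTypeR R) : \bar R :=
  (kern z e p.1 * \1_D p)%:E.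
have mf : measurable_fun setT f.
  apply/measurable_EFinP; apply: measurable_funM.
    apply: (measurableT_comp _ measurable_fst).
    by apply: continuous_measurable_fun; exact: kern_continuous.
  exact: measurable_indic.
have f0 p : (0 <= f p)%E by rewrite lee_fin mulr_ge0 ?kern_ge0.
have /= T := @fubini_tonelli _ _ _ _ R lam nu f mf f0.
rewrite /Rintegral; congr fine; transitivity (\int[lam]_x \int[nu]_y f (x, y))%E.
  apply: eq_integral => x _.
  rewrite /f/=; under eq_integral do rewrite EFinM.
  rewrite ge0_integralZl//; last 2 first.
  - apply/measurable_EFinP.
    rewrite (_ : (fun y => _) = \1_(`]-oo, x]%classic : set (measurableTypeR R))).
      exact: measurable_indic.
    by apply/funext => y; rewrite !indicE; congr (_%:R); apply/idP/idP; rewrite !inE/= in_itv.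
  - by rewrite lee_fin kern_ge0.
  rewrite EFinM; congr (_ * _)%E.
  rewrite fineK ?fin_num_measure// -[X in nu X = _]setIT -integral_indic//.
rewrite T; apply: eq_integral => y _.
rewrite /f/=.
(* Any end point to the right of both [y] and the support of the kernel will do; the added 1 makes
   [y < b] strict, as the fundamental theorem of calculus requires. *)
pose b := Num.max y (z + e) + 1.
have yb : y < b by rewrite /b (@le_lt_trans _ _ (Num.max y (z + e))) ?ltrDl// le_max lexx.
have zb : z + e <= b.
  by rewrite /b (@le_trans _ _ (Num.max y (z + e))) ?lerDl// le_max lexx orbT.
transitivity (\int[lam]_(x in `[y, b]) (kern z e x)%:E)%E.
  rewrite [RHS]integral_mkcond; apply: eq_integral => x _; rewrite patchE.
  rewrite mem_setE in_itv/= indicE; case: ifPn.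
    by move=> /andP[yx _]; rewrite (_ : _ \in D) ?mulr1// inE.
  rewrite negb_and -!ltNge => /orP[xy|bx].
    rewrite (_ : (_ \in D) = false) ?mulr0//; apply/negbTE; rewrite notin_setE/= /D/=.
    by apply/negP; rewrite -ltNge.
  rewrite kern_out ?mul0r// in_itv/= negb_and -!ltNge; apply/orP; right.
  exact: le_lt_trans bx.
rewrite (@continuous_FTC2 R (kern z e) (ramp z e))//.
- by rewrite (@ramp_ge R z e b)// EFinB.
- exact/continuous_subspaceT/kern_continuous.
- split.
  + by move=> x _; have [] := is_derive_ramp z e x.
  + exact/cvg_at_right_filter/ramp_continuous.
  + exact/cvg_at_left_filter/ramp_continuous.
- by move=> x _; apply: derive1_eq; exact: is_derive_ramp.
Qed.

End BoundedPaths.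

(** * Identities along moving frames *)

Section Solution.
Context {R : realType}.
Notation lam := (@lebesgue_measure R).

(** The conditions that are invariant under translation in time, so that the analysis can start from
    any instant. *)
Record is_solution (u ux : R -> R -> R) (nu : R -> Mplus R) : Prop := IsSolution {
  sol_path : Cb_path u ;
  sol_dx : forall t, weak_derivative (u ^~ t) (ux ^~ t) ;
  sol_weak : weakly_continuous nu ;
  sol_ac : forall t, ac_part_is_sq_dx (nu t) (ux ^~ t) ;
  sol_ae : {ae lam, forall t : R,
    forall A, measurable A -> nu t A = sq_dx (ux ^~ t) A} ;
  sol_velocity : weak_velocity_equation u ux nu ;
  sol_transport : weak_continuity_equation u nu }.

Lemma ramp_lipschitz (e : R) : 0 < e ->
  exists L, forall z x y, `|ramp z e x - ramp z e y| <= L * `|x - y|.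
Proof.
move=> e0; have [K K0 HK] := @bump_bounded R.
exists (e^-1 * K) => z.
have H x y : x <= y -> `|ramp z e y - ramp z e x| <= e^-1 * K * `|y - x|.
  move=> xy; have [] := @MVT_segment R (ramp z e) (kern z e) x y xy.
  - by move=> c _; exact: is_derive_ramp.
  - exact/continuous_subspaceT/ramp_continuous.
  have ei0 : 0 <= e^-1 by rewrite invr_ge0 ltW.
  by move=> c _ ->; rewrite normrM ler_wpM2r// /kern normrM (ger0_norm ei0) ler_wpM2l.
move=> x y; case: (leP x y) => [xy|/ltW xy]; last exact: H.
by rewrite distrC [X in _ * X]distrC; exact: H.
Qed.

Lemma kern_shift (z e x : R) : kern z e x = kern 0 e (x - z).
Proof. by rewrite /kern subr0. Qed.

Lemma derive1_kern_shift (z e x : R) :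
  derive1 (kern z e) x = derive1 (kern 0 e) (x - z).
Proof.
have -> : kern z e = (fun y => kern 0 e (y - z)).
  by apply/funext => y; exact: kern_shift.
exact: derive1_shift.
Qed.

Lemma kern_derive1_out (z e x : R) : 0 < e -> x \notin `[z, z + e] ->
  derive1 (kern z e) x = 0.
Proof.
by move=> e0; apply: derive1_out => y; exact: kern_out.
Qed.

Lemma Cb_path_kern (z : R -> R) (e : R) : 0 < e -> continuous z ->
  Cb_path (fun x t => kern (z t) e x).
Proof.
move=> e0 cz; rewrite (_ : (fun _ => _) = (fun x t => kern 0 e (x - z t))).
  by apply: Cb_path_test => //; exact: kern_test.
by apply/funext => x; apply/funext => t; rewrite kern_shift.
Qed.

Lemma Cb_path_derive1_kern (z : R -> R) (e : R) : 0 < e -> continuous z ->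
  Cb_path (fun x t => derive1 (kern (z t) e) x).
Proof.
move=> e0 cz; rewrite (_ : (fun _ => _) = (fun x t => derive1 (kern 0 e) (x - z t))).
  by apply: Cb_path_test => //; exact/test_function_derive1/kern_test.
by apply/funext => x; apply/funext => t; rewrite derive1_kern_shift.
Qed.

Lemma Cb_path_ramp (z : R -> R) (e : R) : 0 < e -> continuous z ->
  Cb_path (fun x t => 1 - ramp (z t) e x).
Proof.
move=> e0 cz; have [L HL] := ramp_lipschitz e0.
rewrite (_ : (fun _ => _) = (fun x t => (fun y => 1 - ramp 0 e y) (x - z t))).
  apply: (@Cb_path_shift R (fun y => 1 - ramp 0 e y) z L 1) => //.
    move=> x y; rewrite (_ : _ - _ - _ = ramp 0 e y - ramp 0 e x); last by ring.
    by rewrite distrC; exact: HL.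
  by move=> x; have := ramp_ge0 0 e x; have := ramp_le1 0 e x; rewrite ler_norml; lra.
by apply/funext => x; apply/funext => t; rewrite /ramp subr0.
Qed.

Lemma kern_moving_supp (z : R -> R) (e t0 : R) : 0 < e -> continuous z ->
  exists a b : R, \forall t \near t0, forall x, x \notin `[a, b] ->
    x \notin `[z t, z t + e].
Proof.
move=> e0 cz; exists (z t0 - 1), (z t0 + 1 + e).
have /cvgrPdist_le/(_ 1 ltr01) := cz t0.
apply: filterS => t zt x; apply: contra; rewrite !in_itv/=.
by move: zt; rewrite ler_norml; lra.
Qed.

Lemma lebesgue_moving_kern (g : R -> R -> R) (z : R -> R) (e : R) : 0 < e ->
  continuous z -> Cb_path g ->
  continuous (fun t => \int[lam]_x (g x t * kern (z t) e x)).
Proof.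
move=> e0 cz Cg; apply: (@lebesgue_moving_integral R (fun x t => g x t * kern (z t) e x)).
  by apply: Cb_pathM => //; exact: Cb_path_kern.
move=> t0; have [a [b H]] := kern_moving_supp t0 e0 cz; exists a, b.
by apply: filterS H => t Ht x /Ht xz; rewrite kern_out// mulr0.
Qed.

Lemma lebesgue_moving_derive1_kern (g : R -> R -> R) (z : R -> R) (e : R) : 0 < e ->
  continuous z -> Cb_path g ->
  continuous (fun t => \int[lam]_x (g x t * derive1 (kern (z t) e) x)).
Proof.
move=> e0 cz Cg.
apply: (@lebesgue_moving_integral R (fun x t => g x t * derive1 (kern (z t) e) x)).
  by apply: Cb_pathM => //; exact: Cb_path_derive1_kern.
move=> t0; have [a [b H]] := kern_moving_supp t0 e0 cz; exists a, b.
by apply: filterS H => t Ht x /Ht xz; rewrite kern_derive1_out// mulr0.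
Qed.

Section Identities.
Variables (u ux : R -> R -> R) (nu : R -> Mplus R).
Hypothesis sol : is_solution u ux nu.

(** In a frame of speed [k] mass flows with the relative velocity [u - k]. Continuity of both sides
    allows the weak derivative to be integrated between two given times. *)
Lemma transport_weak_derivative (psi : R -> R) (k : R) : test_function psi ->
  let A := fun t => \int[nu t]_x psi (x - k * t) in
  let B := fun t => \int[nu t]_x ((u x t - k) * derive1 psi (x - k * t)) in
  [/\ continuous A, continuous B & weak_derivative A B].
Proof.
move=> tp A B.
have ckt : continuous (fun t : R => k * t).
  by move=> t; apply: cvgM; [exact: cvg_cst|exact: cvg_id].
have P1 : Cb_path (fun x t => psi (x - k * t)) by exact: (Cb_path_test ckt tp).
have P2 : Cb_path (fun x t => (u x t - k) * derive1 psi (x - k * t)).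
  apply: Cb_pathM; last exact: (Cb_path_test ckt (test_function_derive1 tp)).
  apply: (@Cb_pathD _ u (fun _ _ => - k)); first exact: sol_path sol.
  exact: (@Cb_path_time _ (cst (- k)) (@cst_continuous _ _ _)).
have cA : continuous A by exact: weak_moving_integral (sol_weak sol) P1.
have cB : continuous B by exact: weak_moving_integral (sol_weak sol) P2.
split=> //; split; first exact: continuous_locally_integrable.
move=> theta tt.
have [a [b Ht]] := test_function_supp tt.
have [a' [b' Ht']] := test_function_supp (test_function_derive1 tt).
have i1 : lam.-integrable setT (EFin \o (fun t => A t * derive1 theta t)).
  apply: (@integrable_mul_csupp _ (derive1 theta) A a' b') => //.
    exact/test_function_continuous/test_function_derive1.
  exact: continuous_locally_integrable.
have i2 : lam.-integrable setT (EFin \o (fun t => B t * theta t)).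
  apply: (@integrable_mul_csupp _ theta B a b) => //.
    exact/test_function_continuous.
  exact: continuous_locally_integrable.
have := sol_transport sol (sheared_test k tt tp).
rewrite (_ : (fun t => _) = (fun t => A t * derive1 theta t + B t * theta t)).
  by rewrite RintegralD// => /eqP; rewrite addr_eq0 => /eqP.
apply/funext => t; rewrite /A /B.
rewrite -!RintegralZr//; last 2 first.
- by apply: integrable_Cb; have [] := P2.
- by apply: integrable_Cb; have [] := P1.
rewrite -RintegralD//; last 2 first.
- rewrite (_ : (fun x => _ * _) = (fun x => derive1 theta t * psi (x - k * t))).
    by apply: integrableRZ => //; apply: integrable_Cb; have [] := P1.
  by apply/funext => x; rewrite mulrC.
- rewrite (_ : (fun x => _ * _) =
    (fun x => theta t * ((u x t - k) * derive1 psi (x - k * t)))).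
    by apply: integrableRZ => //; apply: integrable_Cb; have [] := P2.
  by apply/funext => x; rewrite mulrC.
by apply: eq_Rintegral => x _; rewrite d_t_sheared// d_x_sheared//; ring.
Qed.

Definition average (z e t : R) : R := \int[lam]_x (u x t * kern z e x).

(** The time derivative of [average z e] when [z] moves with speed [k]: the flux [u^2 / 2] is
    corrected by [- k u] for the motion of the window, and the source [F / 2] appears averaged over
    the window, in the form given by [kern_cumulative]. *)
Definition average_rate (z e k t : R) : R :=
  \int[lam]_x ((u x t ^+ 2 / 2 - k * u x t) * derive1 (kern z e) x) +
  2^-1 * \int[nu t]_x (1 - ramp z e x).

Lemma average_continuous (z : R -> R) (e : R) : 0 < e -> continuous z ->
  continuous (fun t => average (z t) e t).
Proof.
by move=> e0 cz; apply: lebesgue_moving_kern => //; exact: sol_path sol.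
Qed.

Lemma average_rate_continuous (z k : R -> R) (e : R) : 0 < e ->
  continuous z -> continuous k ->
  continuous (fun t => average_rate (z t) e (k t) t).
Proof.
move=> e0 cz ck t; have Pu := sol_path sol.
apply: (@cvgD _ _ _ _ _
  (fun t => \int[lam]_x ((u x t ^+ 2 / 2 - k t * u x t) * derive1 (kern (z t) e) x))
  (fun t => 2^-1 * \int[nu t]_x (1 - ramp (z t) e x))).
  apply: (@lebesgue_moving_derive1_kern (fun x t => u x t ^+ 2 / 2 - k t * u x t)) => //.
  rewrite (_ : (fun _ => _) =
    (fun x t => u x t * (u x t * 2^-1) + (- k t) * u x t)); last first.
    by apply/funext => x; apply/funext => s; ring.
  apply: Cb_pathD; last first.
    apply: Cb_pathM => //; apply: (@Cb_path_time _ (fun t => - k t)).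
    by move=> s; apply: cvgN; exact: ck.
  apply: Cb_pathM => //; apply: Cb_pathM => //.
  exact: (@Cb_path_time _ (cst 2^-1) (@cst_continuous _ _ _)).
apply: cvgM; first exact: cvg_cst.
apply: (weak_moving_integral (sol_weak sol)).
exact: Cb_path_ramp.
Qed.

Lemma cumulative_locally_integrable t :
  locally_integrable setT (fun x => Defs.cumulative nu x t).
Proof.
have homF (x y : R) : x <= y -> Defs.cumulative nu x t <= Defs.cumulative nu y t.
  move=> xy; apply: fine_le; rewrite ?fin_num_measure//.
  by apply: le_measure; rewrite ?inE//; apply: subset_itvl; rewrite bnd_simp.
split; [exact: nondecreasing_measurable|exact: openT|].
move=> K _ cK; apply: le_lt_trans (_ : \int[lam]_(x in K) (cst (nu t setT)) x < +oo)%E.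
  have mK : measurable K by exact: compact_measurable.
  apply: ge0_le_integral => //.
  - apply/measurable_EFinP; apply: measurableT_comp => //; apply: measurable_funTS.
    exact: nondecreasing_measurable.
  - move=> x _; rewrite /= ger0_norm ?fine_ge0// /cumulative fineK ?fin_num_measure//.
    by apply: le_measure; rewrite ?inE.
rewrite integral_cst; last exact: compact_measurable.
rewrite lte_mul_pinfty ?fin_num_measure//; exact: compact_finite_measure.
Qed.

(** The velocity equation is tested with a sheared kernel. Removing [u_x] by [weak_derivative_chain]
    and [F] by [kern_cumulative] leaves quantities that are continuous in time, although neither
    [u_x] nor [F] needs to be. *)
Lemma average_weak_derivative (a e k : R) : 0 < e ->
  weak_derivative (fun t => average (a + k * t) e t)
                  (fun t => average_rate (a + k * t) e k t).
Proof.
move=> e0.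
have cz : continuous (fun t : R => a + k * t).
  by move=> t; apply: cvgD; [exact: cvg_cst|apply: cvgM; [exact: cvg_cst|exact: cvg_id]].
have cA := average_continuous e0 cz.
have cB := average_rate_continuous e0 cz (@cst_continuous _ _ k).
set A := fun t => _ in cA *; set B := fun t => _ in cB *.
split; first exact: continuous_locally_integrable.
move=> theta tt.
have [c [d Ht]] := test_function_supp tt.
have [c' [d' Ht']] := test_function_supp (test_function_derive1 tt).
have i1 : lam.-integrable setT (EFin \o (fun t => A t * derive1 theta t)).
  apply: (@integrable_mul_csupp _ (derive1 theta) A c' d') => //.
    exact/test_function_continuous/test_function_derive1.
  exact: continuous_locally_integrable.
have i2 : lam.-integrable setT (EFin \o (fun t => B t * theta t)).
  apply: (@integrable_mul_csupp _ theta B c d) => //.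
    exact/test_function_continuous.
  exact: continuous_locally_integrable.
have tk z : test_function (kern z e) by exact: kern_test.
have := sol_velocity sol (sheared_test k tt (tk a)).
rewrite (_ : (fun t => _) = (fun t => A t * derive1 theta t + B t * theta t)).
  by rewrite RintegralD// => /eqP; rewrite addr_eq0 => /eqP.
apply/funext => t; rewrite /A /B /average /average_rate.
set z := a + k * t.
have kE x : kern a e (x - k * t) = kern z e x.
  by rewrite [LHS]kern_shift [RHS]kern_shift /z; congr (kern _ _ _); ring.
have kE' x : derive1 (kern a e) (x - k * t) = derive1 (kern z e) x.
  by rewrite [LHS]derive1_kern_shift [RHS]derive1_kern_shift /z; congr (derive1 _ _); ring.
have cu : continuous (u ^~ t) by have [/(_ t)[]] := sol_path sol.
have iK (g : R -> R) : locally_integrable setT g ->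
    lam.-integrable setT (EFin \o (fun x => g x * kern z e x)).
  move=> ig; apply: (@integrable_mul_csupp _ (kern z e) g z (z + e)) => //.
    exact: kern_continuous.
  by move=> x; exact: kern_out.
have iK' (g : R -> R) : locally_integrable setT g ->
    lam.-integrable setT (EFin \o (fun x => g x * derive1 (kern z e) x)).
  move=> ig; apply: (@integrable_mul_csupp _ (derive1 (kern z e)) g z (z + e)) => //.
    exact/test_function_continuous/test_function_derive1.
  by move=> x; exact: kern_derive1_out.
have cu2 : continuous (fun x => u x t ^+ 2 / 2).
  by move=> x; apply: cvgM; [apply: cvgM; exact: cu|exact: cvg_cst].
have j1 : lam.-integrable setT (EFin \o (fun x => u x t * kern z e x)).
  exact/iK/continuous_locally_integrable.
have j2 : lam.-integrable setT (EFin \o (fun x => u x t * derive1 (kern z e) x)).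
  exact/iK'/continuous_locally_integrable.
have j2' : lam.-integrable setT (EFin \o (fun x => u x t ^+ 2 / 2 * derive1 (kern z e) x)).
  exact/iK'/continuous_locally_integrable.
have j3 : lam.-integrable setT (EFin \o (fun x => Defs.cumulative nu x t * kern z e x)).
  exact/iK/cumulative_locally_integrable.
have j4 : lam.-integrable setT (EFin \o (fun x => kern z e x * (u x t * ux x t))).
  have [ig _] := sol_dx sol t.
  have := @integrable_mul_csupp _ (fun x => kern z e x * u x t) (ux ^~ t) z (z + e).
  rewrite (_ : (fun x => ux x t * _) = (fun x => kern z e x * (u x t * ux x t))); last first.
    by apply/funext => x; ring.
  apply=> //.
    by move=> x; apply: cvgM; [exact: kern_continuous|exact: cu].
  by move=> x xz; rewrite kern_out// mul0r.
have chain := weak_derivative_chain cu (sol_dx sol t) (tk z).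
rewrite -(kern_cumulative (nu t) z e0) -/(Defs.cumulative nu _ t).
have -> : \int[lam]_x (kern z e x * fine (nu t `]-oo, x]%classic)) =
    \int[lam]_x (Defs.cumulative nu x t * kern z e x).
  by apply: eq_Rintegral => x _; rewrite mulrC.
have -> : \int[lam]_x ((u x t ^+ 2 / 2 - k * u x t) * derive1 (kern z e) x) =
    - (\int[lam]_x (kern z e x * (u x t * ux x t))) -
    k * \int[lam]_x (u x t * derive1 (kern z e) x).
  rewrite chain opprK -RintegralZl// -RintegralB//; last exact: integrableRZ.
  by apply: eq_Rintegral => x _; ring.
transitivity (\int[lam]_x (derive1 theta t * (u x t * kern z e x)
    - theta t * k * (u x t * derive1 (kern z e) x)
    - theta t * (kern z e x * (u x t * ux x t))
    + theta t / 2 * (Defs.cumulative nu x t * kern z e x))).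
  apply: eq_Rintegral => x _; rewrite d_t_sheared// /sheared/= kE kE'.
  by field.
rewrite RintegralD//; last 2 first.
- by apply: integrableRB => //; [apply: integrableRB => //|]; exact: integrableRZ.
- exact: integrableRZ.
rewrite RintegralB//; last 2 first.
- by apply: integrableRB => //; exact: integrableRZ.
- exact: integrableRZ.
rewrite RintegralB//; last 2 first.
- exact: integrableRZ.
- exact: integrableRZ.
rewrite !RintegralZl//; ring.
Qed.

End Identities.
End Solution.

(** * Transport of mass across lines *)

Section DistributionFunctions.
Context {R : realType}.
Implicit Types (m : Mplus R) (x y : R).

(** An atom at [x] is the gap between the closed distribution function [cdfc] and the open one
    [cdfo]. *)
Definition cdfc m x : R := fine (m [set` `]-oo, x]]).
Definition cdfo m x : R := fine (m [set` `]-oo, x[]).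

Lemma fine_measure_le m (A B : set (measurableTypeR R)) :
  measurable A -> measurable B -> A `<=` B -> fine (m A) <= fine (m B).
Proof.
move=> mA mB AB; apply: fine_le; rewrite ?fin_num_measure//.
by apply: le_measure; rewrite ?inE.
Qed.

Lemma cdfo_le_cdfc m x : cdfo m x <= cdfc m x.
Proof. by apply: fine_measure_le => //; apply: subset_itvl; rewrite bnd_simp. Qed.

Lemma cdfc_le_cdfo m x y : x < y -> cdfc m x <= cdfo m y.
Proof. by move=> xy; apply: fine_measure_le => //; apply: subset_itvl; rewrite bnd_simp. Qed.

Lemma le_cdfc m x y : x <= y -> cdfc m x <= cdfc m y.
Proof. by move=> xy; apply: fine_measure_le => //; apply: subset_itvl; rewrite bnd_simp. Qed.

Lemma cdfo_ge0 m x : 0 <= cdfo m x.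
Proof. exact: fine_ge0. Qed.

Lemma cdfc_le_mass m x : cdfc m x <= fine (m setT).
Proof. by apply: fine_measure_le. Qed.

Lemma fine_cvg_measure m (A : set (measurableTypeR R)) (B : nat -> set (measurableTypeR R)) :
  measurable A -> m (B n) @[n --> \oo] --> m A -> fine (m (B n)) @[n --> \oo] --> fine (m A).
Proof.
by move=> mA H; apply: fine_cvg; rewrite fineK ?fin_num_measure//.
Qed.

Lemma cdfc_truncation m x :
  fine (m [set` `[x - n.+1%:R, x]]) @[n --> \oo] --> cdfc m x.
Proof.
apply: fine_cvg_measure => //.
have E : [set` `]-oo, x]] = \bigcup_n ([set` `[x - n.+1%:R, x]] : set R).
  apply/seteqP; split=> [y/=|y [n _]/=]; last by rewrite !in_itv/= => /andP[].
  rewrite in_itv/= => yx; exists (Num.bound (x - y)) => //=.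
  rewrite in_itv/= yx andbT lerBlDr -lerBlDl ltW//.
  apply: lt_trans (archi_boundP _) _; first by rewrite subr_ge0.
  by rewrite ltr_nat.
rewrite E; apply: nondecreasing_cvg_mu => //.
  by apply: bigcup_measurable => n _.
move=> p q pq; apply/subsetPset/subset_itv; rewrite bnd_simp//.
by rewrite lerB// ler_nat.
Qed.

Lemma cdfc_right_cvg m x (c : R) : 0 < c ->
  cdfc m (x + c / n.+1%:R) @[n --> \oo] --> cdfc m x.
Proof.
move=> c0; apply: (@fine_cvg_measure m _ (fun n => [set` `]-oo, x + c / n.+1%:R]])) => //.
have E : [set` `]-oo, x]] = \bigcap_n ([set` `]-oo, x + c / n.+1%:R]] : set R).
  apply/seteqP; split=> [y/=|y H/=].
    rewrite in_itv/= => yx n _ /=; rewrite in_itv/= (le_trans yx)// lerDl.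
    by rewrite divr_ge0// ltW.
  rewrite in_itv/= leNgt; apply/negP => xy.
  have yx0 : 0 < y - x by rewrite subr_gt0.
  have := H (Num.bound (c / (y - x))) I; rewrite /= in_itv/= leNgt => /negP; apply.
  rewrite -ltrBrDl ltr_pdivrMr// mulrC -ltr_pdivrMr//.
  apply: lt_trans (archi_boundP _) _; first by rewrite divr_ge0// ltW.
  by rewrite ltr_nat.
rewrite E; apply: nonincreasing_cvg_mu => //.
- by rewrite ltey_eq fin_num_measure.
- by apply: bigcap_measurable => //; exists 0%N.
- move=> p q pq; apply/subsetPset/subset_itvl; rewrite bnd_simp.
  by rewrite lerD2l ler_pM2l// lef_pV2 ?posrE// ler_nat.
Qed.

Lemma cdfo_left_cvg m x (c : R) : 0 < c ->
  cdfc m (x - c / n.+1%:R) @[n --> \oo] --> cdfo m x.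
Proof.
move=> c0; apply: (@fine_cvg_measure m _ (fun n => [set` `]-oo, x - c / n.+1%:R]])) => //.
have E : [set` `]-oo, x[] = \bigcup_n ([set` `]-oo, x - c / n.+1%:R]] : set R).
  apply/seteqP; split=> [y/=|y [n _]/=]; rewrite !in_itv/=; last first.
    by move=> yx; rewrite (le_lt_trans yx)// ltrBlDr ltrDl divr_gt0.
  move=> yx; have yx0 : 0 < x - y by rewrite subr_gt0.
  exists (Num.bound (c / (x - y))) => //=; rewrite in_itv/=.
  rewrite lerBrDr -lerBrDl ler_pdivrMr// mulrC -ler_pdivrMr// ltW//.
  apply: lt_trans (archi_boundP _) _; first by rewrite divr_ge0// ltW.
  by rewrite ltr_nat.
rewrite E; apply: nondecreasing_cvg_mu => //.
  by apply: bigcup_measurable => n _.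
move=> p q pq; apply/subsetPset/subset_itvl; rewrite bnd_simp.
by rewrite lerD2l lerN2 ler_pM2l// lef_pV2 ?posrE// ler_nat.
Qed.

Lemma integrable_patch1 m (D : set (measurableTypeR R)) : measurable D ->
  m.-integrable setT (EFin \o ((fun=> 1 : R) \_ D)).
Proof.
move=> mD; have /(integrable_mkcond _ mD) := finite_measure_integrable_cst m (1 : R) mD.
rewrite (_ : _ \_ D = EFin \o ((fun=> 1 : R) \_ D))//.
by apply/funext => x /=; rewrite !patchE; case: ifP.
Qed.

Lemma cdfB m x y : x < y -> fine (m [set` `]x, y[]) = cdfo m y - cdfc m x.
Proof.
move=> xy; apply/eqP; rewrite eq_sym subr_eq; apply/eqP; rewrite /cdfo /cdfc.
have -> : [set` `]-oo, y[] = [set` `]x, y[] `|` [set` `]-oo, x]] :> set R.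
  apply/seteqP; split=> z /=; rewrite !in_itv/=.
    by move=> zy; case: (leP z x) => zx; [right|left; rewrite zy].
  by case=> [/andP[]//|zx]; exact: le_lt_trans xy.
rewrite measureU//; first by rewrite fineD ?fin_num_measure.
apply/seteqP; split=> z //= []; rewrite !in_itv/= => /andP[xz _] zx.
by have := lt_le_trans xz zx; rewrite ltxx.
Qed.

End DistributionFunctions.

(** * Comparison of distribution functions along a moving line *)

Section Transport.
Context {R : realType}.
Notation lam := (@lebesgue_measure R).
Variables (u ux : R -> R -> R) (nu : R -> Mplus R).
Hypothesis sol : is_solution u ux nu.

(* The sign condition covers both orders of [t] and [t']: mass crosses the line leftwards
   when [u <= k] near it, and rightwards when [u >= k]. *)
Lemma transport_cdfc_le (xi k t t' C h0 : R) : 0 < h0 ->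
  (forall s, Num.min t t' <= s <= Num.max t t' ->
     (forall x, `|u x s| <= C) /\ fine (nu s setT) <= C) ->
  (forall s x, Num.min t t' <= s <= Num.max t t' -> `|x - (xi + k * s)| <= h0 ->
     0 <= (t' - t) * (k - u x s)) ->
  cdfc (nu t) (xi + k * t) <= cdfc (nu t') (xi + k * t').
Proof.
move=> h00 HC Hu; have [Kb Kb0 HKb] := @bump_bounded R.
pose D := (C + `|k|) * Kb * C * `|t' - t|.
have tmin : Num.min t t' <= t <= Num.max t t' by rewrite ge_min le_max !lexx.
have C0 : 0 <= C by have [/(_ 0) H _] := HC _ tmin; exact: le_trans H.
(* In the moving frame this is 1 on [[xi - n.+1, xi]] and vanishes beyond [xi + h0 / n.+1]. The left
   flank has width [n.+1], so its slope, and with it the spurious flux there, is of order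
   [1 / n.+1]; the steep right flank stays inside the strip where the sign of [k - u] is known.
   [D / n.+1] collects the spurious flux over the whole time span. *)
pose psi n x : R := ramp (xi - 2 * n.+1%:R) n.+1%:R x - ramp xi (h0 / n.+1%:R) x.
have n0 n : (0 : R) < n.+1%:R by [].
have hn0 n : (0 : R) < h0 / n.+1%:R by rewrite divr_gt0.
have tp n : test_function (psi n).
  move: (hn0 n) (n0 n); rewrite /psi; set a := h0 / _; set b := n.+1%:R => a0 b0.
  by apply: trapezoid_test => //; lra.
have psi_ge0 n x : 0 <= psi n x.
  rewrite /psi subr_ge0; case: (leP x xi) => xxi.
    by rewrite [X in X <= _]ramp_le// ramp_ge0.
  rewrite [X in _ <= X]ramp_ge ?ramp_le1//.
  by move: (n0 n); set b := n.+1%:R => b0; lra.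
have dpsi n x : derive1 (psi n) x =
    kern (xi - 2 * n.+1%:R) n.+1%:R x - kern xi (h0 / n.+1%:R) x.
  by apply: derive1_eq; exact: is_derive_trapezoid.
pose A n s := \int[nu s]_x psi n (x - k * s).
pose B n s := \int[nu s]_x ((u x s - k) * derive1 (psi n) (x - k * s)).
have kb z e x : 0 < e -> `|kern z e x| <= e^-1 * Kb.
  move=> e0; have ei : 0 <= e^-1 by rewrite invr_ge0 ltW.
  by rewrite [leLHS]normrM (ger0_norm ei) ler_wpM2l.
have ib n s : (nu s).-integrable setT
    (EFin \o (fun x => (u x s - k) * derive1 (psi n) (x - k * s))).
  apply: integrable_Cb; have cks : continuous (fun _ : R => k * s) by exact: cst_continuous.
  have P1 := Cb_path_test cks (test_function_derive1 (tp n)).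
  have P2 := Cb_pathD (sol_path sol) (@Cb_path_time R (cst (- k)) (@cst_continuous _ _ _)).
  by have [/(_ s)] := Cb_pathM P2 P1.
have ipsi n s : (nu s).-integrable setT (EFin \o (fun x => psi n (x - k * s))).
  apply: integrable_Cb; have cks : continuous (fun _ : R => k * s) by exact: cst_continuous.
  by have [/(_ s)] := Cb_path_test cks (tp n).
have Bge n s : Num.min t t' <= s <= Num.max t t' ->
    - ((C + `|k|) * Kb * C * `|t' - t| / n.+1%:R) <= (t' - t) * B n s.
  move=> sI; have [us ms] := HC s sI.
  rewrite -RintegralZl//; last exact: ib.
  have E0 : 0 <= `|t' - t| * ((C + `|k|) * (n.+1%:R^-1 * Kb)).
    by rewrite !mulr_ge0 ?invr_ge0 ?addr_ge0// ltW.
  apply: (@le_trans _ _ (\int[nu s]_x (cst (- (`|t' - t| * ((C + `|k|) * (n.+1%:R^-1 * Kb)))) x))).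
    rewrite Rintegral_cst// mulNr lerN2.
    rewrite (_ : (C + _) * _ * C * _ / _ = `|t' - t| * ((C + `|k|) * (n.+1%:R^-1 * Kb)) * C).
      by rewrite ler_wpM2l.
    by ring.
  apply: le_Rintegral => //.
  - exact: finite_measure_integrable_cst.
  - by apply: integrableRZ => //; exact: ib.
  move=> x _; rewrite dpsi mulrBr mulrBr.
  have H1 : - (`|t' - t| * ((C + `|k|) * (n.+1%:R^-1 * Kb))) <=
      (t' - t) * ((u x s - k) * kern (xi - 2 * n.+1%:R) n.+1%:R (x - k * s)).
    rewrite lerNl; apply: le_trans (ler_norm _) _; rewrite normrN normrM.
    rewrite ler_wpM2l// [leLHS]normrM; apply: ler_pM => //; last exact: kb.
    by apply: le_trans (ler_normB _ _) _; rewrite lerD2r.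
  apply: le_trans H1 _; rewrite lerDl -mulrN -mulNr opprB mulrA.
  case: (boolP (x - k * s \in `[xi, xi + h0 / n.+1%:R])) => [|xo]; last first.
    by rewrite kern_out// mulr0.
  rewrite in_itv/= => /andP[x1 x2]; rewrite mulr_ge0 ?kern_ge0//; apply: Hu => //.
  have hn : h0 / n.+1%:R <= h0 by rewrite ler_pdivrMr// ler_peMr ?ler1n//; exact: ltW.
  have {}x2 : x - k * s <= xi + h0 by rewrite (le_trans x2)// lerD2l.
  have H : forall y : R, xi <= y - k * s -> y - k * s <= xi + h0 ->
    `|y - (xi + k * s)| <= h0 by move=> y; rewrite ler_norml; move: h00; lra.
  exact: H.
have AA n : A n t <= A n t' + D / n.+1%:R.
  have [cA cB wAB] := transport_weak_derivative sol k (tp n).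
  have intB a b : lam.-integrable `[a, b] (EFin \o B n).
    exact: integrable_continuous_itv.
  have intc a b (c : R) : lam.-integrable `[a, b] (EFin \o cst c).
    by apply: integrable_continuous_itv; exact: cst_continuous.
  pose c := (C + `|k|) * Kb * C / n.+1%:R.
  have len (a b c' : R) : a <= b -> \int[lam]_(x in `[a, b]) (cst c' x) = c' * (b - a).
    move=> ab; rewrite Rintegral_cst//= lebesgue_measure_itv/= lte_fin.
    case: ltP => //= ba; have -> : a = b by apply/eqP; rewrite eq_le ab.
    by rewrite subrr.
  have DE : D / n.+1%:R = c * `|t' - t| by rewrite /D /c; ring.
  case: (ltgtP t t') => [tt'|tt'|->]; last first.
  - rewrite lerDl DE mulr_ge0// /c !mulr_ge0 ?invr_ge0 ?addr_ge0//; exact: ltW.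
  - have := weak_derivative_increment cA wAB (ltW tt'); rewrite -/(A n) -/(B n).
    rewrite DE ltr0_norm ?subr_lt0// opprB -(len _ _ c (ltW tt')) => E.
    rewrite -lerBlDl E; apply: le_Rintegral => // s; rewrite /= in_itv/= => sI.
    have := Bge n s; rewrite (min_r (ltW tt')) (max_l (ltW tt')) => /(_ sI).
    have -> : `|t' - t| = - (t' - t) by rewrite ltr0_norm// subr_lt0.
    move=> H.
    rewrite -(@ler_nM2l _ (t' - t)) ?subr_lt0//; apply: le_trans H.
    by rewrite /c le_eqVlt; apply/orP; left; apply/eqP; ring.
  - have := weak_derivative_increment cA wAB (ltW tt'); rewrite -/(A n) -/(B n).
    rewrite DE gtr0_norm ?subr_gt0// => E.
    have {}E : A n t' - A n t = \int[lam]_(x in `[t, t']) B n x := E.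
    suff : - c * (t' - t) <= A n t' - A n t by rewrite mulNr; lra.
    rewrite E -(len _ _ (- c) (ltW tt')).
    apply: le_Rintegral => // s; rewrite /= in_itv/= => sI.
    have := Bge n s; rewrite (min_l (ltW tt')) (max_r (ltW tt')) => /(_ sI).
    have -> : `|t' - t| = t' - t by rewrite gtr0_norm// subr_gt0.
    move=> H.
    rewrite -(@ler_pM2l _ (t' - t)) ?subr_gt0//; apply: le_trans H.
    by rewrite /c le_eqVlt; apply/orP; left; apply/eqP; ring.
have lo n : fine (nu t [set` `[xi + k * t - n.+1%:R, xi + k * t]]) <= A n t.
  rewrite -[leLHS]mul1r -Rintegral_cst// Rintegral_mkcond; apply: le_Rintegral => //.
  - exact: integrable_patch1.
  - exact: ipsi.
  move=> x _; rewrite patchE; case: ifPn => // /[!inE]/=; move: {x}(x : R) => x.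
  rewrite in_itv/= => /andP[x1 x2].
  move: (n0 n) (hn0 n) x1; rewrite /psi; set a := h0 / _; set b := n.+1%:R => b0 a0 x1.
  by rewrite ramp_ge ?(@ramp_le _ xi) ?subr0//; lra.
have hi n : A n t' <= cdfc (nu t') (xi + k * t' + h0 / n.+1%:R).
  rewrite -[leRHS]mul1r -Rintegral_cst// Rintegral_mkcond; apply: le_Rintegral => //.
  - exact: ipsi.
  - exact: integrable_patch1.
  move=> x _; rewrite patchE; case: ifPn => [_|/negP].
    by rewrite /psi lerBlDr (le_trans (ramp_le1 _ _ _))// lerDl ramp_ge0.
  rewrite inE/=; move: {x}(x : R) => x; rewrite in_itv/= => /negP.
  rewrite -ltNge => xx.
  move: (hn0 n) (n0 n) xx; rewrite /psi; set a := h0 / _; set b := n.+1%:R => a0 b0 xx.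
  by rewrite !ramp_ge ?subrr//; lra.
have cvgR : cdfc (nu t') (xi + k * t' + h0 / n.+1%:R) + D / n.+1%:R @[n --> \oo] -->
    cdfc (nu t') (xi + k * t') + D * 0.
  apply: cvgD; first exact: cdfc_right_cvg.
  apply: cvgM; first exact: cvg_cst.
  exact: cvg_harmonic.
rewrite mulr0 addr0 in cvgR.
apply: ler_cvg_to (@cdfc_truncation R (nu t) (xi + k * t)) cvgR _.
apply: nearW => n; apply: le_trans (lo n) _; apply: le_trans (AA n) _.
by rewrite lerD2r.
Qed.

(** An open half-line is the increasing union of closed ones, so the closed comparison is applied to
    lines shifted to the left by at most [h0 / 2]; the half strips around these lines lie in the
    original strip. *)
Lemma transport_cdfo_le (xi k t t' C h0 : R) : 0 < h0 ->
  (forall s, Num.min t t' <= s <= Num.max t t' ->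
     (forall x, `|u x s| <= C) /\ fine (nu s setT) <= C) ->
  (forall s x, Num.min t t' <= s <= Num.max t t' -> `|x - (xi + k * s)| <= h0 ->
     0 <= (t' - t) * (k - u x s)) ->
  cdfo (nu t) (xi + k * t) <= cdfo (nu t') (xi + k * t').
Proof.
move=> h00 HC Hu.
have h20 : 0 < h0 / 2 by rewrite divr_gt0.
apply: (ler_cvg_to (@cdfo_left_cvg R (nu t) (xi + k * t) _ h20)
                   (@cdfo_left_cvg R (nu t') (xi + k * t') _ h20)).
apply: nearW => n.
have hn : h0 / 2 / n.+1%:R <= h0 / 2 by rewrite ler_pdivrMr// ler_peMr ?ler1n//; exact: ltW.
have hn0 : 0 <= h0 / 2 / n.+1%:R by rewrite divr_ge0// ltW.
have E s : xi + k * s - h0 / 2 / n.+1%:R = xi - h0 / 2 / n.+1%:R + k * s by ring.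
rewrite !E; apply: (@transport_cdfc_le _ k t t' C (h0 / 2)) => // s x sI.
rewrite ler_norml => xs; apply: Hu => //; move: hn hn0 xs.
by set a := h0 / 2 / _ => hn hn0 xs; rewrite ler_norml; lra.
Qed.

Lemma velocity_jointly_continuous (x0 t0 e : R) : 0 < e ->
  exists2 r, 0 < r & forall x t, `|x - x0| < r -> `|t - t0| < r -> `|u x t - u x0 t0| <= e.
Proof.
move=> e0; have [Cu uu] := sol_path sol.
have e20 : 0 < e / 2 by rewrite divr_gt0.
have [r1 /= r10 H1] := uu t0 _ e20.
have [/(_ x0)/cvgrPdist_le/(_ _ e20)[r2 /= r20 H2] _] := Cu t0.
exists (Num.min r1 r2); first by rewrite lt_min r10.
move=> x t; rewrite !lt_min => /andP[_ x2] /andP[t1 _].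
have -> : u x t - u x0 t0 = (u x t - u x t0) - (u x0 t0 - u x t0) by ring.
apply: le_trans (ler_normB _ _) _; rewrite [e]splitr lerD//.
  by apply: H1; rewrite /= distrC.
by apply: H2; rewrite /= distrC.
Qed.

Lemma locally_bounded (t0 : R) : exists C r, 0 < r /\ forall s, `|s - t0| < r ->
  (forall x, `|u x s| <= C) /\ fine (nu s setT) <= C.
Proof.
have [Cu uu] := sol_path sol.
have [r1 /= r10 H1] := uu t0 _ ltr01.
have /CbP[_ [M HM]] := Cu t0.
have cm : continuous (fun t => fine (nu t setT)) by exact: mass_continuous (sol_weak sol).
have /cvgrPdist_le/(_ 1 ltr01)[r2 /= r20 H2] := cm t0.
exists (Num.max (M + 1) (fine (nu t0 setT) + 1)), (Num.min r1 r2).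
split; first by rewrite lt_min r10.
move=> s; rewrite lt_min => /andP[s1 s2]; split=> [x|].
  rewrite le_max; apply/orP; left.
  have -> : u x s = u x t0 + (u x s - u x t0) by ring.
  apply: le_trans (ler_normD _ _) _; rewrite lerD//.
  by apply: H1; rewrite /= distrC.
rewrite le_max; apply/orP; right.
by have := H2 s; rewrite /= distrC => /(_ s2); rewrite ler_norml; lra.
Qed.

(** Close to [(x0, t0)] the velocity is within [d] of [u x0 t0]. Two lines whose speeds differ from
    it by [d] therefore bracket the motion: no mass is lost to the left of the outer one and none is
    gained to the left of the inner one. *)
Lemma transport_step (x0 t0 d : R) : 0 < d ->
  exists2 r, 0 < r & forall h, `|h| < r ->
    cdfc (nu t0) x0 <= cdfc (nu (t0 + h)) (x0 + h * u x0 t0 + d * `|h|) /\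
    cdfo (nu (t0 + h)) (x0 + h * u x0 t0 - d * `|h|) <= cdfo (nu t0) x0.
Proof.
move=> d0; have [C [r1 [r10 HC]]] := locally_bounded t0.
have [r2 r20 Hu] := velocity_jointly_continuous x0 t0 d0.
set U := u x0 t0 in Hu *.
(* [K] dominates the speed of both comparison lines. With [|h| * K < r2 / 2], a strip of half-width
   [r2 / 2] around such a line remains within [r2] of [x0]. *)
pose K := `|U| + d + 1.
have K0 : 0 < K by rewrite ltr_wpDl// addr_ge0// ltW.
exists (Num.min (Num.min r1 r2) (r2 / 2 / K)).
  by rewrite !lt_min r10 r20 !divr_gt0.
move=> h; rewrite !lt_min => /andP[/andP[h1 h2] h3].
have hK : `|h| * K < r2 / 2 by rewrite -ltr_pdivlMr.
have r220 : 0 < r2 / 2 by rewrite divr_gt0.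
have sgh : Num.sg h * h = `|h| by rewrite normrEsg.
have near_line (k : R) s x : `|k| <= `|U| + d -> `|s - t0| <= `|h| ->
    `|x - (x0 - k * t0 + k * s)| <= r2 / 2 -> `|u x s - U| <= d.
  move=> kK sh xs; apply: Hu; last exact: le_lt_trans h2.
  have -> : x - x0 = (x - (x0 - k * t0 + k * s)) + k * (s - t0) by ring.
  apply: le_lt_trans (ler_normD _ _) _; rewrite normrM.
  have : `|k| * `|s - t0| <= K * `|h| by rewrite ler_pM// (le_trans kK)// lerDl.
  by move: hK; rewrite mulrC; lra.
have sgn1 : `|Num.sg h * d| <= d.
  rewrite normrM (gtr0_norm d0) ger_pMl// normr_sg.
  by case: (h == 0).
have btw s a b : (a = t0 /\ b = t0 + h) \/ (a = t0 + h /\ b = t0) ->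
    Num.min a b <= s <= Num.max a b -> `|s - t0| <= `|h|.
  move=> ab; have -> : Num.min a b = Num.min t0 (t0 + h).
    by case: ab => -[-> ->] //; rewrite minC.
  have -> : Num.max a b = Num.max t0 (t0 + h).
    by case: ab => -[-> ->] //; rewrite maxC.
  rewrite minEle maxEle; case: (leP 0 h) => h0.
    by rewrite lerDl h0 (ger0_norm h0) ler_norml; lra.
  have -> : (t0 <= t0 + h) = false by rewrite lerDl; apply/negbTE; rewrite -ltNge.
  by rewrite (ltr0_norm h0) ler_norml; lra.
split.
(* The sign of [h] puts the line at [x0 + h * U + d * |h|] at the final time, to the right of the
   expected position whether time runs forward or backward. *)
- pose k := U + Num.sg h * d.
  have kK : `|k| <= `|U| + d by apply: le_trans (ler_normD _ _) _; rewrite lerD2l.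
  have := @transport_cdfc_le (x0 - k * t0) k t0 (t0 + h) C (r2 / 2) r220.
  have -> : x0 - k * t0 + k * t0 = x0 by ring.
  have -> : x0 - k * t0 + k * (t0 + h) = x0 + h * U + d * `|h|.
    by rewrite -sgh /k; ring.
  apply=> [s /btw sI|s x /btw sI xs].
    by apply: HC; apply: le_lt_trans h1; apply: sI; left.
  have := near_line k s x kK (sI ltac:(by left)) xs.
  have -> : (t0 + h - t0) * (k - u x s) = d * `|h| - h * (u x s - U).
    by rewrite -sgh /k; ring.
  move=> ud; rewrite subr_ge0; apply: le_trans (ler_norm _) _.
  by rewrite normrM mulrC ler_wpM2r.
(* Here the comparison runs in the opposite direction, from time [t0 + h] to time [t0]. *)
- pose k := U - Num.sg h * d.
  have kK : `|k| <= `|U| + d by apply: le_trans (ler_normB _ _) _; rewrite lerD2l.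
  have := @transport_cdfo_le (x0 - k * t0) k (t0 + h) t0 C (r2 / 2) r220.
  have -> : x0 - k * t0 + k * t0 = x0 by ring.
  have -> : x0 - k * t0 + k * (t0 + h) = x0 + h * U - d * `|h|.
    by rewrite -sgh /k; ring.
  apply=> [s /btw sI|s x /btw sI xs].
    by apply: HC; apply: le_lt_trans h1; apply: sI; right.
  have := near_line k s x kK (sI ltac:(by right)) xs.
  have -> : (t0 - (t0 + h)) * (k - u x s) = d * `|h| - (- h) * (u x s - U).
    by rewrite -sgh /k; ring.
  move=> ud; rewrite subr_ge0; apply: le_trans (ler_norm _) _.
  by rewrite normrM normrN mulrC ler_wpM2r.
Qed.

End Transport.

(** * Lagrangian coordinates *)

Section Quantiles.
Context {R : realType}.
Variable m : Mplus R.

(** The point [(x, c)] lies on the graph of the distribution function, completed by a vertical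
    segment at each atom. The level [c] will be the conserved label, and [x + c] the Lagrangian
    variable. *)
Definition at_level (x c : R) : bool := cdfo m x <= c <= cdfc m x.

(** The completed graph is a monotone curve, and along such a curve both coordinates increase with
    their sum. *)
Lemma at_level_mono (x c x' c' : R) : at_level x c -> at_level x' c' ->
  x + c <= x' + c' -> x <= x' /\ c <= c'.
Proof.
move=> /andP[x1 x2] /andP[x1' x2'] s.
case: (ltgtP x x') => [xx'|xx'|xx'].
- by have := cdfc_le_cdfo m xx' => ?; split; lra.
- by have := cdfc_le_cdfo m xx' => ?; split; lra.
- by split; lra.
Qed.

(** The abscissa is the last point at which [x + F(x-)] has not exceeded [b]; approaching it from
    the left and from the right yields the two inequalities. *)
Lemma at_level_exists (b : R) : exists x, at_level x (b - x).
Proof.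
pose S := [set x : R | x + cdfo m x <= b].
have S0 : S (b - fine (m setT)).
  rewrite /S/= -lerBrDl subKr.
  by apply: le_trans (cdfo_le_cdfc m _) _; exact: cdfc_le_mass.
have Sb : ubound S b.
  by move=> x; rewrite /S/=; have := cdfo_ge0 m x; lra.
have supS : has_sup S by split; [exists (b - fine (m setT))|exists b].
have n0 n : (0 : R) < 1 / n.+1%:R by rewrite divr_gt0.
have lim0 (c : R) : c + 1 / n.+1%:R @[n --> \oo] --> c.
  rewrite -[X in _ --> X]addr0; apply: cvgD; first exact: cvg_cst.
  rewrite (_ : (fun n => _) = @harmonic R); first exact: cvg_harmonic.
  by apply/funext => n; rewrite div1r.
have lim0' (c : R) : c - 1 / n.+1%:R @[n --> \oo] --> c.
  rewrite -[X in _ --> X]subr0; apply: cvgB; first exact: cvg_cst.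
  rewrite (_ : (fun n => _) = @harmonic R); first exact: cvg_harmonic.
  by apply/funext => n; rewrite div1r.
exists (sup S); apply/andP; split.
  apply: (ler_cvg_to (@cdfo_left_cvg _ m (sup S) _ ltr01) (lim0 (b - sup S))).
  apply: nearW => n; have [y Sy yc] := sup_adherent (n0 n) supS.
  have := cdfc_le_cdfo m yc; move: Sy yc; rewrite /S/=; set d := 1 / _ => Sy yc H.
  by apply: le_trans H _; move: Sy yc; lra.
apply: (ler_cvg_to (lim0' (b - sup S)) (@cdfc_right_cvg _ m (sup S) _ ltr01)).
apply: nearW => n; rewrite leNgt; apply/negP; move: (n0 n).
set d := 1 / n.+1%:R => d0 H.
have : S (sup S + d).
  by rewrite /S/=; have := cdfo_le_cdfc m (sup S + d); move: H d0; lra.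
by move=> /(ub_le_sup (proj2 supS)); move: d0; lra.
Qed.

Lemma xbar_at_level (b : R) : at_level (xbar m b) (b - xbar m b).
Proof.
have E : [set x : R | (x%:E + m [set` `]-oo, x[] <= b%:E)%E /\
    (b%:E <= x%:E + m [set` `]-oo, x]])%E] = [set x | at_level x (b - x)].
  apply/seteqP; split=> x /=; rewrite /at_level /cdfo /cdfc.
    rewrite -(fineK (fin_num_measure m `]-oo, x[%classic _))//.
    rewrite -(fineK (fin_num_measure m `]-oo, x]%classic _))//.
    by rewrite -!EFinD !lee_fin => -[x1 x2]; apply/andP; split; lra.
  move=> /andP[x1 x2].
  rewrite -(fineK (fin_num_measure m `]-oo, x[%classic _))//.
  rewrite -(fineK (fin_num_measure m `]-oo, x]%classic _))//.
  by rewrite -!EFinD !lee_fin; split; lra.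
rewrite /xbar E; have := @getPex R [set x | at_level x (b - x)]; apply.
exact: at_level_exists.
Qed.

Lemma xbar_eq (x c : R) : at_level x c -> xbar m (x + c) = x.
Proof.
move=> xc; have H := xbar_at_level (x + c).
have [|x1 _] := at_level_mono xc H; first by lra.
have [|x2 _] := at_level_mono H xc; first by lra.
by apply/eqP; rewrite eq_le x1 x2.
Qed.

Lemma xbar_mono (b b' : R) : b <= b' ->
  xbar m b <= xbar m b' /\ b - xbar m b <= b' - xbar m b'.
Proof.
move=> bb'; apply: at_level_mono; [exact: xbar_at_level|exact: xbar_at_level|].
by lra.
Qed.

Lemma xbar_lipschitz (b b' : R) : `|xbar m b - xbar m b'| <= `|b - b'|.
Proof.
have H (c c' : R) : c <= c' -> `|xbar m c - xbar m c'| <= `|c - c'|.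
  move=> cc'; have [h1 h2] := xbar_mono cc'.
  by rewrite ler0_norm ?subr_le0// ler0_norm ?subr_le0//; lra.
case: (leP b b') => [|/ltW] bb'; first exact: H.
by rewrite distrC [leRHS]distrC; exact: H.
Qed.

End Quantiles.

Section Lagrangian.
Context {R : realType}.
Notation lam := (@lebesgue_measure R).

Lemma sq_dx_le (m : Mplus R) (g : R -> R) (A : set (measurableTypeR R)) :
  ac_part_is_sq_dx m g -> measurable A -> (sq_dx g A <= m A)%E.
Proof.
move=> [mac [[_ [ms [_ H]]] E]] mA.
by rewrite -E// H// leeDl.
Qed.

(** From [2 |g| <= l + g^2 / l]. The weight [l = 1] gives the Lipschitz bound in [b], and the
    optimal weight gives the Cauchy-Schwarz form. The energy is taken over the open interval, so
    that atoms at the end points are not counted; this is needed when levels lie inside vertical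
    segments. *)
Lemma increment_energy (m : Mplus R) (f g : R -> R) (x y l : R) :
  continuous f -> weak_derivative f g -> ac_part_is_sq_dx m g ->
  x < y -> 0 < l ->
  2 * `|f y - f x| <= l * (y - x) + l^-1 * (cdfo m y - cdfc m x).
Proof.
move=> cf fg ac xy l0; have [ig _] := fg.
have mg : measurable_fun setT g by have [] := ig.
have igo : lam.-integrable `]x, y[ (EFin \o g).
  apply: integrableS (locally_integrable_itv x y ig) => //.
  exact: subset_itv_oo_cc.
rewrite (weak_derivative_increment cf fg (ltW xy)).
have -> : \int[lam]_(s in `[x, y]) g s = \int[lam]_(s in `]x, y[) g s.
  rewrite -Rintegral_itv_bndo_bndc -?Rintegral_itv_obnd_cbnd//.
  by apply: integrableS (locally_integrable_itv x y ig) => //; exact: subset_itv_co_cc.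
have H2 : (sq_dx g `]x, y[%classic <= m `]x, y[%classic)%E by exact: sq_dx_le.
have i2 : lam.-integrable `]x, y[ (EFin \o (fun s => g s ^+ 2)).
  apply/integrableP; split.
    apply/measurable_EFinP; apply: measurable_funX; exact: measurable_funTS.
  apply: le_lt_trans (_ : m `]x, y[%classic < +oo)%E.
    apply: le_trans H2; rewrite /sq_dx le_eqVlt; apply/orP; left; apply/eqP.
    by apply: eq_integral => s _ /=; rewrite ger0_norm ?sqr_ge0.
  by rewrite ltey_eq fin_num_measure.
have B2 : \int[lam]_(s in `]x, y[) (g s ^+ 2) <= cdfo m y - cdfc m x.
  by rewrite -cdfB//; apply: fine_le => //; rewrite ?fin_num_measure//;
    exact: integrable_fin_num.
have ic : lam.-integrable `]x, y[ (EFin \o cst l).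
  have : lam.-integrable `[x, y] (EFin \o cst l).
    apply: continuous_compact_integrable; first exact: segment_compact.
    exact/continuous_subspaceT/cst_continuous.
  by apply: integrableS => //; exact: subset_itv_oo_cc.
apply: le_trans (_ : \int[lam]_(s in `]x, y[) (cst l s + l^-1 * g s ^+ 2) <= _); last first.
  rewrite RintegralD//; last exact: integrableRZ.
  rewrite RintegralZl// Rintegral_cst//= lebesgue_measure_itv/= lte_fin xy -EFinB/=.
  by rewrite lerD2l ler_wpM2l// invr_ge0 ltW.
apply: le_trans (_ : 2 * \int[lam]_(s in `]x, y[) `|g s| <= _).
  by rewrite ler_wpM2l//; exact: le_normr_Rintegral.
rewrite -RintegralZl//; last exact: integrable_norm.
apply: le_Rintegral => //.
- by apply: integrableRZ => //; exact: integrable_norm.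
- by apply: integrableRD => //; exact: integrableRZ.
move=> s _; rewrite -[g s ^+ 2]real_normK ?num_real//.
set a := `|g s|.
have -> : cst l s + l^-1 * a ^+ 2 = l^-1 * (l - a) ^+ 2 + 2 * a.
  by rewrite /cst; field; rewrite gt_eqF.
by rewrite lerDr mulr_ge0 ?sqr_ge0// invr_ge0 ltW.
Qed.

Lemma increment_sqr (m : Mplus R) (f g : R -> R) (x y : R) :
  continuous f -> weak_derivative f g -> ac_part_is_sq_dx m g -> x < y ->
  (f y - f x) ^+ 2 <= (y - x) * (cdfo m y - cdfc m x).
Proof.
move=> cf fg ac xy.
have yx : 0 < y - x by rewrite subr_gt0.
rewrite -[leLHS]real_normK ?num_real//; set d := `|_|.
have : 0 <= d by exact: normr_ge0.
rewrite le_eqVlt => /predU1P[<-|d0].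
  rewrite expr0n/= mulr_ge0//; first exact: ltW.
  by rewrite subr_ge0; exact: cdfc_le_cdfo.
(* The optimal weight: it turns [l * (y - x)] into [d], which is absorbed on the left. *)
have l0 : 0 < d / (y - x) by rewrite divr_gt0.
have := increment_energy cf fg ac xy l0; rewrite -/d divfK ?gt_eqF//.
rewrite invf_div => H.
have {}H : d <= (y - x) / d * (cdfo m y - cdfc m x) by lra.
by rewrite expr2 -ler_pdivlMr// mulrAC.
Qed.

Variables (u ux : R -> R -> R) (nu : R -> Mplus R).
Hypothesis sol : is_solution u ux nu.

Definition position (b t : R) : R := xbar (nu t) b.
Definition velocity (b t : R) : R := u (position b t) t.

Lemma velocity_lipschitz (b b' t : R) :
  `|velocity b t - velocity b' t| <= 2^-1 * `|b - b'|.
Proof.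
have H (c c' : R) : c <= c' -> `|velocity c t - velocity c' t| <= 2^-1 * `|c - c'|.
  move=> cc'; have [h1 h2] := xbar_mono (nu t) cc'.
  have /andP[l1 l2] := xbar_at_level (nu t) c.
  have /andP[l1' l2'] := xbar_at_level (nu t) c'.
  (* Two labels inside the same atom share their position and hence their velocity. *)
  rewrite /velocity /position; move: h1; rewrite le_eqVlt => /predU1P[->|h1].
    by rewrite subrr normr0 mulr_ge0.
  have cu : continuous (u ^~ t) by have [/(_ t)[]] := sol_path sol.
  have := increment_energy cu (sol_dx sol t) (sol_ac sol t) h1 ltr01.
  rewrite invr1 !mul1r distrC (@ler0_norm _ (c - c')) ?subr_le0//.
  by set d := `|_|; lra.
case: (leP b b') => [|/ltW] bb'; first exact: H.
by rewrite distrC [`|b - b'|]distrC; exact: H.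
Qed.

(** When [b] advances at its own velocity, its position does so too, to first order. The level of
    [b] is squeezed between the two estimates of [transport_step]; a larger deviation of the
    quantile would contradict monotonicity of the distribution function. *)
Lemma position_step (b t d : R) : 0 < d ->
  exists2 r, 0 < r & forall h, `|h| < r ->
    `|position (b + h * velocity b t) (t + h) - (position b t + h * velocity b t)|
      <= d * `|h|.
Proof.
move=> d0; have [r r0 Hr] := transport_step sol (position b t) t d0.
exists r => // h hr; have [H1 H2] := Hr h hr.
rewrite -/(velocity b t) in H1 H2; set U := velocity b t in H1 H2 *.
set x0 := position b t in H1 H2 *.
have /andP[l1 l2] := xbar_at_level (nu t) b; rewrite -/(position b t) -/x0 in l1 l2.
have /andP[k1 k2] := xbar_at_level (nu (t + h)) (b + h * U).
rewrite -/(position _ _) in k1 k2; set x1 := position _ _ in k1 k2 *.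
have dh : 0 <= d * `|h| by rewrite mulr_ge0// ltW.
rewrite ler_norml; apply/andP; split; rewrite leNgt; apply/negP => H.
  have H3 : x1 < x0 + h * U - d * `|h| by lra.
  by have := cdfc_le_cdfo (nu (t + h)) H3; lra.
have H3 : x0 + h * U + d * `|h| < x1 by lra.
by have := cdfc_le_cdfo (nu (t + h)) H3; lra.
Qed.

Lemma position_continuous (b : R -> R) : continuous b ->
  continuous (fun t => position (b t) t).
Proof.
move=> cb t; apply/cvgrPdist_le => e e0.
have e20 : 0 < e / 2 by rewrite divr_gt0.
have [r r0 Hr] := position_step (b t) t ltr01.
have /cvgrPdist_le/(_ _ e20)[r2 /= r20 Hb] := cb t.
pose K := 2 * `|velocity (b t) t| + 1.
have K0 : 0 < K by rewrite ltr_wpDl// mulr_ge0.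
near=> s.
have sr : `|s - t| < r.
  by near: s; exists r => // z /=; rewrite distrC.
have sr2 : `|b t - b s| <= e / 2.
  by apply: Hb; near: s; exists r2.
have sK : `|s - t| < e / 2 / K.
  near: s; exists (e / 2 / K) => /=; first by rewrite divr_gt0.
  by move=> z; rewrite /= distrC.
have := Hr _ sr; rewrite mul1r [t + _]addrC subrK.
set U := velocity _ _ => H.
have L1 := xbar_lipschitz (nu s) (b t + (s - t) * U) (b t).
have L2 := xbar_lipschitz (nu s) (b t) (b s).
rewrite -!/(position _ _) in L1 L2.
have -> : position (b t) t - position (b s) s =
  - (position (b t + (s - t) * U) s - (position (b t) t + (s - t) * U))
  - (s - t) * U + (position (b t + (s - t) * U) s - position (b t) s)
  + (position (b t) s - position (b s) s) by ring.
have HK : `|s - t| * K <= e / 2 by rewrite -ler_pdivlMr// ltW.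
have E : b t + (s - t) * U - b t = (s - t) * U by ring.
rewrite E normrM in L1.
apply: le_trans (ler_normD _ _) _.
have := ler_normD (- (position (b t + (s - t) * U) s - (position (b t) t + (s - t) * U))
  - (s - t) * U) (position (b t + (s - t) * U) s - position (b t) s).
have := ler_normB (- (position (b t + (s - t) * U) s - (position (b t) t + (s - t) * U)))
  ((s - t) * U).
rewrite normrN normrM; move: HK; rewrite /K mulrDr mulrCA mulr1.
by rewrite -/U; lra.
Unshelve. all: by end_near. Qed.

Lemma curve_velocity_continuous (z : R -> R) : continuous z ->
  continuous (fun t => u (z t) t).
Proof.
move=> cz t; apply/cvgrPdist_le => e e0.
have [r r0 Hr] := velocity_jointly_continuous sol (z t) t e0.
near=> s; rewrite distrC; apply: Hr.
  by rewrite distrC; near: s; have /cvgrPdist_lt := cz t; exact.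
by near: s; exists r => // y /=; rewrite distrC.
Unshelve. all: by end_near. Qed.

Lemma velocity_continuous (b : R -> R) : continuous b ->
  continuous (fun t => velocity (b t) t).
Proof. by move=> cb; exact/curve_velocity_continuous/position_continuous. Qed.

End Lagrangian.

(** * Characteristics *)

Section Primitives.
Context {R : realType}.
Notation lam := (@lebesgue_measure R).

Lemma is_derive1P (f : R -> R) (x df : R) :
  is_derive x 1 f df <-> forall d, 0 < d -> exists2 r, 0 < r &
    forall h, `|h| < r -> `|f (x + h) - f x - h * df| <= d * `|h|.
Proof.
have E h : h != 0 -> `|df - h^-1 *: ((f \o shift x) (h *: 1) - f x)| =
    `|h|^-1 * `|f (x + h) - f x - h * df|.
  move=> h0; rewrite /= /GRing.scale/= mulr1 -normfV -normrM distrC [h + x]addrC.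
  by congr (`|_|); field.
split=> [[dfx Df] d d0|H].
  have : h^-1 *: ((f \o shift x) (h *: 1) - f x) @[h --> 0^'] --> df.
    by rewrite -Df; exact: dfx.
  move=> /cvgrPdist_le/(_ d d0)[r /= r0 Hr]; exists r => // h hr.
  have [->|h0] := eqVneq h 0.
    by rewrite addr0 subrr mul0r subrr normr0 mulr0.
  have := Hr h; rewrite /= sub0r normrN => /(_ hr h0); rewrite E//.
  by rewrite ler_pdivrMl ?normr_gt0// [d * _]mulrC.
have L : h^-1 *: ((f \o shift x) (h *: 1) - f x) @[h --> 0^'] --> df.
  apply/cvgrPdist_le => d d0; have [r r0 Hr] := H d d0.
  exists r => //= h; rewrite /= sub0r normrN => hr h0; rewrite E//.
  by rewrite ler_pdivrMl ?normr_gt0// [_ * d]mulrC; exact: Hr.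
apply: DeriveDef; first by apply/cvg_ex; exists df.
exact: cvg_lim L.
Qed.

Lemma is_derive_continuous (f : R -> R) (x df : R) :
  is_derive x 1 f df -> {for x, continuous f}.
Proof. by move=> [dfx _]; apply/differentiable_continuous/derivable1_diffP. Qed.

Lemma increment_bound (P g : R -> R) (T t K : R) :
  (forall s, `|s - T| <= `|t - T| -> is_derive s 1 P (g s) /\ `|g s| <= K) ->
  `|P t - P T| <= K * `|t - T|.
Proof.
move=> H.
have Hseg (a b : R) : a <= b -> (forall s, a <= s <= b -> is_derive s 1 P (g s) /\ `|g s| <= K) ->
    `|P b - P a| <= K * `|b - a|.
  move=> ab Hs; have [] := @MVT_segment R P g a b ab.
  - by move=> s; rewrite in_itv/= => /andP[/ltW as_ /ltW sb]; have [|] := Hs s; rewrite ?as_.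
  - apply: derivable_within_continuous => s; rewrite in_itv/= => sab.
    by have [[]] := Hs s sab.
  by move=> s; rewrite in_itv/= => sab ->; rewrite normrM ler_wpM2r//; have [] := Hs s sab.
case: (leP T t) => [Tt|/ltW tT].
  by apply: Hseg => // s sT; apply: H; rewrite !ger0_norm; lra.
rewrite distrC [`|t - T|]distrC; apply: Hseg => // s sT; apply: H.
by rewrite !ler0_norm; lra.
Qed.

(** The signed integral from 0 to [t]: at least one of the two terms runs over an empty or one-point
    interval. *)
Definition primitive (g : R -> R) (t : R) : R :=
  \int[lam]_(s in `[0, t]) g s - \int[lam]_(s in `[t, 0]) g s.

Lemma is_derive_integral (g : R -> R) (a t : R) : continuous g -> a < t ->
  is_derive t 1 (fun s => \int[lam]_(z in `[a, s]) g z) (g t).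
Proof.
move=> cg at_.
have tt1 : t < t + 1 by rewrite ltrDl.
have [||dF F'] := @continuous_FTC1 R g (BLeft a) t (t + 1) tt1
  (integrable_continuous_itv a (t + 1) cg).
- by rewrite /= lte_fin.
- exact: cg.
by move: F'; rewrite derive1E => F'; exact: (DeriveDef dF F').
Qed.

Lemma is_derive_primitive (g : R -> R) (t : R) : continuous g ->
  is_derive t 1 (primitive g) (g t).
Proof.
(* A base point to the left of both 0 and [t], because [is_derive_integral] differentiates only to
   the right of its lower end. *)
move=> cg; pose a := - (`|t| + 1).
have a0 : a < 0 by rewrite /a oppr_lt0 ltr_wpDl.
have at_ : a < t by rewrite /a ltrNl ltr_pwDr// -normrN ler_norm.
have ig := @integrable_continuous_itv R.
have D1 : is_derive t 1 (fun s => \int[lam]_(z in `[a, s]) g z -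
    \int[lam]_(z in `[a, 0]) g z) (g t).
  have := is_deriveB (is_derive_integral cg at_)
    (is_derive_cst (\int[lam]_(z in `[a, 0]) g z) t 1).
  by rewrite subr0.
apply: near_eq_is_derive D1.
near=> s; have as_ : a < s by near: s; exact: lt_nbhsr.
rewrite /primitive.
case: (ltgtP 0 s) => s0.
- rewrite (Rintegral_itv_split (ig g a s cg) (ltW a0) (ltW s0)).
  rewrite (_ : `[s, 0]%classic = set0) ?Rintegral_set0; first by ring.
  by apply: set_itv_ge; rewrite bnd_simp -ltNge.
- rewrite (Rintegral_itv_split (ig g a 0 cg) (ltW as_) (ltW s0)).
  rewrite (_ : `[0, s]%classic = set0) ?Rintegral_set0; first by ring.
  by apply: set_itv_ge; rewrite bnd_simp -ltNge.
- by rewrite -s0 set_itv1 Rintegral_set1; ring.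
Unshelve. all: by end_near. Qed.

Lemma weak_derivative_is_derive (f g : R -> R) (t : R) :
  continuous f -> continuous g -> weak_derivative f g -> is_derive t 1 f (g t).
Proof.
move=> cf cg fg.
have t1 : t - 1 < t by rewrite gtrBl.
have D1 : is_derive t 1 (fun s => \int[lam]_(z in `[t - 1, s]) g z + f (t - 1)) (g t).
  have := is_deriveD (is_derive_integral cg t1) (is_derive_cst (f (t - 1)) t 1).
  by rewrite addr0.
apply: near_eq_is_derive D1.
near=> s; have as_ : t - 1 < s by near: s; exact: lt_nbhsr.
by rewrite -(weak_derivative_increment cf fg (ltW as_)) subrK.
Unshelve. all: by end_near. Qed.

(** The intervals around [a n] whose radius is the geometric tail [2 * D / 2 ^+ n] are nested; the
    limit is the supremum of their left ends. *)
Lemma geometric_limit (a : nat -> R) (D : R) :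
  (forall n, `|a n.+1 - a n| <= D / 2 ^+ n) ->
  exists l, forall n, `|a n - l| <= 2 * D / 2 ^+ n.
Proof.
move=> H; pose e n : R := 2 * D / 2 ^+ n.
have eS n : e n.+1 = D / 2 ^+ n by rewrite /e exprS; field; rewrite expf_neq0.
have e2 n : e n = 2 * e n.+1 by rewrite eS /e; ring.
have D0 : 0 <= D by have := le_trans (normr_ge0 _) (H 0%N); rewrite expr0 divr1.
have e0 n : 0 <= e n by rewrite /e divr_ge0 ?exprn_ge0// mulr_ge0.
have cS : {homo (fun n => a n - e n) : n m / (n <= m)%N >-> n <= m}.
  apply/nondecreasing_seqP => n; have := H n; rewrite -eS (e2 n) ler_norml; lra.
have dS : {homo (fun n => - (a n + e n)) : n m / (n <= m)%N >-> n <= m}.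
  apply/nondecreasing_seqP => n; have := H n; rewrite -eS (e2 n) ler_norml; lra.
have cd n m : a n - e n <= a m + e m.
  have := cS _ _ (leq_maxl n m); have := dS _ _ (leq_maxr n m).
  by have := e0 (maxn n m); rewrite lerN2; lra.
exists (sup (range (fun n => a n - e n))) => n.
have ub : has_ubound (range (fun n => a n - e n)).
  by exists (a 0%N + e 0%N) => _ [m _ <-].
have h1 : a n - e n <= sup (range (fun n => a n - e n)).
  by apply: ub_le_sup => //; exists n.
have h2 : sup (range (fun n => a n - e n)) <= a n + e n.
  by apply: ge_sup; [exists (a n - e n); exists n|move=> _ [m _ <-]].
by rewrite -/(e n) ler_norml; lra.
Qed.

(** The Picard iterates converge on the unit interval around [T] only, whereas the field is
    evaluated along curves continuous on the whole line. Composing with this projection extends the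
    limit continuously. *)
Definition clamp (T t : R) : R := Num.max (T - 1) (Num.min (T + 1) t).

Lemma clamp_id (T t : R) : `|t - T| <= 1 -> clamp T t = t.
Proof.
rewrite ler_norml => tT; rewrite /clamp min_r; last by lra.
by rewrite max_r//; lra.
Qed.

Lemma clamp_dist (T t : R) : `|clamp T t - T| <= 1.
Proof.
rewrite /clamp ler_norml maxEle minEle.
by case: (leP (T + 1) t) => h1; case: (leP (T - 1) _) => h2; lra.
Qed.

Lemma clamp_continuous (T : R) : continuous (clamp T).
Proof.
have cm (f g : R -> R) : continuous f -> continuous g ->
    continuous (fun x => Num.max (f x) (g x)).
  by move=> cf cg x; apply: continuous_max; [exact: cf|exact: cg].
have cn (f g : R -> R) : continuous f -> continuous g ->
    continuous (fun x => Num.min (f x) (g x)).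
  by move=> cf cg x; apply: continuous_min; [exact: cf|exact: cg].
apply: cm; first exact: cst_continuous.
by apply: cn => [|x]; [exact: cst_continuous|exact: cvg_id].
Qed.

(* Picard iteration: on a unit interval a field of Lipschitz constant 1/2 is a contraction. *)
Lemma local_flow (V : R -> R -> R) (T b0 : R) :
  (forall b b' t, `|V b t - V b' t| <= 2^-1 * `|b - b'|) ->
  (forall b, continuous b -> continuous (fun t => V (b t) t)) ->
  exists b : R -> R, [/\ continuous b, b T = b0 &
    forall t, `|t - T| <= 1 -> is_derive t 1 b (V (b t) t)].
Proof.
move=> LV cV.
pose next (b : R -> R) t := b0 + (primitive (fun s => V (b s) s) t
  - primitive (fun s => V (b s) s) T).
have dnext (b : R -> R) (t : R) : continuous b -> is_derive t 1 (next b) (V (b t) t).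
  move=> cb; have dP := is_derive_primitive t (cV b cb).
  have dc := is_derive_cst (primitive (fun s => V (b s) s) T) t 1.
  have := is_deriveD (is_derive_cst b0 t 1) (is_deriveB dP dc).
  by rewrite add0r subr0.
have cnext b : continuous b -> continuous (next b).
  by move=> cb t; exact: is_derive_continuous (dnext b t cb).
have nextT b : next b T = b0 by rewrite /next subrr addr0.
have contr b b' e t : continuous b -> continuous b' -> `|t - T| <= 1 ->
    (forall s, `|s - T| <= 1 -> `|b s - b' s| <= e) ->
    `|next b t - next b' t| <= 2^-1 * e.
  move=> cb cb' tT be.
  have e0 : 0 <= e by apply: le_trans (be T _); rewrite ?subrr ?normr0.
  have := @increment_bound (fun s => next b s - next b' s)
    (fun s => V (b s) s - V (b' s) s) T t (2^-1 * e).
  rewrite !nextT subrr subr0 => H; apply: le_trans (H _) _.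
    move=> s st; split; first exact: is_deriveB (dnext b s cb) (dnext b' s cb').
    by apply: le_trans (LV _ _ _) _; rewrite ler_wpM2l// be// (le_trans st).
  by rewrite ler_piMr// mulr_ge0.
pose bn n := iter n next (cst b0).
have cbn n : continuous (bn n).
  by elim: n => [|n IH] /=; [exact: cst_continuous|exact: cnext].
have [D HD] : exists D, forall t, `|t - T| <= 1 -> `|bn 1%N t - bn 0%N t| <= D.
  have [|M _ HM] := @continuous_bounded_itv R (fun t => bn 1%N t - bn 0%N t) (T - 1) (T + 1).
    by move=> t; apply: cvgB; exact: cbn.
  exists M => t tT; apply: HM.
  by rewrite in_itv/=; move: tT; rewrite ler_norml; lra.
have Hn n t : `|t - T| <= 1 -> `|bn n.+1 t - bn n t| <= D / 2 ^+ n.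
  elim: n t => [|n IH] t tT; first by rewrite expr0 divr1; exact: HD.
  rewrite exprS invfM mulrCA; exact: (@contr (bn n.+1) (bn n)).
have /choice[bh Hbh] : forall t, exists l, forall n,
    `|bn n (clamp T t) - l| <= 2 * D / 2 ^+ n.
  by move=> t; apply: geometric_limit => n; exact/Hn/clamp_dist.
have small (e : R) : 0 < e -> exists n, 2 * D / 2 ^+ n <= e.
  move=> e0; have D0 : 0 <= D by apply: le_trans (HD T _); rewrite ?subrr ?normr0.
  have De0 : 0 <= e^-1 * (2 * D) by rewrite !mulr_ge0// invr_ge0 ltW.
  exists (Num.bound (e^-1 * (2 * D))); rewrite ler_pdivrMr ?exprn_gt0// -ler_pdivrMl//.
  apply: le_trans (ltW (archi_boundP De0)) _.
  by rewrite -natrX ler_nat ltnW// ltn_expl.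
have cbh : continuous bh.
  move=> t; apply/cvgrPdist_le => e e0.
  have e30 : 0 < e / 3 by rewrite divr_gt0.
  have [n Hsm] := small _ e30.
  have : continuous (bn n \o clamp T).
    by move=> s; apply: continuous_comp; [exact: clamp_continuous|exact: cbn].
  move=> /(_ t)/cvgrPdist_le/(_ _ e30); apply: filterS => s /= Hs.
  have -> : bh t - bh s = - (bn n (clamp T t) - bh t) +
    (bn n (clamp T t) - bn n (clamp T s)) + (bn n (clamp T s) - bh s) by ring.
  apply: le_trans (ler_normD _ _) _.
  have := ler_normD (- (bn n (clamp T t) - bh t)) (bn n (clamp T t) - bn n (clamp T s)).
  by rewrite normrN; have := Hbh t n; have := Hbh s n; lra.
have fix_eq t : `|t - T| <= 1 -> next bh t = bh t.
  move=> tT; apply/eqP; rewrite -subr_eq0 -normr_le0; apply/ler_addgt0Pl => e e0.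
  rewrite addr0; have [n Hsm] := small _ e0.
  have h1 : `|next bh t - bn n.+1 t| <= 2^-1 * (2 * D / 2 ^+ n).
    apply: contr => // s sT; rewrite distrC; have := Hbh s n.
    by rewrite clamp_id.
  have h2 := Hbh t n.+1; rewrite clamp_id// in h2.
  have E : 2 * D / 2 ^+ n.+1 = 2^-1 * (2 * D / 2 ^+ n).
    by rewrite exprS; field; rewrite expf_neq0.
  rewrite E in h2.
  have -> : next bh t - bh t = (next bh t - bn n.+1 t) + (bn n.+1 t - bh t) by ring.
  apply: le_trans (ler_normD _ _) _; lra.
(* The clamped limit [bh] is constant outside the unit interval and may have corners at its ends;
   [next bh] agrees with it on the interval and is differentiable everywhere. *)
exists (next bh); split; [exact: cnext|exact: nextT|].
by move=> t tT; rewrite [in V _ _]fix_eq//; exact: dnext.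
Qed.

End Primitives.

(** * Conservation of the level along the flow *)

Section Characteristics.
Context {R : realType}.
Variables (u ux : R -> R -> R) (nu : R -> Mplus R).
Hypothesis sol : is_solution u ux nu.

Lemma characteristic (T x0 c : R) : at_level (nu T) x0 c ->
  exists x : R -> R, [/\ continuous x, x T = x0 &
    forall t, `|t - T| <= 1 ->
      at_level (nu t) (x t) c /\ is_derive t 1 x (u (x t) t)].
Proof.
move=> x0c.
have [b [cb bT db]] := @local_flow R (velocity u nu) T (x0 + c)
  (velocity_lipschitz sol) (velocity_continuous sol).
pose z t := position nu (b t) t.
have cz : continuous z by exact: (position_continuous sol cb).
(* The position [z] is not known to be differentiable, so [b - z] is expanded directly. Three errors
   arise: the expansion of [b], that of the position at [b + h * U], and the passage from there to
   [b (t + h)], controlled by the Lipschitz bound on the quantile. *)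
have dg (t : R) : `|t - T| <= 1 -> is_derive t 1 (fun s => b s - z s) 0.
  move=> tT; apply/is_derive1P => d d0.
  have d30 : 0 < d / 3 by rewrite divr_gt0.
  have [r1 r10 H1] := position_step sol (b t) t d30.
  have [r2 r20 H2] := (is_derive1P _ _ _).1 (db t tT) _ d30.
  exists (Num.min r1 r2); first by rewrite lt_min r10.
  move=> h; rewrite lt_min => /andP[h1 h2].
  have := H2 h h2; have := H1 h h1; set U := velocity u nu (b t) t => {}H1 {}H2.
  have := xbar_lipschitz (nu (t + h)) (b (t + h)) (b t + h * U).
  rewrite -!/(position _ _ _) -/(z (t + h)) => H3.
  rewrite mulr0 subr0.
  have -> : b (t + h) - z (t + h) - (b t - z t) = (b (t + h) - b t - h * U)
    - (z (t + h) - position nu (b t + h * U) (t + h))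
    - (position nu (b t + h * U) (t + h) - (z t + h * U)) by ring.
  apply: le_trans (ler_normB _ _) _.
  have := ler_normB (b (t + h) - b t - h * U)
    (z (t + h) - position nu (b t + h * U) (t + h)).
  rewrite -/(z t) in H1.
  have H3' : `|b (t + h) - (b t + h * U)| <= d / 3 * `|h|.
    by rewrite opprD addrA.
  lra.
have zT : z T = x0 by rewrite /z /position bT; exact: xbar_eq.
have bz t : `|t - T| <= 1 -> b t - z t = c.
  move=> tT; apply/eqP; rewrite -subr_eq0 -normr_le0.
  have -> : c = b T - z T by rewrite bT zT addrC addKr.
  have := @increment_bound R (fun s => b s - z s) (cst 0) T t 0.
  rewrite mul0r; apply=> s st; split; last by rewrite normr0.
  by apply: dg; exact: le_trans tT.
have xz t : `|t - T| <= 1 -> b t - c = z t.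
  by move=> tT; rewrite -(bz t tT) subKr.
exists (fun t => b t - c); split.
- by move=> t; apply: cvgB; [exact: cb|exact: cvg_cst].
- by rewrite bT addrK.
move=> t tT; rewrite xz//; split.
  by rewrite -(bz t tT); exact: xbar_at_level.
have := is_deriveB (db t tT) (is_derive_cst c t 1).
by rewrite subr0.
Qed.

End Characteristics.

(** * Acceleration along characteristics *)

Section Acceleration.
Context {R : realType}.
Notation lam := (@lebesgue_measure R).

Lemma derive1_kern_bound : exists2 K : R, 0 <= K &
  forall z e x, 0 < e -> `|derive1 (kern z e) x| <= e^-1 * (e^-1 * K).
Proof.
have tb : test_function (@bump R).
  rewrite (_ : bump = kern 0 1); first exact: kern_test.
  by apply/funext => x; rewrite /kern invr1 mul1r subr0 mulr1.
have [K HK] := test_function_bounded (test_function_derive1 tb).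
exists K => [|z e x e0]; first exact: le_trans (HK 0).
have dk : is_derive x 1 (kern z e) (e^-1 * (derive1 bump ((x - z) / e) * e^-1)).
  have := @is_derive1_comp R bump (fun x : R => (x - z) / e) x _ _
    (test_function_is_derive ((x - z) / e) tb) (is_derive_affine z e x).
  move=> /(is_deriveM (is_derive_cst (e^-1 : R) x 1)).
  by rewrite scaler0 addr0.
rewrite (derive1_eq dk) [_ * e^-1]mulrC !normrM !(@ger0_norm _ e^-1) ?invr_ge0 ?(ltW e0)//.
by rewrite !ler_wpM2l// invr_ge0 ltW.
Qed.

Lemma Rintegral_derive1_kern (z e : R) : 0 < e ->
  \int[lam]_x derive1 (kern z e) x = 0.
Proof.
move=> e0; have tk := kern_test z e0.
rewrite (@Rintegral_restrict _ _ _ lam `[z - 1, z + e + 1]%classic); last first.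
  move=> x /negP xz; apply: kern_derive1_out => //; apply: contra xz.
  by rewrite !in_itv/=; lra.
have zz : z - 1 < z + e + 1 by lra.
rewrite /Rintegral (@continuous_FTC2 R (derive1 (kern z e)) (kern z e))//.
- have -> : kern z e (z + e + 1) = 0.
    by rewrite kern_out// in_itv/= negb_and -!ltNge; apply/orP; right; rewrite ltrDl.
  have -> : kern z e (z - 1) = 0.
    by rewrite kern_out// in_itv/= negb_and -!ltNge; apply/orP; left; rewrite gtrBl.
  by rewrite sube0.
- exact/continuous_subspaceT/test_function_continuous/test_function_derive1.
- split.
  + by move=> x _; have [] := test_function_is_derive x tk.
  + exact/cvg_at_right_filter/kern_continuous.
  + exact/cvg_at_left_filter/kern_continuous.
Qed.

Lemma Rintegral_ramp_bounds (m : Mplus R) (z e : R) : 0 < e ->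
  cdfc m z <= \int[m]_x (1 - ramp z e x) <= cdfc m (z + e).
Proof.
move=> e0.
have ir : m.-integrable setT (EFin \o (fun x => 1 - ramp z e x)).
  by apply: integrable_Cb; have [/(_ 0)] := Cb_path_ramp e0 (@cst_continuous _ _ z).
have patch x : \int[m]_y ((fun=> 1 : R) \_ `]-oo, x]%classic) y = cdfc m x.
  by rewrite -Rintegral_mkcond Rintegral_cst// mul1r.
rewrite -!patch; apply/andP; split.
  apply: le_Rintegral => //; first exact: integrable_patch1.
  move=> x _; rewrite patchE; case: ifPn => [|_]; last by rewrite subr_ge0 ramp_le1.
  by rewrite inE/= in_itv/= => xz; rewrite ramp_le// subr0.
apply: le_Rintegral => //; first exact: integrable_patch1.
move=> x _; rewrite patchE; case: ifPn => [_|/negP].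
  by rewrite gerBl ramp_ge0.
rewrite inE/= in_itv/= => /negP; rewrite -ltNge => xz.
by rewrite ramp_ge ?subrr// ltW.
Qed.

Variables (u ux : R -> R -> R) (nu : R -> Mplus R).
Hypothesis sol : is_solution u ux nu.

Lemma slice_continuous t : continuous (u ^~ t).
Proof. by have [/(_ t)[]] := sol_path sol. Qed.

(* With [k = u z t] the flux integrand becomes [(u - k)^2 / 2], which the energy controls. *)
Lemma average_rate_bound : exists2 K : R, 0 <= K & forall z e t, 0 < e ->
  `|average_rate u nu z e (u z t) t - 2^-1 * cdfc (nu t) z| <=
  K * (cdfc (nu t) (z + e) - cdfc (nu t) z).
Proof.
have [K K0 HK] := derive1_kern_bound.
exists (2^-1 * K + 2^-1) => [|z e t e0]; first by rewrite addr_ge0// mulr_ge0.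
have cu : continuous (u ^~ t) by exact: slice_continuous.
set k := u z t; set m := nu t.
have /andP[r1 r2] := Rintegral_ramp_bounds m z e0.
have iK' (g : R -> R) : continuous g ->
    lam.-integrable setT (EFin \o (fun x => g x * derive1 (kern z e) x)).
  move=> cg; apply: (@integrable_mul_csupp _ (derive1 (kern z e)) g z (z + e)) => //.
  - exact/test_function_continuous/test_function_derive1/kern_test.
  - by move=> x; exact: kern_derive1_out.
  - exact: continuous_locally_integrable.
have cq : continuous (fun x => 2^-1 * (u x t - k) ^+ 2).
  move=> x; apply: cvgM; first exact: cvg_cst.
  by apply: cvgM; apply: cvgB; [exact: cu|exact: cvg_cst|exact: cu|exact: cvg_cst].
have E : \int[lam]_x ((u x t ^+ 2 / 2 - k * u x t) * derive1 (kern z e) x) =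
    \int[lam]_x (2^-1 * (u x t - k) ^+ 2 * derive1 (kern z e) x).
  (* The derivative of the kernel has integral zero, so the constant [k^2 / 2] can be added to
     complete the square. *)
  rewrite -[RHS]subr0 -(mulr0 (2^-1 * k ^+ 2)) -(Rintegral_derive1_kern z e0).
  have i1 : lam.-integrable setT (EFin \o derive1 (kern z e)).
    have := iK' (cst 1) (@cst_continuous _ _ _).
    rewrite (_ : (fun x => cst 1 x * _) = derive1 (kern z e))//.
    by apply/funext => x; rewrite mul1r.
  rewrite -RintegralZl// -RintegralB//.
  - by apply: eq_Rintegral => x _; field.
  - exact: iK'.
  - exact: integrableRZ.
have M0 : 0 <= cdfc m (z + e) - cdfc m z.
  by rewrite subr_ge0; apply: le_cdfc; rewrite lerDl ltW.
have B1 : `|\int[lam]_x (2^-1 * (u x t - k) ^+ 2 * derive1 (kern z e) x)| <=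
    2^-1 * K * (cdfc m (z + e) - cdfc m z).
  rewrite (@Rintegral_restrict _ _ _ lam `[z, z + e]%classic); last first.
    by move=> x /negP xz; rewrite kern_derive1_out// mulr0.
  have ii : lam.-integrable `[z, z + e]
      (EFin \o (fun x => 2^-1 * (u x t - k) ^+ 2 * derive1 (kern z e) x)).
    by apply: integrableS (iK' _ cq).
  apply: le_trans (le_normr_Rintegral _ ii) _ => //.
  (* By [increment_sqr] the squared increment is at most [e] times the mass of the window, the
     derivative of the kernel is of size [e^-2], and the interval has length [e]: all powers of [e]
     cancel. *)
  pose c := 2^-1 * (e * (cdfc m (z + e) - cdfc m z)) * (e^-1 * (e^-1 * K)).
  apply: le_trans (_ : \int[lam]_(x in `[z, z + e]) (cst c x) <= _).
    apply: le_Rintegral => //.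
    - exact: integrable_norm ii.
    - by apply: integrable_continuous_itv; exact: cst_continuous.
    move=> x; rewrite /= in_itv/= => /andP[zx xe]; rewrite normrM.
    apply: ler_pM => //; last exact: HK.
    have q0 : 0 <= 2^-1 * (u x t - k) ^+ 2 by rewrite mulr_ge0 ?sqr_ge0.
    rewrite (ger0_norm q0) ler_wpM2l//.
    move: zx; rewrite le_eqVlt => /predU1P[<-|zx].
      by rewrite subrr expr0n/= mulr_ge0// ltW.
    apply: le_trans (increment_sqr cu (sol_dx sol t) (sol_ac sol t) zx) _.
    apply: ler_pM.
    - by rewrite subr_ge0 ltW.
    - by rewrite subr_ge0; exact: cdfc_le_cdfo.
    - by rewrite lerBlDl.
    - by rewrite lerD2r; apply: le_trans (cdfo_le_cdfc _ _) (le_cdfc _ _).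
  rewrite Rintegral_cst//= lebesgue_measure_itv/= lte_fin ltrDl e0 -EFinB/=.
  rewrite le_eqVlt; apply/orP; left; apply/eqP; rewrite /c; field.
  by rewrite gt_eqF.
rewrite /average_rate E; move: B1; rewrite !ler_norml.
set I1 := \int[lam]_x _; set I2 := \int[m]_x _ in r1 r2 *.
set d := _ - _ in M0 *; set Kd := 2^-1 * K * d => B1.
have -> : (2^-1 * K + 2^-1) * d = Kd + 2^-1 * d by rewrite /Kd; ring.
rewrite /d; lra.
Qed.

(** The width [e] is fixed here and the constant may degenerate with it; what matters is that [L]
    does not depend on time. *)
Lemma average_lipschitz (e : R) : 0 < e -> exists2 L : R, 0 <= L &
  forall C t z z', (forall x, `|u x t| <= C) -> `|z - z'| <= 1 ->
  `|average u z e t - average u z' e t| <= C * L * `|z - z'|.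
Proof.
move=> e0; have [L0 [L00 HL0]] := test_function_lipschitz (kern_test 0 e0).
exists (L0 * (1 + e)) => [|C t z z' HC zz']; first by rewrite mulr_ge0// addr_ge0// ltW.
have cu : continuous (u ^~ t) by exact: slice_continuous.
(* As [z] and [z'] are at distance at most 1, an interval of length [1 + e] contains both
   windows. *)
pose a := Num.min z z'; pose b := a + 1 + e.
have az : a <= z by rewrite ge_min lexx.
have az' : a <= z' by rewrite ge_min lexx orbT.
have zb : z <= a + 1 by move: zz'; rewrite ler_norml /a minEle; case: ifP; lra.
have zb' : z' <= a + 1 by move: zz'; rewrite ler_norml /a minEle; case: ifP; lra.
have ik w : lam.-integrable setT (EFin \o (fun x => u x t * kern w e x)).
  apply: (@integrable_mul_csupp _ (kern w e) (u ^~ t) w (w + e)).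
  - exact: kern_continuous.
  - by move=> x; exact: kern_out.
  - exact: continuous_locally_integrable.
rewrite /average -RintegralB// (@Rintegral_restrict _ _ _ lam `[a, b]%classic); last first.
  move=> x /negP xab; rewrite !kern_out ?mulr0 ?subrr//; apply: contra xab;
  by rewrite !in_itv/= /b => /andP[? ?]; apply/andP; split; lra.
have ii : lam.-integrable `[a, b]
    (EFin \o (fun x => u x t * kern z e x - u x t * kern z' e x)).
  by apply: integrableRB => //; apply: integrableS (ik _).
apply: le_trans (le_normr_Rintegral _ ii) _ => //.
have C0 : 0 <= C := le_trans (normr_ge0 _) (HC 0).
apply: le_trans (_ : \int[lam]_(x in `[a, b]) (cst (C * (L0 * `|z - z'|)) x) <= _).
  apply: le_Rintegral => //.
  - exact: integrable_norm ii.
  - by apply: integrable_continuous_itv; exact: cst_continuous.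
  move=> x _; rewrite -mulrBr normrM ler_pM// [kern z e x]kern_shift [kern z' e x]kern_shift.
  apply: le_trans (HL0 _ _) _; rewrite ler_wpM2l// distrC le_eqVlt; apply/orP; left.
  by apply/eqP; congr (`|_|); ring.
have ab : a < b by rewrite /b -addrA ltrDl addr_gt0.
rewrite Rintegral_cst//= lebesgue_measure_itv/= lte_fin ab -EFinB/= /b.
by rewrite le_eqVlt; apply/orP; left; apply/eqP; ring.
Qed.

(** The rate is known for windows on straight lines. At the time [t] the curve is replaced by its
    tangent of speed [k]; it leaves this line by o(h) only, and [average_lipschitz] carries this
    over to the averages. *)
Lemma is_derive_average (x : R -> R) (e t : R) : 0 < e ->
  is_derive t 1 x (u (x t) t) ->
  is_derive t 1 (fun s => average u (x s) e s) (average_rate u nu (x t) e (u (x t) t) t).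
Proof.
move=> e0 dx; set k := u (x t) t in dx *.
pose a := x t - k * t.
have cz : continuous (fun s : R => a + k * s).
  by move=> s; apply: cvgD; [exact: cvg_cst|apply: cvgM; [exact: cvg_cst|exact: cvg_id]].
have dA := weak_derivative_is_derive t (average_continuous sol e0 cz)
  (average_rate_continuous sol e0 cz (@cst_continuous _ _ k))
  (average_weak_derivative sol a k e0).
have atx : a + k * t = x t by rewrite /a; ring.
rewrite /= atx in dA.
have [L L0 HL] := average_lipschitz e0.
have [C [r0 [r00 HC]]] := locally_bounded sol t.
apply/is_derive1P => d d0.
have C0 : 0 <= C.
  have [H _] := HC t ltac:(by rewrite subrr normr0).
  exact: le_trans (H 0).
(* The 1 keeps curve and tangent within the range of [average_lipschitz]; the other term absorbs its
   constant [C * L]. *)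
pose d1 := Num.min 1 (d / 2 / (C * L + 1)).
have CL0 : 0 < C * L + 1 by rewrite ltr_wpDl// mulr_ge0.
have d10 : 0 < d1 by rewrite lt_min ltr01 !divr_gt0.
have d20 : 0 < d / 2 by rewrite divr_gt0.
have [r1 r10 H1] := (is_derive1P _ _ _).1 dx _ d10.
have [r2 r20 H2] := (is_derive1P _ _ _).1 dA _ d20.
exists (Num.min (Num.min r0 r1) (Num.min r2 1)).
  by rewrite !lt_min r00 r10 r20 ltr01.
move=> h; rewrite !lt_min => /andP[/andP[h0 h1] /andP[h2 h3]].
have [HCh _] := HC (t + h) ltac:(by rewrite addrAC subrr add0r).
have {}H1 := H1 h h1; have {}H2 := H2 h h2.
have E1 : x (t + h) - (a + k * (t + h)) = x (t + h) - x t - h * k by rewrite /a; ring.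
rewrite -E1 in H1.
have x1 : `|x (t + h) - (a + k * (t + h))| <= 1.
  apply: le_trans H1 _; rewrite -[leRHS]mulr1 ler_pM ?(ltW d10)//; last exact: ltW.
  by rewrite ge_min lexx.
have H3 := HL C (t + h) _ _ HCh x1.
have H4 : C * L * `|x (t + h) - (a + k * (t + h))| <= d / 2 * `|h|.
  apply: le_trans (_ : C * L * (d1 * `|h|) <= _).
    by rewrite ler_wpM2l// mulr_ge0.
  rewrite mulrA ler_wpM2r//.
  have : d1 <= d / 2 / (C * L + 1) by rewrite ge_min lexx orbT.
  rewrite ler_pdivlMr// mulrDr mulr1 mulrC => H; apply: le_trans H.
  by rewrite lerDl ltW.
rewrite atx in H2.
have split3 (p q r s : R) : p - q - s = (r - q - s) + (p - r) by ring.
rewrite (split3 _ _ (average u (a + k * (t + h)) e (t + h))).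
apply: le_trans (ler_normD _ _) _; rewrite [d in leRHS]splitr mulrDl lerD//.
exact: le_trans H3 H4.
Qed.

(** At almost every time [mu(t)] is [u_x^2 dx], and then the level of a characteristic is the value
    of [F] on it. *)
Lemma ae_no_atom :
  {ae lam, forall t : R, forall x, cdfo (nu t) x = cdfc (nu t) x}.
Proof.
apply: (@filterS _ _ (ae_filter_ringOfSetsType lam) _ _ _ (sol_ae sol)) => t Ht x.
rewrite /cdfo /cdfc; congr fine.
rewrite !Ht// /sq_dx integral_itv_bndo_bndc//.
have [[mg _ _] _] := sol_dx sol t.
by apply/measurable_EFinP; apply: measurable_funX; exact: measurable_funTS.
Qed.

(** The derivative of the averaged velocity is integrated in time at fixed width before the width
    shrinks. On the left continuity of [u] suffices; on the right [ae_no_atom] identifies the limit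
    of the rates as [c / 2] for almost every time, and dominated convergence passes to the
    integral. *)
Lemma characteristic_acceleration (x : R -> R) (c t1 t2 : R) : continuous x ->
  (forall t, t1 <= t <= t2 -> at_level (nu t) (x t) c /\ is_derive t 1 x (u (x t) t)) ->
  t1 < t2 ->
  u (x t2) t2 - u (x t1) t1 = c / 2 * (t2 - t1).
Proof.
move=> cx Hx t12.
pose W n t := average u (x t) n.+1%:R^-1 t.
pose E n t := average_rate u nu (x t) n.+1%:R^-1 (u (x t) t) t.
have e0 n : (0 : R) < n.+1%:R^-1 by rewrite invr_gt0.
have cE n : continuous (E n).
  apply: (average_rate_continuous sol (e0 n) cx).
  exact: (curve_velocity_continuous sol cx).
have cW n : continuous (W n) by exact: (average_continuous sol (e0 n) cx).
have dW n t : t1 <= t <= t2 -> is_derive t 1 (W n) (E n t).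
  by move=> tt; apply: is_derive_average => //; have [] := Hx t tt.
have FTC n : W n t2 - W n t1 = \int[lam]_(t in `[t1, t2]) E n t.
  rewrite /Rintegral (@continuous_FTC2 R (E n) (W n))//.
  - exact/continuous_subspaceT/cE.
  - split.
    + move=> t; rewrite in_itv/= => /andP[/ltW h1 /ltW h2].
      by have [|//] := dW n t; first by rewrite h1.
    + exact/cvg_at_right_filter/cW.
    + exact/cvg_at_left_filter/cW.
  - move=> t; rewrite in_itv/= => /andP[/ltW h1 /ltW h2].
    by apply: derive1_eq; apply: dW; rewrite h1.
have lim1 : W n t2 - W n t1 @[n --> \oo] --> u (x t2) t2 - u (x t1) t1.
  by apply: cvgB; apply: (kern_average_cvg (f := u ^~ _)); exact: slice_continuous.
have [K K0 HK] := average_rate_bound.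
have [M M0 HM] := @continuous_bounded_itv R _ t1 t2
  (mass_continuous (sol_weak sol)).
have mass_bound t y : t1 <= t <= t2 -> 0 <= cdfc (nu t) y <= M.
  move=> tt; rewrite fine_ge0//=; apply: le_trans (cdfc_le_mass _ _) _.
  by apply: le_trans (ler_norm _) _; apply: HM; rewrite in_itv.
have lim2 : \int[lam]_(t in `[t1, t2]) E n t @[n --> \oo] -->
    \int[lam]_(t in `[t1, t2]) (cst (c / 2) t).
  (* [M] bounds the mass on [[t1, t2]]; by [average_rate_bound] each rate is at most [K * M] plus
     half a value of the distribution function. *)
  apply: (@Rdominated_convergence _ _ _ lam _ _ _ (cst (M + K * M))) => //.
  - by move=> n; apply: measurable_funTS; exact: continuous_measurable_fun.
  - apply: (@filterS _ _ (ae_filter_ringOfSetsType lam) _ _ _ ae_no_atom) => t Ht.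
    rewrite /= in_itv/= => tt.
    have [/andP[l1 l2] _] := Hx t tt.
    have -> : c / 2 = 2^-1 * cdfc (nu t) (x t) by rewrite -Ht in l2 *; lra.
    have cv : K * (cdfc (nu t) (x t + 1 / n.+1%:R) - cdfc (nu t) (x t)) @[n --> \oo] --> (0 : R).
      rewrite -[X in _ --> X](mulr0 K) -(subrr (cdfc (nu t) (x t))).
      apply: cvgM; first exact: cvg_cst.
      by apply: cvgB; [exact: cdfc_right_cvg|exact: cvg_cst].
    apply/cvgrPdist_le => d d0; have /cvgrPdist_le/(_ d d0) := cv.
    apply: filterS => n; rewrite sub0r normrN => H.
    rewrite distrC; apply: le_trans (HK _ _ _ (e0 n)) _.
    by apply: le_trans H; rewrite div1r; exact: ler_norm.
  - by apply: integrable_continuous_itv; exact: cst_continuous.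
  - move=> n t; rewrite /= in_itv/= => tt.
    have := HK (x t) _ t (e0 n); rewrite -/(E n t).
    have /andP[q1 q2] := mass_bound t (x t) tt.
    have /andP[p1 p2] := mass_bound t (x t + n.+1%:R^-1) tt.
    set Q := cdfc _ (x t) in q1 q2 *; set P := cdfc _ _ in p1 p2 * => H.
    have : K * (P - Q) <= K * M by rewrite ler_wpM2l//; lra.
    have -> : E n t = (E n t - 2^-1 * Q) + 2^-1 * Q by ring.
    move=> H2; apply: le_trans (ler_normD _ _) _.
    by rewrite (@ger0_norm _ (_ * Q)) ?mulr_ge0//; lra.
have -> : c / 2 * (t2 - t1) = \int[lam]_(t in `[t1, t2]) (cst (c / 2) t).
  by rewrite Rintegral_cst//= lebesgue_measure_itv/= lte_fin t12 -EFinB.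
have FTC' : (fun n => W n t2 - W n t1) = (fun n => \int[lam]_(t in `[t1, t2]) E n t).
  by apply/funext.
by rewrite FTC' in lim1; exact: (cvg_unique _ lim1 lim2).
Qed.

End Acceleration.

(** * Representation of conservative solutions *)

Section Representation.
Context {R : realType}.
Notation lam := (@lebesgue_measure R).

Section Flow.
Variables (u ux : R -> R -> R) (nu : R -> Mplus R).
Hypothesis sol : is_solution u ux nu.

Lemma local_representation (T x0 c h : R) : at_level (nu T) x0 c -> `|h| <= 1 ->
  at_level (nu (T + h)) (x0 + u x0 T * h + h ^+ 2 / 4 * c) c /\
  u (x0 + u x0 T * h + h ^+ 2 / 4 * c) (T + h) = u x0 T + c / 2 * h.
Proof.
move=> x0c h1; have [x [cx xT Hx]] := characteristic sol x0c.
have acc t : `|t - T| <= 1 -> u (x t) t = u x0 T + c / 2 * (t - T).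
  move=> tT; case: (ltgtP T t) => [Tt|tT'|<-]; last by rewrite subrr mulr0 addr0 xT.
    rewrite -(characteristic_acceleration sol cx _ Tt) ?xT; first by ring.
    move=> s sT; apply: Hx; apply: le_trans tT.
    by rewrite !ger0_norm; lra.
  have := characteristic_acceleration sol cx _ tT'; rewrite xT.
  have Hs s : t <= s <= T -> at_level (nu s) (x s) c /\ is_derive s 1 x (u (x s) s).
    move=> sT; apply: Hx; apply: le_trans tT.
    by rewrite !ler0_norm; lra.
  by move=> /(_ _ Hs) E; apply: (addIr (- u x0 T)); rewrite -[LHS]opprB E; ring.
(* The deviation from the quadratic formula. Inserting the known velocity, its increment over [k]
   differs from o(k) by [k * (k * c / 4)] only, so it is constant. *)
pose P t := x t - (x0 + u x0 T * (t - T) + (t - T) ^+ 2 / 4 * c).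
have dP (t : R) : `|t - T| <= 1 -> is_derive t 1 P 0.
  move=> tT; have [_ dx] := Hx t tT; apply/is_derive1P => d d0.
  have d20 : 0 < d / 2 by rewrite divr_gt0.
  have [r r0 Hr] := (is_derive1P _ _ _).1 dx _ d20.
  have c0 : 0 < `|c| + 1 by rewrite ltr_wpDl.
  exists (Num.min r (d / 2 / (`|c| + 1))); first by rewrite lt_min r0 divr_gt0.
  move=> k; rewrite lt_min => /andP[kr kc].
  have := Hr k kr; rewrite acc// => H.
  have -> : P (t + k) - P t - k * 0 =
      (x (t + k) - x t - k * (u x0 T + c / 2 * (t - T))) - k * (k * c / 4).
    by rewrite /P; field.
  apply: le_trans (ler_normB _ _) _; rewrite [d]splitr mulrDl lerD//.
  rewrite normrM mulrC ler_wpM2r// !normrM [`|4^-1|]ger0_norm//.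
  move: kc; rewrite ltr_pdivlMr// mulrDr mulr1 => kc.
  have : 0 <= `|k| * `|c| by rewrite mulr_ge0.
  have := normr_ge0 k; lra.
have xE : x (T + h) = x0 + u x0 T * h + h ^+ 2 / 4 * c.
  have Th : T + h - T = h by rewrite addrAC subrr add0r.
  have := @increment_bound R P (cst 0) T (T + h) 0.
  rewrite mul0r Th => H; have {}H : P (T + h) - P T = 0.
    apply/eqP; rewrite -normr_le0; apply: H => s sh; split; last by rewrite normr0.
    by apply: dP; exact: le_trans h1.
  have PT : P T = 0 by rewrite /P xT !subrr; ring.
  by move: H; rewrite PT subr0 /P Th => /eqP; rewrite subr_eq0 => /eqP.
have Th : `|T + h - T| <= 1 by rewrite addrAC subrr add0r.
rewrite -xE; split; first by have [] := Hx _ Th.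
by rewrite acc// addrAC subrr add0r.
Qed.

(** The formula is consistent under composition: restarting it at time [T + l] with the level [c]
    and the velocity reached there reproduces the same parabola. Steps of length at most 1 can
    therefore be chained. *)
Lemma representation (T x0 c h : R) : at_level (nu T) x0 c ->
  at_level (nu (T + h)) (x0 + u x0 T * h + h ^+ 2 / 4 * c) c /\
  u (x0 + u x0 T * h + h ^+ 2 / 4 * c) (T + h) = u x0 T + c / 2 * h.
Proof.
move=> x0c.
suff H n : forall h, `|h| <= n%:R ->
  at_level (nu (T + h)) (x0 + u x0 T * h + h ^+ 2 / 4 * c) c /\
  u (x0 + u x0 T * h + h ^+ 2 / 4 * c) (T + h) = u x0 T + c / 2 * h.
  by apply: (H (Num.bound `|h|)); exact/ltW/archi_boundP.
elim: n => [|n IH] {}h.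
  rewrite normr_le0 => /eqP ->.
  by rewrite expr0n/= !mul0r !mulr0 !addr0.
(* One of [n.+1] equal pieces: [k] has modulus at most 1 and the rest [l = n * k] has modulus at
   most [n]. *)
move=> hn; pose k := h / n.+1%:R; pose l := h - k.
have n0 : (0 : R) < n.+1%:R by [].
have k1 : `|k| <= 1 by rewrite normrM normfV (gtr0_norm n0) ler_pdivrMr// mul1r.
have ln : `|l| <= n%:R.
  have -> : l = n%:R * k by rewrite /l /k -natr1; field; rewrite natr1 gt_eqF.
  by rewrite normrM normr_nat ler_piMr.
have [lev1 u1] := IH l ln.
have [lev2 u2] := local_representation lev1 k1.
rewrite u1 in lev2 u2.
have Th : T + l + k = T + h by rewrite /l -addrA subrK.
have xh : x0 + u x0 T * l + l ^+ 2 / 4 * c + (u x0 T + c / 2 * l) * k + k ^+ 2 / 4 * c =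
    x0 + u x0 T * h + h ^+ 2 / 4 * c by rewrite /l; field.
rewrite Th xh in lev2 u2; split=> //; rewrite u2 /l; ring.
Qed.

Lemma cdfc_cvg_mass (m : Mplus R) : cdfc m n%:R @[n --> \oo] --> fine (m setT).
Proof.
apply: (@fine_cvg_measure R m setT (fun n => [set` `]-oo, n%:R]])) => //.
have -> : setT = \bigcup_n ([set` `]-oo, n%:R]] : set R).
  apply/seteqP; split=> // x _; exists (Num.bound `|x|) => //=.
  by rewrite in_itv/= (le_trans (ler_norm x))// ltW// archi_boundP.
apply: nondecreasing_cvg_mu => //; first by apply: bigcup_measurable => n _.
by move=> p q pq; apply/subsetPset/subset_itvl; rewrite bnd_simp ler_nat.
Qed.

(** Every level [F(n, s)] is transported to a level at time [s'], hence is at most the mass there;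
    let [n] grow and exchange the two times. *)
Lemma mass_conserved (t t' : R) : nu t setT = nu t' setT.
Proof.
have H s s' : fine (nu s setT) <= fine (nu s' setT).
  apply: (cvgr_to_le (@cdfc_cvg_mass (nu s))); apply: nearW => n.
  have lev : at_level (nu s) n%:R (cdfc (nu s) n%:R).
    by rewrite /at_level lexx andbT; exact: cdfo_le_cdfc.
  have [] := representation (s' - s) lev.
  rewrite [s + _]addrC subrK => /andP[_ H] _.
  exact: le_trans H (cdfc_le_mass _ _).
rewrite -[LHS]fineK ?fin_num_measure// -[RHS]fineK ?fin_num_measure//.
by congr EFin; apply/eqP; rewrite eq_le !H.
Qed.

End Flow.

Lemma finite_measure_ext (m m' : {measure set (measurableTypeR R) -> \bar R}) :
  (forall x : R, m [set` `]-oo, x]] = m' [set` `]-oo, x]]) ->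
  (forall x : R, (m [set` `]-oo, x]] < +oo)%E) ->
  forall A, measurable A -> m A = m' A.
Proof.
move=> mm' fin; apply: (@measure_unique _ R (measurableTypeR R) (@ocitv R)
  (fun n => `](- n%:R), n%:R]%classic)) => //.
- exact: ocitvI.
- by move=> n; exact: is_ocitv.
- apply/seteqP; split=> // x _; exists (Num.bound `|x|) => //=.
  have : `|x| < (Num.bound `|x|)%:R by exact: archi_boundP.
  by rewrite in_itv/= ltr_norml => /andP[-> /ltW].
- move=> _ [[a b] _ <-] /=; case: (leP b a) => ab.
    by rewrite set_itv_ge ?measure0// bnd_simp -leNgt.
  have diff (n : {measure set (measurableTypeR R) -> \bar R}) :
      (n [set` `]-oo, a]] < +oo)%E ->
      n `]a, b]%classic = (n [set` `]-oo, b]] - n [set` `]-oo, a]])%E.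
    move=> nfin; have -> : [set` `]-oo, b]] = [set` `]-oo, a]] `|` `]a, b]%classic :> set R.
      apply/seteqP; split=> z /=; rewrite !in_itv/=.
        by move=> zb; case: (leP z a) => za; [left|right].
      by case=> [za|/andP[]//]; exact: le_trans (ltW ab).
    rewrite measureU//; first by rewrite addeAC subee ?add0e// ge0_fin_numE.
    apply/seteqP; split=> z //= []; rewrite !in_itv/= => za /andP[az _].
    by have := lt_le_trans az za; rewrite ltxx.
  by rewrite !diff// -?mm'.
- move=> n; apply: le_lt_trans (fin n%:R); apply: le_measure; rewrite ?inE//.
  by apply: subset_itvr; rewrite bnd_simp.
Qed.

(** The difference has integral zero over every interval, so Lebesgue differentiation makes it
    vanish almost everywhere on each half-line []-n, +oo[]. *)
Lemma weak_derivative_unique (f g g' : R -> R) : continuous f ->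
  weak_derivative f g -> weak_derivative f g' -> {ae lam, forall x, g x = g' x}.
Proof.
move=> cf fg fg'; have [ig _] := fg; have [ig' _] := fg'.
pose d x := g x - g' x.
have id' : locally_integrable setT d by exact: locally_integrableB.
have d0 a b : \int[lam]_(x in `[a, b]) d x = 0.
  case: (leP a b) => ab; last by rewrite set_itv_ge ?Rintegral_set0// bnd_simp -ltNge.
  rewrite RintegralB//; try exact: locally_integrable_itv.
  by rewrite -!(weak_derivative_increment cf)// subrr.
have H n : {ae lam, forall x, - n%:R < x -> d x = 0}.
  have := @FTC1 R d (BLeft (- n%:R)) _ id'.
  move=> /(_ (fun y => locally_integrable_itv (- n%:R) y id')).
  apply: (@filterS _ _ (ae_filter_ringOfSetsType lam)) => x /= Hx nx.
  have [_ <-] := Hx ltac:(by rewrite lte_fin).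
  by apply: derive1_eq; rewrite (_ : (fun _ => _) = cst 0); [exact: is_derive_cst|apply/funext].
apply: (@filterS _ _ (ae_filter_ringOfSetsType lam) _ _ _ (ae_foralln H)) => x Hx.
have : d x = 0.
  apply: (Hx (Num.bound `|x|)).
  by rewrite ltrNl (le_lt_trans (ler_norm _))// normrN archi_boundP.
by move=> /eqP; rewrite subr_eq0 => /eqP.
Qed.

Lemma sq_dx_ae_eq (g g' : R -> R) (A : set (measurableTypeR R)) : measurable A ->
  measurable_fun setT g -> measurable_fun setT g' ->
  {ae lam, forall x, g x = g' x} -> sq_dx g A = sq_dx g' A.
Proof.
move=> mA mg mg' gg'; apply: ae_eq_integral => //.
- by apply/measurable_EFinP; apply: measurable_funX; exact: measurable_funTS.
- by apply/measurable_EFinP; apply: measurable_funX; exact: measurable_funTS.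
- by apply: (@filterS _ _ (ae_filter_ringOfSetsType lam) _ _ _ gg') => x -> _.
Qed.

(** The singular part is carried by a Lebesgue-null set, which [m] does not charge either, so it is
    zero. *)
Lemma dominated_ac_part (m : Mplus R) (g : R -> R) (A : set (measurableTypeR R)) :
  ac_part_is_sq_dx m g -> m `<< lam -> measurable A -> m A = sq_dx g A.
Proof.
move=> [mac [[_ [ms [[N [mN msN lamN]] H]]] E]] mlam mA.
have mlam' : content_dominates lam m by exact/null_content_dominatesP.
have mCN : measurable (~` N) by exact: measurableC.
have msCN : ms (~` N) = 0%E.
  have := mlam' _ mCN lamN; rewrite H// => /eqP.
  by rewrite padde_eq0// => /andP[_ /eqP].
have msA : ms A = 0%E.
  apply/eqP; rewrite eq_le measure_ge0 andbT.
  apply: le_trans (_ : ms setT <= _)%E; first by apply: le_measure; rewrite ?inE.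
  rewrite -(setUv N); apply: le_trans (measureU2 _ _ _) _ => //.
  by rewrite [X in (X + _)%E]msN [X in (_ + X)%E]msCN adde0.
by rewrite H// msA adde0 E.
Qed.

Lemma sqr_Lnorm2 (g : R -> R) :
  ('N[lam]_2%:E[EFin \o g] ^+ 2)%E = sq_dx g setT.
Proof.
have n20 : (2 : R) != 0 by [].
have L0 : (0 <= 'N[lam]_2%:E[EFin \o g])%E by exact: Lnorm_ge0.
have -> : ('N[lam]_2%:E[EFin \o g] ^+ 2 = 'N[lam]_2%:E[EFin \o g] `^ 2)%E.
  case: ('N[lam]_2%:E[EFin \o g])%E L0 => [r| |]//.
    by rewrite lee_fin => r0; rewrite poweR_EFin powR_mulrn// EFin_expe.
  by move=> _; rewrite poweRyr// expe2 mulyy.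
rewrite powR_Lnorm//; apply: eq_integral => x _ /=.
by rewrite powR_mulrn// real_normK ?num_real.
Qed.

Lemma uniform_Cb_path (u : R -> R -> R) : (forall t, Cb (u ^~ t)) ->
  (forall t0, {uniform, (fun t => u ^~ t) @ t0 --> u ^~ t0}) -> Cb_path u.
Proof.
move=> Cu uu; split=> // t0 e e0.
have := uu t0 [set h | forall x, ball (u x t0) e (h x)].
rewrite /= => /(_ _)H.
have : nbhs (u ^~ t0 : {uniform R -> R}) [set h | forall x, ball (u x t0) e (h x)].
  apply/uniform_nbhs; exists [set p | ball p.1 e p.2]; split.
    exact: (entourage_ball _ (PosNum e0)).
  by move=> h Hh x; exact: Hh.
move=> /H; apply: filterS => t /= Ht x; rewrite distrC; exact/ltW/Ht.
Qed.

End Representation.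

(** * Comparison with a time of absolute continuity *)

Section MainStatement.
Context {R : realType}.
Notation lam := (@lebesgue_measure R).
Variables (u ux : R -> R -> R) (nu : R -> Mplus R).
Hypothesis sol : is_solution u ux nu.
Variables (s : R) (vx : R -> R).
Hypothesis ns : forall A, measurable A -> nu s A = sq_dx vx A.
Hypothesis mvx : measurable_fun setT vx.

Lemma ac_no_atom x : cdfo (nu s) x = cdfc (nu s) x.
Proof.
rewrite /cdfo /cdfc; congr fine; rewrite !ns// /sq_dx integral_itv_bndo_bndc//.
by apply/measurable_EFinP; apply: measurable_funX; exact: measurable_funTS.
Qed.

Lemma sq_cumulativeE x : sq_cumulative vx x = cdfc (nu s) x.
Proof. by rewrite -ac_no_atom /cdfo ns. Qed.

(** Without atoms at time [s], each [xi] carries exactly one level, and the parabola starting there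
    is [map_X]. *)
Lemma map_X_at_level (xi t : R) :
  at_level (nu t) (map_X (u ^~ s) vx xi (t - s)) (sq_cumulative vx xi) /\
  u (map_X (u ^~ s) vx xi (t - s)) t = u xi s + (t - s) / 2 * sq_cumulative vx xi.
Proof.
have lev : at_level (nu s) xi (sq_cumulative vx xi).
  by rewrite /at_level sq_cumulativeE ac_no_atom lexx.
have := representation sol (t - s) lev; rewrite [s + _]addrC subrK.
by rewrite -/(map_X (u ^~ s) vx xi (t - s)) => -[l ->]; split=> //; field.
Qed.

(** If the levels differ, conservation of levels forces the order of the positions. If they agree,
    there is no energy between the two points, so the velocity is the same at both by
    [increment_sqr] and they are translated by the same amount. *)
Lemma map_X_mono (t xi xi' : R) : xi <= xi' ->
  map_X (u ^~ s) vx xi (t - s) <= map_X (u ^~ s) vx xi' (t - s).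
Proof.
rewrite le_eqVlt => /predU1P[->//|xx'].
have [/andP[l1 l2] _] := map_X_at_level xi t.
have [/andP[l1' l2'] _] := map_X_at_level xi' t.
have := le_cdfc (nu s) (ltW xx'); rewrite -!sq_cumulativeE le_eqVlt => /predU1P[E|lt_c].
  have cu : continuous (u ^~ s) by exact: slice_continuous sol _.
  have := increment_sqr cu (sol_dx sol s) (sol_ac sol s) xx'.
  rewrite ac_no_atom -!sq_cumulativeE E subrr mulr0 => H.
  have : u xi' s - u xi s = 0 by apply/eqP; rewrite -sqrf_eq0 eq_le H sqr_ge0.
  by move=> /eqP; rewrite subr_eq0 => /eqP uE; rewrite /map_X uE E !lerD2r ltW.
rewrite leNgt; apply/negP => H.
by have := cdfc_le_cdfo (nu t) H; lra.
Qed.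

(** Finite measures are compared on half-lines. By monotonicity the preimage of []-oo, a]] is a
    half-line ending at [sup S]; whether it contains its end point does not affect its mass, since
    [mu(s)] has no atoms. *)
Lemma map_X_pushforward (t : R) (A : set (measurableTypeR R)) : measurable A ->
  nu t A = pushforward (sq_dx vx) (map_X (u ^~ s) vx ^~ (t - s)) A.
Proof.
pose X := map_X (u ^~ s) vx ^~ (t - s).
have mX : measurable_fun setT (X : measurableTypeR R -> measurableTypeR R).
  by apply: nondecreasing_measurable => // x y; exact: map_X_mono.
have mXA (B : set (measurableTypeR R)) : measurable B -> measurable (X @^-1` B).
  by move=> mB; rewrite -[X in measurable X]setTI; exact: mX.
(* [sq_dx vx] is a bare set function; the structure of a measure is taken from [nu s], which agrees
   with it on measurable sets. *)
have [pm Hpm] : exists pm : {measure set (measurableTypeR R) -> \bar R},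
    forall B, pm B = nu s (X @^-1` B).
  by unshelve eexists (pushforward (nu s) (X : measurableTypeR R -> measurableTypeR R)).
suff H : forall B, measurable B -> nu t B = pm B.
  by move=> mA; rewrite H// Hpm ns//; exact: mXA.
apply: finite_measure_ext => a; last by rewrite ltey_eq fin_num_measure.
rewrite Hpm.
have /CbP[_ [B HB]] : Cb (u ^~ s) by have [] := sol_path sol.
pose S := [set xi | X xi <= a].
pose M := fine (nu s setT).
have M0 : 0 <= M by exact: fine_ge0.
have cumM xi : 0 <= sq_cumulative vx xi <= M.
  by rewrite sq_cumulativeE fine_ge0//=; exact: cdfc_le_mass.
(* [X] stays within bounded distance of the identity, so [S] is nonempty and bounded above. *)
have XB xi : xi - B * `|t - s| <= X xi <= xi + B * `|t - s| + (t - s) ^+ 2 / 4 * M.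
  have /andP[c0 cM] := cumM xi; have tt : 0 <= (t - s) ^+ 2 / 4 by rewrite divr_ge0 ?sqr_ge0.
  have : `|u xi s * (t - s)| <= B * `|t - s| by rewrite normrM ler_wpM2r.
  rewrite ler_norml => /andP[b1 b2].
  have := mulr_ge0 tt c0; have := ler_wpM2l tt cM; rewrite /X /map_X; lra.
have supS : has_sup S.
  split.
    exists (a - (B * `|t - s| + (t - s) ^+ 2 / 4 * M)); rewrite /S/=.
    by have /andP[_] := XB (a - (B * `|t - s| + (t - s) ^+ 2 / 4 * M)); lra.
  exists (a + B * `|t - s|) => xi; rewrite /S/= => Xa.
  by have /andP[+ _] := XB xi; lra.
(* Levels to the left of [sup S] are carried to positions at most [a], those to the right beyond
   [a]; together they determine [cdfc (nu t) a] by continuity at [sup S]. *)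
have below xi : xi < sup S -> cdfc (nu s) xi <= cdfc (nu t) a.
  rewrite -subr_gt0 => xs; have [y Sy xy] := sup_adherent xs supS.
  have {}xy : xi < y by rewrite subKr in xy.
  apply: le_trans (le_cdfc _ (ltW xy)) _.
  have [/andP[_ l2] _] := map_X_at_level y t; rewrite -sq_cumulativeE.
  by apply: le_trans l2 _; exact: le_cdfc.
have above xi : sup S < xi -> cdfc (nu t) a <= cdfc (nu s) xi.
  move=> sx; have Xa : a < X xi.
    rewrite ltNge; apply/negP => Sxi.
    by have := ub_le_sup (proj2 supS) Sxi; lra.
  have [/andP[l1 _] _] := map_X_at_level xi t; rewrite -sq_cumulativeE.
  exact: le_trans (cdfc_le_cdfo _ Xa) l1.
have n0 n : (0 : R) < 1 / n.+1%:R by rewrite divr_gt0.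
have eq1 : cdfc (nu t) a = cdfc (nu s) (sup S).
  apply/eqP; rewrite eq_le; apply/andP; split.
    apply: (cvgr_to_ge (@cdfc_right_cvg R (nu s) (sup S) 1 ltr01)).
    by apply: nearW => n; apply: above; rewrite ltrDl.
  rewrite -ac_no_atom.
  apply: (cvgr_to_le (@cdfo_left_cvg R (nu s) (sup S) 1 ltr01)).
  by apply: nearW => n; apply: below; rewrite gtrBl.
have subS : [set` `]-oo, sup S[] `<=` X @^-1` [set` `]-oo, a]].
  move=> xi /=; rewrite !in_itv/= => xs.
  rewrite -subr_gt0 in xs; have [y Sy xy] := sup_adherent xs supS.
  rewrite subKr in xy; apply: le_trans Sy; exact/map_X_mono/ltW.
have Ssub : X @^-1` [set` `]-oo, a]] `<=` [set` `]-oo, sup S]].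
  by move=> xi /=; rewrite !in_itv/= => xs; exact: ub_le_sup (proj2 supS) _ xs.
have mS : measurable (X @^-1` [set` `]-oo, a]] : set (measurableTypeR R)) by exact: mXA.
rewrite -[LHS]fineK ?fin_num_measure// -[RHS]fineK ?fin_num_measure//; congr EFin.
rewrite -/(cdfc _ _) eq1; apply/eqP; rewrite eq_le; apply/andP; split.
  by rewrite -ac_no_atom; exact: fine_measure_le.
exact: fine_measure_le.
Qed.

End MainStatement.

Theorem theorem1p2 (R : realType) (u0 : R -> R) (mu0 : Mplus R)
    (u : R -> R -> R) (mu : R -> Mplus R) (s : R)
    (hD : datum u0 mu0)
    (hsol : conservative_solution u0 mu0 u mu)
    (hs : mu s `<< lebesgue_measure) :
  let v : R -> R := u ^~ s in
  Cb v /\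
  (exists2 vx : R -> R, weak_derivative v vx & L2 vx) /\
  forall vx : R -> R, weak_derivative v vx ->
    (('N[lebesgue_measure]_2%:E[EFin \o vx] ^+ 2)%E = mu0 setT) /\
    forall t : R,
      [/\ char_y u0 mu0 ^~ t = (map_X v vx ^~ (t - s)) \o (char_y u0 mu0 ^~ s),
          (forall A : set (measurableTypeR R), measurable A ->
             mu t A = pushforward (sq_dx vx) (map_X v vx ^~ (t - s)) A) &
          forall x xi : R, x = map_X v vx xi (t - s) ->
            [/\ derivable (fun t' : R => map_X v vx xi (t' - s)) t 1,
                u x t = derive1 (fun t' : R => map_X v vx xi (t' - s)) t &
                u x t = v xi + (t - s) / 2 * sq_cumulative vx xi]].
Proof.
move=> v; have [ux [[[Cu uu] _ _ dux wc] [[u00 mu00] hae hvel hcont hac]]] := hsol.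
have sol : is_solution u ux mu.
  by split=> //; [exact: uniform_Cb_path|move=> t; have [] := dux t].
have [wv L2v] := dux s.
split; first exact: Cu.
split; first by exists (ux ^~ s).
move=> vx wvx.
have cv : continuous v by have [] := Cu s.
have mvx : measurable_fun setT vx by have [[]] := wvx.
have mux : measurable_fun setT (ux ^~ s) by have [[]] := wv.
(* The statement allows any representative of the weak derivative, while the solution comes with its
   own; they agree almost everywhere. *)
have aev := weak_derivative_unique cv wv wvx.
have ns A : measurable A -> mu s A = sq_dx vx A.
  by move=> mA; rewrite (dominated_ac_part (hac s) hs)//; exact: sq_dx_ae_eq.
split.
  by rewrite sqr_Lnorm2 -ns// (mass_conserved sol s 0) mu00.
have rep0 a t : at_level (mu t) (char_y u0 mu0 a t) (a - xbar mu0 a) /\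
    u (char_y u0 mu0 a t) t = u0 (xbar mu0 a) + (a - xbar mu0 a) / 2 * t.
  have lev : at_level (mu 0) (xbar mu0 a) (a - xbar mu0 a).
    by have := xbar_at_level mu0 a; rewrite /at_level /cdfo /cdfc !mu00.
  have := representation sol t lev.
  by rewrite add0r u00 -/(char_y u0 mu0 a t).
move=> t; split.
- apply/funext => a /=.
  have [/andP[l1 l2] us] := rep0 a s.
  (* At time [s] the vertical segments are points, so the label [a - xbar mu0 a] of the
     characteristic must equal the value of the distribution function. The composition formula is
     then the expansion of one parabola about [s] instead of 0. *)
  have c_eq : sq_cumulative vx (char_y u0 mu0 a s) = a - xbar mu0 a.
    apply/eqP; rewrite (sq_cumulativeE ns mvx) eq_le l2 andbT.
    by rewrite -(ac_no_atom ns mvx).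
  by rewrite /map_X /v us c_eq /char_y; field.
- by move=> A mA; exact: (map_X_pushforward sol ns mvx).
- move=> x xi ->.
  have [_ ut] := map_X_at_level sol ns mvx xi t.
  have dX : is_derive t 1 (fun t' : R => map_X v vx xi (t' - s))
      (v xi + (t - s) / 2 * sq_cumulative vx xi).
    apply/is_derive1P => d d0; set c := sq_cumulative vx xi.
    have c0 : 0 < `|c| + 1 by rewrite ltr_wpDl.
    exists (d / (`|c| + 1)); first by rewrite divr_gt0.
    move=> k; rewrite ltr_pdivlMr// mulrDr mulr1 => kc.
    have -> : map_X v vx xi (t + k - s) - map_X v vx xi (t - s) -
        k * (v xi + (t - s) / 2 * c) = k * (k * c / 4).
      by rewrite /map_X -/c; field.
    rewrite normrM mulrC ler_wpM2r// !normrM [`|4^-1|]ger0_norm//.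
    have : 0 <= `|k| * `|c| by rewrite mulr_ge0.
    have := normr_ge0 k; lra.
  split; first by have [] := dX.
  + by rewrite (derive1_eq dX).
  + exact: ut.
Qed.
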